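(* Let $\Theta=(\Theta_p)$, indexed by the prime numbers $p$, be a sequence of independent $[0,\pi]$-valued random variables. Suppose that (C1) for each $\epsilon>0$ one has $\mathbb{E}[\cos\Theta_p]\ll_\epsilon p^{-\frac12+\epsilon}$ for all primes $p$; and (C2) there is an absolute constant $\delta>0$ with $\mathbb{E}[(\cos\Theta_p)^2]\geq\delta$ for all primes $p$. Then: (i) Let $s=\sigma+it$ be a fixed complex number with $\sigma>1/2$ and $t\neq0$. There exists a continuous function $\mathcal{M}_s(\cdot,\Theta):\mathbb{C}\to\mathbb{R}_{\geq0}$ such that $$\mathbb{P}(\log L(s,\Theta)\in A)=\int_A\mathcal{M}_s(w,\Theta)\,|dw|$$ for all Borel sets $A\subset\mathbb{C}$, where $|dw|=(2\pi)^{-1}du\,dv$ for $w=u+iv$. (ii) Let $\sigma>1/2$ be a fixed real number. There exists a continuous function $\mathcal{M}_\sigma(\cdot,\Theta):\mathbb{R}\to\mathbb{R}_{\geq0}$ such that $$\mathbb{P}(\log L(\sigma,\Theta)\in A)=\int_A\mathcal{M}_\sigma(u,\Theta)\,|du|$$ for all Borel sets $A\subset\mathbb{R}$, where $|du|=(2\pi)^{-1/2}du$.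
   Context: The random Euler product is $L(s,\Theta)=\prod_p\left(1-\frac{2\cos\Theta_p}{p^s}+\frac{1}{p^{2s}}\right)^{-1}$, and $\log L(s,\Theta)$ denotes the random variable $\sum_p\sum_{m\geq1}\frac{2\cos(m\Theta_p)}{m}p^{-ms}$ (i.e. the sum over $p$ of $-\log(1-2(\cos\Theta_p)p^{-s}+p^{-2s})$, each term given by its power series in $p^{-s}$); under (C1) this series converges almost surely for $\mathrm{Re}(s)>1/2$. For real $\sigma$, $\log L(\sigma,\Theta)$ is real-valued. *)

(* Defs.v *)
From HB Require Import structures.
From mathcomp Require Import all_boot all_order all_algebra.
From mathcomp Require Import complex.
From mathcomp Require Import all_classical all_reals all_analysis.

Set Implicit Arguments.
Unset Strict Implicit.
Unset Printing Implicit Defensive.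

Import Order.TTheory GRing.Theory Num.Theory.
Import numFieldNormedType.Exports.

Local Open Scope classical_set_scope.
Local Open Scope ring_scope.
Local Open Scope complex_scope.

(* [R[i]^o] is the complex plane with the topology of the complex modulus: the
   library puts a topology on the regular module [K^o] of a [numFieldType] [K],
   but not on the concrete type [R[i]] itself. *)

Definition cexp (R : realType) (z : R[i]) : R[i] :=
  (expR (complex.Re z))%:C *
  (cos (complex.Im z) +i* sin (complex.Im z)).

(* [n ^ z] with the principal logarithm, for [0 < n]. *)
Definition natpowC (R : realType) (n : nat) (z : R[i]) : R[i] :=
  cexp (z * (ln n%:R)%:C).

Definition mutually_independent d (T : measurableType d) (R : realType)
    (P : probability T R) (I : eqType) (D : pred I) (X : I -> T -> R) : Prop :=
  forall (J : seq I) (B : I -> set R),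
    uniq J -> all D J -> (forall i, measurable (B i)) ->
    P (\big[setI/setT]_(i <- J) (X i @^-1` B i)) =
    (\prod_(i <- J) P (X i @^-1` B i))%E.

(* The series of [-log (1 - 2 (cos Theta_p) p^-s + p^-2s)], each term expanded in
   powers of [p^-s], with [p] increasing; [Theta] is only used at primes. Outside
   the event where the series over [p] converges, [lim] takes a fixed default
   value. *)
Definition logL d (T : measurableType d) (R : realType)
    (Theta : nat -> T -> R) (s : R[i]) (x : T) : R[i] :=
  limn (fun N => \sum_(0 <= p < N | prime p)
    limn (fun K => \sum_(1 <= m < K)
      (2 * cos (m%:R * Theta p x) / m%:R)%:C * natpowC p (- (m%:R * s))
      : R[i]^o)).

Definition borelC (R : realType) (A : set R[i]) : Prop :=
  <<s [set U : set R[i]^o | open U] >> A.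

(* [|dw| = (2 pi)^-1 du dv] and [|du| = (2 pi)^(-1/2) du]. *)
Definition integral_dw (R : realType) (A : set R[i]) (f : R[i] -> R) : \bar R :=
  (((2 * pi)^-1)%:E *
   \int[(@lebesgue_measure R \x @lebesgue_measure R)%E]_(z in
       [set z | A (z.1 +i* z.2)]) (f (z.1 +i* z.2))%:E)%E.

Definition integral_du (R : realType) (A : set R) (f : R -> R) : \bar R :=
  (((Num.sqrt (2 * pi))^-1)%:E *
   \int[@lebesgue_measure R]_(u in A) (f u)%:E)%E.

(* Main.v *)
(* Write xi = r (cos alpha, sin alpha). The scalar product of xi and log L(s, Theta) is
   a sum over p of independent variables Z_p, where
   Z_p = 2 r p^-sigma cos Theta_p cos (t log p + alpha) + O(r p^(-2 sigma)).
   By (C1) and (C2), |E exp (i Z_p)|^2 <= exp (- c (r p^-sigma)^2 cos^2 (t log p + alpha))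
   as soon as cos^2 (t log p + alpha) dominates p^(-1/2) + (r p^-sigma)^2. Primes of a
   short interval at which cos (t log p + alpha) is small are close to each other, so
   Chebyshev's lower bound for the number of primes leaves enough good primes, of size a
   suitable power of r, to make the characteristic function decay faster than any power
   of r; for t = 0 only the real part matters, |cos alpha| = 1 and every prime is good.
   Fourier inversion then gives a Lipschitz density. It is carried out with the damping
   factor exp (- xi / n), whose cosine transform is the Cauchy kernel, on the positive
   orthant, which suffices because products of cosines are even. The series itself
   converges almost surely because its increments over dyadic blocks of primes have
   bounded exponential moments. *)
Require Import Defs.
From HB Require Import structures.
From mathcomp Require Import all_boot all_order all_algebra.
From mathcomp Require Import complex.
From mathcomp Require Import all_classical all_reals all_analysis.
From mathcomp Require Import measurable_realfun.
From mathcomp Require Import zify ring lra.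

Set Implicit Arguments.
Unset Strict Implicit.
Unset Printing Implicit Defensive.

Import Order.TTheory GRing.Theory Num.Theory.
Import numFieldNormedType.Exports.

Local Open Scope classical_set_scope.
Local Open Scope ring_scope.
Local Open Scope complex_scope.

(** * Elementary inequalities *)

(** All Fourier analysis is done with real cosines. The squared modulus of E exp (i Z) enters as (E
    cos Z)^2 + (E sin Z)^2; for |Z| <= 1 the first square is at most 1 - E Z^2 / 8 and the second at
    most 2 (E Z)^2 + 2 (E Z^2)^2. Thus (C2) is the gain and (C1) limits the loss: used with the
    exponent -1/4 it makes (E cos Theta_p)^2 of order p^(-1/2), which is why cos^2 of the phase has
    to beat p^(-1/2). The obstacle is that alpha is arbitrary and no prime has a good phase for
    every alpha. The primes are therefore selected for each pair (r, alpha), and every other prime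
    contributes a factor at most 1, so the bound is uniform in the length of the partial sum and
    survives the limit. It is then weakened to the product of (1 + xi1^2)^-2 and (1 + xi2^2)^-2: in
    each coordinate one power is the integrable majorant and the other pays for the factor |xi| of
    the Lipschitz estimate. Finally, [logL] has a default value where the series diverges; since
    that value is a single point, all events remain measurable. *)

Section elementary_inequalities.
Variable R : realType.
Implicit Types x y : R.

Lemma sin_mvt x : exists2 c, `|c| <= `|x| & sin x = cos c * x.
Proof.
have der y : is_derive y 1 (sin : R -> R) (cos y) by exact: is_derive_sin.
have cs : continuous (sin : R -> R) by exact: continuous_sin.
case: (leP 0 x) => x0.
  have [|c] := @MVT_segment R sin cos 0 x x0 (fun y _ => der y).
    exact: continuous_subspaceT.
  rewrite in_itv/= sin0 !subr0 => /andP[c0 cx] ->.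
  by exists c => //; rewrite !ger0_norm.
have [|c] := @MVT_segment R sin cos x 0 (ltW x0) (fun y _ => der y).
  exact: continuous_subspaceT.
rewrite in_itv/= sin0 !sub0r => /andP[xc c0] E.
exists c; first by rewrite !ler0_norm ?lerN2// ltW.
by apply: oppr_inj; rewrite E mulrN.
Qed.

Lemma normr_sin_le x : `|sin x| <= `|x|.
Proof.
have [c _ ->] := sin_mvt x; rewrite normrM ler_piMl//.
by rewrite ler_norml cos_geN1 cos_le1.
Qed.

Lemma cosE_half x : cos x = 1 - 2 * sin (x / 2) ^+ 2.
Proof.
rewrite {1}(splitr x) cosD -!expr2 cos2sin2; ring.
Qed.

Lemma cos_ge x : 1 - x ^+ 2 / 2 <= cos x.
Proof.
rewrite cosE_half lerD2l lerN2.
have : sin (x / 2) ^+ 2 <= (x / 2) ^+ 2.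
  by rewrite -[leLHS]real_normK ?num_real// -[leRHS]real_normK ?num_real//
     ler_pXn2r ?nnegrE// normr_sin_le.
lra.
Qed.

Lemma sin_mvt_ge_half x : `|x| <= 1 ->
  exists c, [/\ 2^-1 <= c, c <= 1, 1 - x ^+ 2 / 2 <= c & sin x = c * x].
Proof.
move=> x1; have [c cx ->] := sin_mvt x; exists (cos c).
have c2 : c ^+ 2 <= x ^+ 2.
  by rewrite -[leLHS]real_normK ?num_real// -[leRHS]real_normK ?num_real//
     ler_pXn2r ?nnegrE.
have x2 : x ^+ 2 <= 1 by rewrite -[leLHS]real_normK ?num_real// expr_le1.
have := cos_ge c; have := cos_le1 c; split => //; lra.
Qed.

Lemma sin2_ge x : `|x| <= 1 -> x ^+ 2 / 4 <= sin x ^+ 2.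
Proof.
move=> /sin_mvt_ge_half[c [c0 c1 _ ->]]; rewrite exprMn mulrC.
by apply: ler_wpM2r; [exact: sqr_ge0|nra].
Qed.

Lemma cos_le x : `|x| <= 1 -> cos x <= 1 - x ^+ 2 / 8.
Proof.
move=> x1; rewrite cosE_half.
have /sin2_ge : `|x / 2| <= 1.
  by rewrite normrM [`|2^-1|]ger0_norm//; have := normr_ge0 x; lra.
rewrite expr_div_n.
lra.
Qed.

Lemma normr_subr_sin x : `|x| <= 1 -> `|sin x - x| <= x ^+ 2.
Proof.
move=> x1; have [c [c0 c1 c2 ->]] := sin_mvt_ge_half x1.
have -> : c * x - x = (c - 1) * x by ring.
rewrite normrM (@ler0_norm _ (c - 1)) ?subr_le0// opprB.
have x2 : x ^+ 2 = `|x| ^+ 2 by rewrite real_normK ?num_real.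
rewrite x2 in c2 *; have := normr_ge0 x; nra.
Qed.

(** Two mean value steps give exp x = 1 + x + exp (e) c x with |e| <= |c| <= |x|. The linear term is
    kept exactly because its expectation is what (C1) makes small. *)
Lemma expR_le_quad x : `|x| <= 1 -> expR x <= 1 + x + expR 1 * x ^+ 2.
Proof.
move=> x1.
have der y : is_derive y 1 (expR : R -> R) (expR y) by exact: is_derive_expR.
have mvt y : exists2 c, `|c| <= `|y| & expR y - 1 = expR c * y.
  case: (leP 0 y) => y0.
    have [|c] := @MVT_segment R expR expR 0 y y0 (fun y _ => der y).
      apply: continuous_subspaceT; exact: continuous_expR.
    rewrite in_itv/= expR0 !subr0 => /andP[c0 cx] ->.
    by exists c => //; rewrite !ger0_norm.
  have [|c] := @MVT_segment R expR expR y 0 (ltW y0) (fun y _ => der y).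
    apply: continuous_subspaceT; exact: continuous_expR.
  rewrite in_itv/= expR0 !sub0r => /andP[xc c0] E.
  exists c; first by rewrite !ler0_norm ?lerN2// ltW.
  by apply: oppr_inj; rewrite opprB E mulrN.
have [c cx] := mvt x; have [e ec] := mvt c => E1 E2.
have : expR e <= expR 1.
  by rewrite ler_expR (le_trans (ler_norm _))// (le_trans ec)// (le_trans cx).
have e0 := expR_ge0 e.
have : c * x <= x ^+ 2.
  rewrite (le_trans (ler_norm _))// normrM -real_normK ?num_real// expr2.
  by rewrite ler_wpM2r.
have -> : expR x = 1 + x + expR e * (c * x) by rewrite -[LHS](subrK 1) E2 mulrA -E1; ring.
have := sqr_ge0 x; nra.
Qed.

End elementary_inequalities.

(** * Chebyshev's lower bound and the phases of primes *)

Section central_binomial.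
Local Open Scope nat_scope.

(** Legendre's formula: the exponent is the sum over k of floor (2n / p^k) - 2 floor (n / p^k). Each
    difference is 0 or 1 and vanishes once p^k exceeds 2n. *)
Lemma logn_central_binomial_le p n : prime p -> 0 < n ->
  p ^ logn p 'C(n.*2, n) <= n.*2.
Proof.
move=> pp n0; have n2 : 0 < n.*2 by rewrite double_gt0.
have p1 := prime_gt1 pp.
apply: leq_trans (trunc_logP p1 n2).
rewrite leq_exp2l//.
(* Legendre's sum is padded with zeros up to 2n, so that the sums for n and 2n share one range. *)
have facE m : m <= n.*2 -> logn p m`! = \sum_(1 <= k < n.*2.+1) m %/ p ^ k.
  move=> mn; rewrite logn_fact// (@big_cat_nat _ _ _ m.+1 1 n.*2.+1)//=.
  rewrite [X in _ = _ + X]big_nat_cond [X in _ = _ + X]big1 ?addn0// => k /andP[/andP[mk _] _].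
  by rewrite divn_small// (leq_trans mk)// ltnW// ltn_expl.
have := bin_fact (leq_addl n n); rewrite addnn -{2}addnn addnK.
move/(congr1 (logn p)).
rewrite !lognM ?muln_gt0 ?fact_gt0 ?bin_gt0 -?addnn ?leq_addl// addnn.
rewrite !facE -?addnn ?leq_addl// addnn => E.
suff: \sum_(1 <= k < n.*2.+1) n.*2 %/ p ^ k <=
   \sum_(1 <= k < n.*2.+1) n %/ p ^ k + \sum_(1 <= k < n.*2.+1) n %/ p ^ k
     + trunc_log p n.*2 by lia.
rewrite -big_split/=.
apply: (@leq_trans (\sum_(1 <= k < n.*2.+1)
   (n %/ p ^ k + n %/ p ^ k + (k <= trunc_log p n.*2)))).
  apply: leq_sum => k _.
  case: (leqP k (trunc_log p n.*2)) => kt.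
    rewrite -{1}addnn; set q := p ^ k.
    have q0 : 0 < q by rewrite expn_gt0 ltnW.
    have := divn_eq n q; have := ltn_pmod n q0.
    set a := n %/ q; set b := n %% q => bq ->.
    by rewrite -ltnS ltn_divLR//; lia.
  rewrite divn_small//.
  by rewrite (leq_trans (trunc_log_ltn _ p1))// leq_exp2l.
rewrite big_split/= leq_add2l.
set t := trunc_log p _.
suff H M : \sum_(1 <= k < M.+1) (k <= t) = minn M t by rewrite H geq_minr.
elim: M => [|M IH]; first by rewrite big_geq// min0n.
by rewrite big_nat_recr//= IH; lia.
Qed.

Lemma central_binomial_ge n : 2 ^ n <= 'C(n.*2, n).
Proof.
elim: n => // n IH; rewrite doubleS expnS binS.
have -> : 'C(n.*2.+1, n.+1) = 'C(n.*2.+1, n).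
  by rewrite -[LHS]bin_sub -?addnn ?ltnS ?leq_addl// subSS addnK.
rewrite addnn -mul2n leq_pmul2l//.
by rewrite (leq_trans IH)// leq_bin2l.
Qed.

(** The central binomial coefficient is at least 2^n and is the product of its prime powers; each of
    these is at most 2n, and only primes up to 2n occur. *)
Lemma chebyshev_lower n : 0 < n ->
  2 ^ n <= n.*2 ^ count prime (iota 0 n.*2.+1).
Proof.
move=> n0.
apply: leq_trans (central_binomial_ge n) _.
have C0 : 0 < 'C(n.*2, n) by rewrite bin_gt0 -addnn leq_addl.
rewrite -{1}(partnT C0) /partn.
apply: (@leq_trans
  (\prod_(p <- iota 0 'C(n.*2, n).+1 | prime p && (p <= n.*2)) n.*2)).
  rewrite big_mkcond/= [leqRHS]big_mkcond/= /index_iota subn0.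
  apply: leq_prod => p _ /=.
  case: (boolP (prime p)) => pp /=; last by rewrite lognE (negPf pp).
  case: ifPn => [_|]; first exact: logn_central_binomial_le.
  rewrite -ltnNge => np.
  suff : logn p (n.*2)`! = 0.
    have := bin_fact (leq_addl n n); rewrite addnn => <-.
    by rewrite !lognM ?muln_gt0 ?fact_gt0//; case: (logn p 'C(n.*2, n)).
  rewrite logn_fact// big_nat big1// => k /andP[k0 _]; rewrite divn_small//.
  by rewrite (leq_trans np)// -{1}(expn1 p) leq_exp2l// prime_gt1.
rewrite -big_filter big_const_seq count_predT iter_muln_1 leq_pexp2l//.
  by rewrite double_gt0.
rewrite -size_filter uniq_leq_size ?filter_uniq ?iota_uniq// => p.
by rewrite !mem_filter !mem_iota/= => /andP[/andP[-> pn] _]; rewrite ltnS.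
Qed.

End central_binomial.

(** Within one window the elements lie less than [H] above the smallest of them, so a window holds
    at most [H]; the induction strips the top window. *)
Lemma size_windows (s : seq nat) W H M : uniq s -> (0 < H)%N ->
  (forall a, a \in s -> a %/ W < M)%N ->
  (forall a b, a \in s -> b \in s -> (a %/ W = b %/ W)%N -> (a < b)%N ->
    (b - a < H)%N) ->
  (size s <= M * H)%N.
Proof.
move=> + H0; elim: M s => [|M IH] s us sM sH.
  case: s {us sH} sM => // a s sM.
  by have := sM a; rewrite mem_head ltn0 => /(_ isT).
rewrite mulSn -(count_predC (fun a => (a %/ W == M)%N) s) leq_add//.
  rewrite -size_filter; set r := [seq a <- s | (a %/ W == M)%N].
  have ur : uniq r by rewrite filter_uniq.
  have rP a : a \in r -> (a %/ W = M)%N /\ a \in s.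
    by rewrite mem_filter => /andP[/eqP].
  have [->//|r0] := eqVneq r [::].
  have exr : exists a, a \in r.
    by case: (r) r0 => // a l _; exists a; rewrite mem_head.
  case: (@ex_minnP (mem r) exr) => m mr mmin.
  rewrite -(size_iota m H) uniq_leq_size// => b br.
  rewrite mem_iota mmin//=; have [<-|mb] := eqVneq m b; first by lia.
  have := mmin _ br; have [aM as_] := rP _ mr; have [bM bs] := rP _ br.
  have := sH _ _ as_ bs; rewrite aM bM => /(_ erefl); lia.
rewrite -size_filter; apply: IH.
- by rewrite filter_uniq.
- move=> a; rewrite mem_filter /= => /andP[aM /sM]; lia.
- by move=> a b; rewrite !mem_filter => /andP[_ ?] /andP[_ ?]; exact: sH.
Qed.

Lemma leq_sqr_exp2 k : (4 <= k -> k ^ 2 <= 2 ^ k)%N.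
Proof.
elim: k => // k IH; rewrite leq_eqVlt => /predU1P[<-//|k4].
have := IH k4; rewrite [(2 ^ k.+1)%N]expnS; nia.
Qed.

(** Chebyshev's bound is of order n^g / (g log n), and log n is o(n). The logarithm never appears:
    it is replaced by a [k] with n <= 2^k and k <= n / D. *)
Lemma prime_count_ge A g : (0 < g)%N -> exists n0, forall n, (n0 <= n)%N ->
  (A * n ^ g.-1 <= count prime (iota 0 (n ^ g).+1))%N.
Proof.
(* [D] makes 4 k g (A + 1) n^(g-1) at most n^g. The threshold on n gives k >= 2 D + 4, whence n <= D
   (k + 1) <= k^2 <= 2^k. *)
move=> g0; set D := (4 * g * A.+1)%N.
exists (D * (2 * D + 4))%N => n nn0.
set Q := (n ^ g)%N.
have D0 : (0 < D)%N by rewrite /D !muln_gt0 g0.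
have n0 : (0 < n)%N by apply: leq_trans nn0; lia.
have Q0 : (0 < Q)%N by rewrite expn_gt0 n0.
have QE : (Q = n * n ^ g.-1)%N by rewrite -expnS prednK.
set k := (n %/ D)%N.
have kD : (2 * D + 4 <= k)%N by rewrite leq_divRL// mulnC.
have nk : (n <= 2 ^ k)%N.
  apply: (@leq_trans (D * k.+1)%N); first by rewrite ltnW// mulnC ltn_ceil.
  apply: leq_trans (leq_sqr_exp2 _); last by lia.
  nia.
have kn : (D * k <= n)%N by rewrite mulnC leq_divM.
have h0 : (0 < Q./2)%N.
  have : (D <= n)%N by apply: leq_trans nn0; nia.
  have : (4 <= D)%N by rewrite /D; nia.
  have : (n <= Q)%N by rewrite QE leq_pmulr// expn_gt0 n0.
  lia.
have hQ : (Q./2.*2 <= Q)%N by rewrite -{2}(odd_double_half Q) leq_addl.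
have := chebyshev_lower h0; rewrite leqNgt; apply: contraNT; rewrite -ltnNge => lt.
set c := count prime (iota 0 Q./2.*2.+1).
have cc : (c <= count prime (iota 0 Q.+1))%N.
  rewrite /c -!size_filter uniq_leq_size ?filter_uniq ?iota_uniq// => p.
  by rewrite !mem_filter !mem_iota/= => /andP[-> ]; lia.
apply: (@leq_ltn_trans (Q ^ c)%N); first by case: (c) => // c1; rewrite leq_exp2r.
apply: (@leq_ltn_trans (2 ^ (k * g * c))%N).
  rewrite /Q -expnM -mulnA (expnM 2); case: (posnP (g * c)%N) => [->//|?].
  by rewrite leq_exp2r.
rewrite ltn_exp2l//.
have : (k * g * c <= k * g * (A * n ^ g.-1))%N by rewrite leq_mul2l; lia.
have : (4 * (k * g * (A.+1 * n ^ g.-1)) <= Q)%N.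
  by rewrite QE; apply: leq_trans (leq_mul kn (leqnn _)); rewrite /D; nia.
have : (0 < k * g * n ^ g.-1)%N by rewrite !muln_gt0 g0 expn_gt0 n0 !andbT; lia.
nia.
Qed.

(** Two small cosines force the difference of the phases close to a multiple of pi; this bounds the
    spread of the bad primes in a window. *)
Lemma sin2_subr_le (R : realType) (a b : R) :
  sin (a - b) ^+ 2 <= 2 * (cos a ^+ 2 + cos b ^+ 2).
Proof.
rewrite sinB.
have h x y : (x - y) ^+ 2 <= 2 * (x ^+ 2 + y ^+ 2) :> R.
  by have := sqr_ge0 (x + y); nra.
apply: (le_trans (h _ _)); rewrite !exprMn.
have s1 (x : R) : 0 <= sin x ^+ 2 <= 1.
  by rewrite sqr_ge0/= sin2cos2 lerBlDr lerDl sqr_ge0.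
have := s1 a; have := s1 b; have := sqr_ge0 (cos a); have := sqr_ge0 (cos b); nra.
Qed.

Lemma ln_ratio_bounds (R : realType) (a b : nat) : (0 < a)%N -> (a < b)%N ->
  (b - a)%:R / b%:R <= ln (b%:R : R) - ln a%:R <= (b - a)%:R / a%:R.
Proof.
move=> a0 ab; have b0 : (0 < b)%N by lia.
have aR : 0 < a%:R :> R by rewrite ltr0n.
have bR : 0 < b%:R :> R by rewrite ltr0n.
have abR : a%:R < b%:R :> R by rewrite ltr_nat.
rewrite natrB 1?ltnW//; apply/andP; split.
  rewrite -lerN2 opprB -ln_div ?posrE//.
  have -> : a%:R / b%:R = 1 + (- ((b%:R - a%:R) / b%:R)) :> R by field; rewrite gt_eqF.
  by apply: le_ln1Dx; rewrite ltrN2 ltr_pdivrMr// mul1r; lra.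
rewrite -ln_div ?posrE//.
have -> : b%:R / a%:R = 1 + ((b%:R - a%:R) / a%:R) :> R by field; rewrite gt_eqF.
by apply: le_ln1Dx; rewrite (@lt_le_trans _ _ 0)// divr_ge0; lra.
Qed.

Lemma subn_window a b W : (0 < W)%N -> (a %/ W = b %/ W)%N -> (b - a <= W)%N.
Proof.
move=> W0 ab; rewrite leq_subLR {1}(divn_eq b W) -ab.
by apply: leq_add; [exact: leq_divM|rewrite ltnW// ltn_pmod].
Qed.

(* The bad primes, at which the cosine is small, lie within [n ^ g.-2] of each other in
   every window of length [n ^ g.-1]. *)
Lemma good_primes (R : realType) (t : R) g : (1 < g)%N ->
  exists2 tau : R, 0 < tau & exists n0, forall n alpha, (n0 <= n)%N ->
    t != 0 \/ `|cos alpha| = 1 ->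
    exists J : seq nat, [/\ uniq J, all prime J,
      forall p, p \in J -> (n ^ g.-1 <= p <= n ^ g)%N /\
        tau / n%:R ^+ 4 <= cos (t * ln p%:R + alpha) ^+ 2
      & (n ^ g.-1 <= size J)%N].
Proof.
move=> g1; have g0 : (0 < g)%N by lia.
pose C := (Num.truncn `|t|).+1.
have tC : `|t| <= C%:R by rewrite ltW// truncnS_gt.
(* For t <> 0, bad primes a < b of one window with b - a >= n^(g-2) would have u = ln b - ln a >=
   n^-2, so sin^2 (t u) >= t^2 / (4 n^4), while two squared cosines below tau / n^4 give less than 4
   tau / n^4. The value t^2 / 16 makes the two bounds contradict each other. For t = 0 every prime
   is good. *)
exists (if t == 0 then 1 else t ^+ 2 / 16).
  by case: ifPn => // t0; rewrite divr_gt0// exprn_even_gt0.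
(* Of (C + 3) n^(g-1) primes, at most C n^(g-1) lie below [L] and at most (n + 1) n^(g-2) <= 2
   n^(g-1) are bad, which leaves n^(g-1). *)
have [n1 Hn1] := prime_count_ge (C + 3) g0.
exists (maxn 1 n1) => n alpha; rewrite geq_max => /andP[n0 nn1] tal.
set tau := (X in X / _).
have nR : 0 < n%:R :> R by rewrite ltr0n.
pose good p := tau / n%:R ^+ 4 <= cos (t * ln p%:R + alpha) ^+ 2.
pose L := (C * n ^ g.-1)%N.
pose s := [seq p <- iota 0 (n ^ g).+1 | prime p].
pose bad := [seq p <- s | (L <= p)%N && ~~ good p].
have W0 : (0 < n ^ g.-1)%N by rewrite expn_gt0 n0.
have H0 : (0 < n ^ g.-2)%N by rewrite expn_gt0 n0.
have WH : (n ^ g.-1 = n * n ^ g.-2)%N by rewrite -expnS; congr (_ ^ _)%N; lia.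
have QW : (n ^ g = n * n ^ g.-1)%N by rewrite -expnS; congr (_ ^ _)%N; lia.
have us : uniq s by rewrite filter_uniq ?iota_uniq.
have sQ p : p \in s -> (p <= n ^ g)%N by rewrite mem_filter mem_iota/= ltnS => /andP[].
exists [seq p <- s | (L <= p)%N && good p]; split.
- by rewrite filter_uniq.
- by apply/allP => p; rewrite !mem_filter => /and3P[].
- move=> p; rewrite mem_filter => /andP[/andP[Lp gp]] /sQ ->; split => //.
  by rewrite andbT (leq_trans _ Lp)// /L mulSn leq_addr.
have sz : ((C + 3) * n ^ g.-1 <= size s)%N by rewrite size_filter; exact: Hn1.
have sbad : (size bad <= n.+1 * n ^ g.-2)%N.
  apply: (@size_windows _ (n ^ g.-1)) => //.
  - by rewrite filter_uniq.
  - move=> a; rewrite mem_filter => /andP[_ /sQ aQ].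
    by rewrite ltnS (leq_trans (leq_div2r _ aQ))// QW mulnK.
  move=> a b; rewrite /bad !(mem_filter (fun p => (L <= p)%N && ~~ good p)).
  move=> /andP[/andP[La ba] _] /andP[/andP[Lb bb] /sQ bQ] abW ab.
  rewrite ltnNge; apply/negP => Hab.
  move: ba bb; rewrite /good -!ltNge /tau; case: ifPn => [/eqP t0|t0] ba bb.
    have cal : cos alpha ^+ 2 = 1.
      by case: tal => [|cal]; [rewrite t0 eqxx|rewrite -real_normK ?num_real// cal expr1n].
    move: ba; rewrite t0 mul0r add0r cal ltNge ler_pdivrMr ?exprn_gt0// mul1r.
    by rewrite exprn_ege1// ler1n.
  have a0 : (0 < a)%N by rewrite (leq_trans _ La)// muln_gt0.
  have aR : 0 < a%:R :> R by rewrite ltr0n.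
  have bR : 0 < b%:R :> R by rewrite ltr0n (ltn_trans a0).
  have /andP[l1 l2] := ln_ratio_bounds R a0 ab.
  have := sin2_subr_le (t * ln b%:R + alpha) (t * ln a%:R + alpha).
  have -> : t * ln b%:R + alpha - (t * ln a%:R + alpha) = t * (ln b%:R - ln a%:R) by ring.
  set u := ln _ - ln _ in l1 l2 *.
  have u1 : 1 / n%:R ^+ 2 <= u.
    apply: le_trans l1; rewrite ler_pdivlMr// mulrAC ler_pdivrMr ?exprn_gt0// mul1r.
    rewrite -natrX -natrM ler_nat; apply: (leq_trans bQ).
    by rewrite QW WH mulnA mulnn mulnC leq_mul2r Hab orbT.
  have u0 : 0 < u by apply: lt_le_trans u1; rewrite divr_gt0// exprn_gt0.
  (* This is why primes below [L] are discarded: beyond [L], a window of length n^(g-1) turns the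
     phase by at most 1, where the sine is comparable with its argument. *)
  have tu : `|t * u| <= 1.
    rewrite normrM (gtr0_norm u0) (le_trans (ler_pM _ (ltW u0) tC l2))//.
    rewrite mulrA ler_pdivrMr// mul1r -natrM ler_nat.
    apply: leq_trans La; rewrite leq_mul2l/=.
    exact: subn_window.
  have := sin2_ge tu; rewrite exprMn.
  have : t ^+ 2 * (1 / n%:R ^+ 4) <= t ^+ 2 * u ^+ 2.
    rewrite ler_wpM2l ?sqr_ge0//.
    have -> : 1 / n%:R ^+ 4 = (1 / n%:R ^+ 2) ^+ 2 :> R by rewrite expr_div_n expr1n -exprM.
    by rewrite ler_pXn2r// nnegrE ltW// divr_gt0// exprn_gt0.
  have e : t ^+ 2 / 16 / n%:R ^+ 4 = t ^+ 2 * (1 / n%:R ^+ 4) / 16.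
    by field; rewrite gt_eqF.
  move: ba bb; rewrite e.
  move: (cos _ ^+ 2) (cos _ ^+ 2) (sin _ ^+ 2) (t ^+ 2 * _) (t ^+ 2 * _).
  move=> ca cb sn x y; lra.
have sL : (count (fun p => (p < L)%N) s <= L)%N.
  rewrite -size_filter -[leqRHS](size_iota 0) uniq_leq_size ?(filter_uniq _ us)// => p.
  by rewrite mem_filter mem_iota/= => /andP[].
have tot r : (size r = count (fun p => (p < L)%N) r +
    count (fun p => (L <= p)%N && ~~ good p) r +
    count (fun p => (L <= p)%N && good p) r)%N.
  by elim: r => //= p r ->; case: leqP; case: (good p) => /= _; lia.
move: sbad; rewrite [size bad]size_filter => sbad.
rewrite size_filter; move: (tot s) sL sbad sz; rewrite /L WH.
have : (n ^ g.-2 <= n * n ^ g.-2)%N by rewrite leq_pmull.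
rewrite mulSn mulnDl; move: (n * n ^ g.-2)%N => X; move: (C * X)%N (n ^ g.-2)%N => Y Z.
by lia.
Qed.

Lemma prod_le_exp_size (R : realDomainType) (I : eqType) (s : seq I)
    (f : I -> R) q : (forall i, i \in s -> 0 <= f i <= q) ->
  \prod_(i <- s) f i <= q ^+ size s.
Proof.
elim: s => [|i s IH] fq; first by rewrite big_nil expr0.
rewrite big_cons exprS; have /andP[f0 fi] := fq i (mem_head _ _).
apply: ler_pM => //; last by apply: IH => j js; apply: fq; rewrite inE js orbT.
rewrite big_seq; apply: prodr_ge0 => j js.
by have /andP[] : 0 <= f j <= q by apply: fq; rewrite inE js orbT.
Qed.

Lemma ler_powRl (R : realType) (r x y : R) : 0 <= r -> 0 <= x -> x <= y ->
  x `^ r <= y `^ r.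
Proof.
by move=> r0 x0 xy; apply: ge0_ler_powR => //; rewrite nnegrE// (le_trans x0).
Qed.

(** Take n of order r^(1/e). Up to a constant, each prime of [J] contributes at least n^(-2 sigma -
    6) n^-4 to the exponent, and there are at least n^(g-1) of them. The total is at least a
    multiple of n, hence of a power of r, and the exponential beats every power. The lower bound on
    cos^2 is kept in the conclusion because the estimate at a single prime needs it. *)
Lemma prime_phase_decay (R : realType) (sigma t K kappa : R) (m : nat) :
  2^-1 < sigma -> 0 < K -> 0 < kappa ->
  exists2 B : R, 0 < B & forall r alpha, 1 <= r ->
    t != 0 \/ `|cos alpha| = 1 ->
    exists J : seq nat, [/\ uniq J, all prime J,
      forall p, p \in J ->
        K * (p%:R `^ (- 2^-1) + (r * p%:R `^ (- sigma)) ^+ 2) <=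
          cos (t * ln p%:R + alpha) ^+ 2
      & \prod_(p <- J) expR (- (kappa * (r * p%:R `^ (- sigma)) ^+ 2 *
          cos (t * ln p%:R + alpha) ^+ 2)) <= B / r ^+ m].
Proof.
move=> sigma2 K0 kappa0.
(* The exponent of n in the total, (g - 1) - (2 sigma + 10), is then at least 1; the constant 14
   gives g - 1 >= 13, hence p^(-1/2) <= n^-6 and e > 0. *)
pose g := (Num.truncn (2 * sigma) + 14)%N.
have gE : 2 * sigma + 13 <= g%:R.
  have := truncnS_gt (2 * sigma); rewrite /g natrD -natr1; lra.
have g14 : (14 <= g)%N by rewrite leq_addl.
have g1 : (1 < g)%N by rewrite (leq_trans _ g14).
have gP : g.-1%:R = g%:R - 1 :> R.
  by rewrite -[g in RHS](@prednK g) ?(leq_trans _ g14)// -natr1 addrK.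
have g13 : 13 <= g.-1%:R :> R by rewrite ler_nat; lia.
have [tau tau0 [n1 Hn1]] := good_primes t g1.
(* For [r] of order [n `^ e] and [n ^ g.-1 <= p], [r * p `^ (- sigma)] is of order at most
   [n ^- 3], so that its square is negligible before [tau / n ^+ 4]. *)
pose e := g.-1%:R * sigma - 3.
have e0 : 0 < e by rewrite /e; nra.
pose k := (Num.truncn (e * m%:R)).+1.
have ek : e * m%:R <= k%:R by rewrite ltW// truncnS_gt.
pose E := (2 `^ e) ^+ 2.
(* From [n2] on, K (1 + E) n^-6 <= tau n^-4. The constant [B0] comes from exp (- x) <= k! / x^k at x
   = kappa tau n, measured against (2 n)^k >= r^m. *)
pose n2 := (maxn 1 (maxn n1 (Num.truncn (K * (1 + E) / tau)).+1)).
pose B0 := (2 / (kappa * tau)) ^+ k * k`!%:R.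
pose r0 : R := n2%:R `^ e.
have kt0 : 0 < kappa * tau by exact: mulr_gt0.
have r00 : 0 < r0 by rewrite powR_gt0// ltr0n leq_max.
have B00 : 0 < B0.
  by rewrite mulr_gt0// ?exprn_gt0// ?divr_gt0// ltr0n fact_gt0.
exists (B0 + r0 ^+ m); first by rewrite addr_gt0// exprn_gt0.
move=> r alpha r1 ta.
have rp : 0 < r by exact: lt_le_trans r1.
case: (ltP r r0) => rr0.
  exists [::]; split => //; rewrite big_nil ler_pdivlMr ?exprn_gt0// mul1r.
  apply: (@le_trans _ _ (r0 ^+ m)); last by rewrite lerDr ltW.
  by apply: lerXn2r; rewrite ?nnegrE ltW.
pose n := Num.truncn (r `^ e^-1).
have /andP[nr rn] := truncn_itv (powR_ge0 r e^-1).
have rE : (r `^ e^-1) `^ e = r by rewrite -powRrM mulVf ?gt_eqF// powRr1// ltW.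
have n2n : (n2 <= n)%N.
  rewrite truncn_ge_nat ?powR_ge0//.
  have -> : n2%:R = r0 `^ e^-1 :> R by rewrite -powRrM mulfV ?gt_eqF// powRr1.
  by rewrite ler_powRl// ltW// invr_gt0.
have n0 : (0 < n)%N by apply: leq_trans n2n; rewrite leq_max.
have nn1 : (n1 <= n)%N by apply: leq_trans n2n; rewrite /n2 !leq_max leqnn orbT.
have nR : 0 < n%:R :> R by rewrite ltr0n.
have nN : n%:R != 0 :> R by rewrite gt_eqF.
have n1R : 1 <= n%:R :> R by rewrite ler1n.
have nK : K * (1 + E) <= tau * n%:R.
  rewrite [leRHS]mulrC -ler_pdivrMr// (le_trans (ltW (truncnS_gt _)))// ler_nat.
  by apply: leq_trans n2n; rewrite /n2 !leq_max leqnn !orbT.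
have powA (a b : R) : n%:R `^ (a + b) = n%:R `^ a * n%:R `^ b.
  by rewrite powRD// nN implybT.
have rlow : n%:R `^ e <= r.
  by rewrite -[leRHS]rE ler_powRl// ltW.
have rup : r <= 2 `^ e * n%:R `^ e.
  rewrite -powRM// -[leLHS]rE ler_powRl ?powR_ge0 ?(ltW e0)// ltW//.
  apply: lt_le_trans rn _; rewrite -natr1; lra.
have [J [uJ pJ HJ szJ]] := Hn1 n alpha nn1 ta.
have yP p : p \in J -> [/\ n%:R `^ (- sigma - 3) <= r * p%:R `^ (- sigma),
    r * p%:R `^ (- sigma) <= 2 `^ e / n%:R ^+ 3
    & p%:R `^ (- 2^-1) <= (n%:R ^+ 6)^-1 :> R].
  move=> /HJ[/andP[pl pu] _].
  have p0 : (0 < p)%N by rewrite (leq_trans _ pl)// expn_gt0 n0.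
  have powle (a : R) x y : 0 <= a -> (0 < x)%N -> (x <= y)%N -> y%:R `^ (- a) <= x%:R `^ (- a) :> R.
    move=> a0 x0 xy; rewrite !powRN lef_pV2 ?posrE ?powR_gt0 ?ltr0n// ?(leq_trans x0 xy)//.
    by rewrite ler_powRl// ler_nat.
  have powX (a : R) j : (n ^ j)%:R `^ a = n%:R `^ (j%:R * a).
    by rewrite natrX -powR_mulrn// -powRrM.
  split.
  - have -> : - sigma - 3 = e + g%:R * (- sigma) by rewrite /e gP; ring.
    rewrite powA ler_pM ?powR_ge0// -powX powle//; lra.
  - rewrite -powR_mulrn// -powRN.
    have -> : - 3%:R = e + g.-1%:R * (- sigma) by rewrite /e; ring.
    rewrite powA mulrA ler_pM ?powR_ge0// ?(ltW rp)//.
    by rewrite -powX powle ?expn_gt0 ?n0//; lra.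
  - apply: (@le_trans _ _ ((n ^ g.-1)%:R `^ (- 2^-1))).
      by apply: powle; rewrite ?expn_gt0 ?n0 ?invr_ge0.
    rewrite powX -powR_mulrn// -powRN ler_powR//; lra.
exists J; split => //.
  move=> p pp; have [y1 y2 y3] := yP p pp; have [_] := HJ p pp.
  apply: le_trans.
  have yE : (r * p%:R `^ (- sigma)) ^+ 2 <= E / n%:R ^+ 6.
    rewrite /E (_ : n%:R ^+ 6 = (n%:R ^+ 3) ^+ 2); last by rewrite -exprM.
    rewrite -expr_div_n lerXn2r// nnegrE ?mulr_ge0 ?powR_ge0 ?(ltW rp)//.
  apply: (@le_trans _ _ (K * ((1 + E) / n%:R ^+ 6))).
    rewrite ler_wpM2l ?(ltW K0)// mulrDl mul1r lerD//.
  rewrite mulrA (le_trans (ler_wpM2r _ nK)) ?invr_ge0 ?exprn_ge0//.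
  rewrite -mulrA ler_wpM2l ?(ltW tau0)// exprS invfM mulrA mulfV// mul1r.
  by rewrite lef_pV2 ?posrE ?exprn_gt0// ler_weXn2l.
have rm : r ^+ m <= (2 * n%:R) ^+ k.
  rewrite -(powR_mulrn m (ltW rp)) -(powR_mulrn k) ?mulr_ge0//.
  apply: (@le_trans _ _ (((2 * n%:R) `^ e) `^ m%:R)).
    by rewrite ler_powRl ?(ltW rp)// powRM.
  rewrite -powRrM ler_powR//; lra.
rewrite ler_pdivlMr ?exprn_gt0//.
apply: (@le_trans _ _ B0); last by rewrite lerDl exprn_ge0// ltW.
apply: (@le_trans _ _ (expR (- (kappa * tau * n%:R)) * (2 * n%:R) ^+ k)).
  apply: ler_pM => //; rewrite ?exprn_ge0 ?(ltW rp)//.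
    by apply: prodr_ge0 => p _; exact: expR_ge0.
  pose a := kappa * tau * n%:R `^ (- (2 * sigma) - 10).
  apply: (@le_trans _ _ (expR (- a) ^+ size J)).
    apply: prod_le_exp_size => p pp; rewrite expR_ge0 ler_expR lerN2/=.
    have [y1 _ _] := yP p pp; have [_ c1] := HJ p pp.
    rewrite /a -[leLHS]mulrA -[leRHS]mulrA ler_wpM2l ?(ltW kappa0)// [leRHS]mulrC.
    have -> : - (2 * sigma) - 10 = - 4%:R + ((- sigma - 3) + (- sigma - 3)) by ring.
    rewrite 2!powA mulrA ler_pM ?mulr_ge0 ?powR_ge0 ?(ltW tau0)//.
      by rewrite powRN powR_mulrn.
    by rewrite expr2 ler_pM ?powR_ge0.
  rewrite -expRM_natl ler_expR mulrN lerN2 /a [leRHS]mulrC -[leRHS]mulrA.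
  rewrite ler_wpM2l ?(ltW kt0)//.
  apply: (@le_trans _ _ (n%:R `^ (- (2 * sigma) - 10) * (n ^ g.-1)%:R)).
    rewrite natrX -powR_mulrn// -powA -[leLHS]powRr1// ler_powR//.
    rewrite gP; lra.
  by rewrite ler_wpM2l ?powR_ge0// ler_nat.
have x0 : 0 <= kappa * tau * n%:R by rewrite mulr_ge0// ltW.
rewrite expRN ler_pdivrMl ?expR_gt0//.
apply: (@le_trans _ _ ((kappa * tau * n%:R) ^+ k / k`!%:R * B0)); last first.
  rewrite ler_wpM2r ?(ltW B00)//.
  by apply: le_trans (expR_ge1Dxn k.-1 x0); rewrite /= lerDr.
have f0 : k`!%:R != 0 :> R by rewrite pnatr_eq0 -lt0n fact_gt0.
suff -> : (kappa * tau * n%:R) ^+ k / k`!%:R * B0 = (2 * n%:R) ^+ k by [].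
have -> : 2 * n%:R = kappa * tau * n%:R * (2 / (kappa * tau)).
  by field; rewrite !gt_eqF.
rewrite /B0 (exprMn _ (kappa * tau * n%:R)).
by rewrite [_ * k`!%:R]mulrC mulrA divfK.
Qed.

(** * Bounded expectations and independence *)

Section bounded_expectation.
Context d (T : measurableType d) (R : realType) (P : probability T R).
Implicit Types f g : T -> R.

(** Bounded measurable functions are closed under the operations in use and integrable for every
    probability, so that integrability is settled once. *)
Definition bmf d' (S : measurableType d') (f : S -> R) : Prop :=
  measurable_fun setT f /\ exists M, forall x, `|f x| <= M.

Lemma bmf_integrable f : bmf f -> P.-integrable setT (EFin \o f).
Proof.
move=> [mf [M fM]]; apply: (@le_integrable _ _ _ _ _ _ _ (EFin \o cst M)) => //.
- exact/measurable_EFinP.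
- by move=> x _ /=; rewrite lee_fin (le_trans (fM x))// ler_norm.
- exact: finite_measure_integrable_cst.
Qed.

Lemma bmf_cst d' (S : measurableType d') (c : R) : bmf (fun _ : S => c).
Proof. by split; [exact: measurable_cst|exists `|c|]. Qed.

Lemma bmfD d' (S : measurableType d') (f g : S -> R) :
  bmf f -> bmf g -> bmf (fun x => f x + g x).
Proof.
move=> [mf [M fM]] [mg [N gN]]; split; first exact: measurable_funD.
by exists (M + N) => x; rewrite (le_trans (ler_normD _ _))// lerD.
Qed.

Lemma bmfM d' (S : measurableType d') (f g : S -> R) :
  bmf f -> bmf g -> bmf (fun x => f x * g x).
Proof.
move=> [mf [M fM]] [mg [N gN]]; split; first exact: measurable_funM.
by exists (M * N) => x; rewrite normrM ler_pM.
Qed.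

Lemma bmfB d' (S : measurableType d') (f g : S -> R) :
  bmf f -> bmf g -> bmf (fun x => f x - g x).
Proof.
move=> [mf [M fM]] [mg [N gN]]; split; first exact: measurable_funB.
by exists (M + N) => x; rewrite (le_trans (ler_normB _ _))// lerD.
Qed.

Lemma bmf_indic d' (S : measurableType d') (A : set S) :
  measurable A -> bmf (\1_A : S -> R).
Proof.
move=> mA; split; first exact: measurable_indic.
by exists 1 => x; rewrite indicE; case: (_ \in _); rewrite ?normr1 ?normr0.
Qed.

Lemma bmf_comp d1 d2 (S1 : measurableType d1) (S2 : measurableType d2)
  (f : S2 -> R) (X : S1 -> S2) :
  bmf f -> measurable_fun setT X -> bmf (fun x => f (X x)).
Proof.
move=> [mf [M fM]] mX; split; first exact: measurableT_comp.
by exists M => x.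
Qed.

Lemma bmf_sum (I : Type) (s : seq I) d' (S : measurableType d')
    (f : I -> S -> R) :
  (forall i, bmf (f i)) -> bmf (fun x => \sum_(i <- s) f i x).
Proof.
move=> bf; elim: s => [|i s IH].
  by under eq_fun do rewrite big_nil; exact: bmf_cst.
by under eq_fun do rewrite big_cons; exact: bmfD.
Qed.

Lemma bmf_prod (I : Type) (s : seq I) d' (S : measurableType d')
    (f : I -> S -> R) :
  (forall i, bmf (f i)) -> bmf (fun x => \prod_(i <- s) f i x).
Proof.
move=> bf; elim: s => [|i s IH].
  by under eq_fun do rewrite big_nil; exact: bmf_cst.
by under eq_fun do rewrite big_cons; exact: bmfM.
Qed.

Lemma bmf_cos : bmf (cos : R -> R).
Proof.
split; first by apply: continuous_measurable_fun; exact: continuous_cos.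
by exists 1 => x; exact: cos_max.
Qed.

Lemma bmf_sin : bmf (sin : R -> R).
Proof.
split; first by apply: continuous_measurable_fun; exact: continuous_sin.
by exists 1 => x; exact: sin_max.
Qed.

Lemma bmfED f g : bmf f -> bmf g ->
  \int[P]_x (f x + g x) = \int[P]_x f x + \int[P]_x g x.
Proof. by move=> bf bg; rewrite RintegralD//; exact: bmf_integrable. Qed.

Lemma bmfEB f g : bmf f -> bmf g ->
  \int[P]_x (f x - g x) = \int[P]_x f x - \int[P]_x g x.
Proof. by move=> bf bg; rewrite RintegralB//; exact: bmf_integrable. Qed.

Lemma bmfEZ f c : bmf f -> \int[P]_x (c * f x) = c * \int[P]_x f x.
Proof. by move=> bf; rewrite RintegralZl//; exact: bmf_integrable. Qed.

Lemma bmfE_cst c : \int[P]_x c = c.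
Proof. by rewrite Rintegral_cst//= (@probability_setT _ _ _ P) mulr1. Qed.

Lemma bmfE_le f g : bmf f -> bmf g -> (forall x, f x <= g x) ->
  \int[P]_x f x <= \int[P]_x g x.
Proof. by move=> bf bg fg; apply: le_Rintegral => //; exact: bmf_integrable. Qed.

Lemma bmfE_norm f c : bmf f -> (forall x, `|f x| <= c) ->
  `|\int[P]_x f x| <= c.
Proof.
move=> bf fc; rewrite ler_norml -(bmfE_cst c) -mulN1r -bmfEZ; last exact: bmf_cst.
rewrite !bmfE_le//; do ?[exact: bmf_cst].
- by move=> x; have := fc x; rewrite ler_norml => /andP[].
- by move=> x; have := fc x; rewrite ler_norml mulN1r => /andP[].
Qed.

Lemma bmfE_sum (I : Type) (s : seq I) (f : I -> T -> R) :
  (forall i, bmf (f i)) ->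
  \int[P]_x (\sum_(i <- s) f i x) = \sum_(i <- s) \int[P]_x f i x.
Proof.
move=> bf; elim: s => [|i s IH].
  rewrite big_nil -[RHS](bmfE_cst 0); apply: eq_Rintegral => x _.
  by rewrite big_nil.
rewrite big_cons -IH -bmfED//; last exact: bmf_sum.
by apply: eq_Rintegral => x _; rewrite big_cons.
Qed.

Lemma bmfE_indic A : measurable A -> \int[P]_x \1_A x = fine (P A).
Proof. by move=> mA; rewrite /Rintegral integral_indic// setIT. Qed.

End bounded_expectation.

Section independence.
Context d (T : measurableType d) (R : realType) (P : probability T R).

(* A bounded [f] is a uniform limit of finite combinations of indicators of its
   level bands, so orthogonality relations extend from indicators to [f]. *)
Lemma expectation_indep_ext (X W : T -> R) (w : R) :
  measurable_fun setT X -> bmf W ->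
  (forall B, measurable B ->
    \int[P]_x (\1_B (X x) * W x) = (\int[P]_x \1_B (X x)) * w) ->
  forall f, bmf f ->
    \int[P]_x (f (X x) * W x) = (\int[P]_x f (X x)) * w.
Proof.
move=> mX bW HB f bf; have [mf [M fM]] := bf.
have [mW [C WC]] := bW.
(* A probability space is inhabited; a point is needed to see that the bounds [C] and [M] are
   nonnegative. *)
have t0 : T by case: (pselect (exists t : T, True)) => [/cid[]//|nT];
  have := probability_setT P; rewrite (_ : setT = set0) ?measure0//;
  [move/eqP; rewrite eq_sym onee_eq0|apply/seteqP; split => // t; case: nT; exists t].
have C0 : 0 <= C by apply: le_trans (WC t0).
have M0 : 0 <= M by apply: le_trans (fM (X t0)).
apply/eqP; rewrite -subr_eq0 -normr_le0; apply/ler_addgt0Pr => e e0.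
rewrite add0r.
pose n := (Num.truncn ((C + `|w|) / e)).+1.
have n0 : 0 < n%:R :> R by rewrite ltr0n.
have ne : (C + `|w|) / n%:R <= e.
  by rewrite ler_pdivrMr// mulrC -ler_pdivrMr// ltW// truncnS_gt.
(* Adding [M] makes the values nonnegative, so [k y] is the index of the level band of width 1 / n
   that contains f y. *)
pose k y := Num.truncn (n%:R * (f y + M)).
have kP y : (k y)%:R <= n%:R * (f y + M) < (k y).+1%:R.
  apply: truncn_itv; rewrite mulr_ge0// ?ler0n//.
  by have := fM y; rewrite ler_norml; lra.
pose K := (Num.truncn (n%:R * (M + M))).+1.
have kK y : (k y < K)%N.
  rewrite ltnS; apply: le_truncn; rewrite ler_wpM2l// lerD2r.
  by apply: le_trans (fM y); rewrite ler_norm.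
pose B (j : nat) : set R := [set y | k y = j].
have mB j : measurable (B j).
  have -> : B j = f @^-1` `[j%:R / n%:R - M, j.+1%:R / n%:R - M[.
    apply/seteqP; split => y /=; rewrite in_itv/= lerBlDr ltrBrDr.
      by move=> <-; have := kP y; rewrite ler_pdivrMr// ltr_pdivlMr// mulrC.
    rewrite ler_pdivrMr// ltr_pdivlMr// [_ * n%:R]mulrC => h.
    by apply: truncn_def.
  by rewrite -[X in measurable X]setTI; apply: mf.
pose g y := \sum_(j < K) (j%:R / n%:R - M) * \1_(B j) y.
have gE y : g y = (k y)%:R / n%:R - M.
  rewrite /g (bigD1 (Ordinal (kK y)))//= big1 ?addr0.
    by rewrite indicE mem_set ?mulr1.
  move=> j jk; rewrite indicE memNset ?mulr0// => /= kj.
  by move/eqP: jk; apply; apply: val_inj; rewrite /= kj.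
have fg y : `|f y - g y| <= n%:R^-1.
  rewrite gE; have /andP[] := kP y; rewrite -natr1 => k1 k2.
  have -> : f y - ((k y)%:R / n%:R - M) = (n%:R * (f y + M) - (k y)%:R) / n%:R.
    by field; rewrite gt_eqF.
  rewrite normrM normfV (ger0_norm (ltW n0)) ler_pdivrMr// mulVf ?gt_eqF//.
  by rewrite ler_norml; lra.
have bB j : bmf (fun x => \1_(B j) (X x) : R) by apply: bmf_comp => //; exact: bmf_indic.
have bg : bmf g by apply: bmf_sum => j; apply: bmfM; [exact: bmf_cst|exact: bmf_indic].
have Hg : \int[P]_x (g (X x) * W x) = (\int[P]_x g (X x)) * w.
  rewrite bmfE_sum; last by move=> j; apply: bmfM; [exact: bmf_cst|exact: bB].
  rewrite (_ : (fun x => g (X x) * W x) =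
     (fun x => \sum_(j < K) (j%:R / n%:R - M) * (\1_(B j) (X x) * W x))); last first.
    by apply/funext => x; rewrite /g mulr_suml; apply: eq_bigr => j _; rewrite mulrA.
  rewrite bmfE_sum; last by move=> j; apply: bmfM; [exact: bmf_cst|apply: bmfM; [exact: bB|]].
  rewrite mulr_suml; apply: eq_bigr => j _.
  rewrite bmfEZ; last by apply: bmfM => //; exact: bB.
  by rewrite HB// bmfEZ ?mulrA//; exact: bB.
have bfX : bmf (fun x => f (X x)) by exact: bmf_comp.
have bgX : bmf (fun x => g (X x)) by exact: bmf_comp.
have -> : \int[P]_x (f (X x) * W x) - (\int[P]_x f (X x)) * w =
  \int[P]_x ((f (X x) - g (X x)) * W x) - (\int[P]_x (f (X x) - g (X x))) * w.
  rewrite bmfEB// mulrBl -Hg (_ : (fun x => (f (X x) - g (X x)) * W x) =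
     (fun x => f (X x) * W x - g (X x) * W x)); last by apply/funext => x; rewrite mulrBl.
  by rewrite bmfEB; [ring|exact: bmfM|exact: bmfM].
apply: le_trans ne; rewrite mulrDl (le_trans (ler_normB _ _))// lerD//.
  apply: bmfE_norm; first by apply: bmfM => //; exact: bmfB.
  by move=> x; rewrite normrM mulrC ler_pM.
rewrite normrM mulrC ler_wpM2l//; apply: bmfE_norm => //; exact: bmfB.
Qed.

(** Independence is a statement about indicators. The functions are introduced one index at a time,
    each by the extension lemma applied against the product of all other factors. *)
Lemma expectation_prod (I : eqType) (D : pred I) (X : I -> T -> R) :
  (forall i, measurable_fun setT (X i)) -> mutually_independent P D X ->
  forall (J : seq I) (f : I -> R -> R), uniq J -> all D J ->
    (forall i, bmf (f i)) ->
    \int[P]_x (\prod_(i <- J) f i (X i x)) = \prod_(i <- J) \int[P]_x f i (X i x).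
Proof.
move=> mX ind J f uJ DJ bf.
(* Indices of [J1] carry functions and those of [J2] still carry indicators; the case of an empty
   [J1] is the hypothesis of independence. *)
suff H J1 J2 (B : I -> set R) : uniq (J1 ++ J2) -> all D (J1 ++ J2) ->
    (forall i, measurable (B i)) ->
    \int[P]_x ((\prod_(i <- J1) f i (X i x)) * \prod_(i <- J2) \1_(B i) (X i x)) =
    (\prod_(i <- J1) \int[P]_x f i (X i x)) *
      \prod_(i <- J2) \int[P]_x \1_(B i) (X i x).
  have := H J [::] (fun=> setT); rewrite cats0 big_nil mulr1 => <- //.
  by apply: eq_Rintegral => x _; rewrite big_nil mulr1.
have bX i : bmf (fun x => f i (X i x)) by exact: bmf_comp.
elim: J1 J2 B {uJ DJ J} => [|i J1 IH] J2 B /= uJ DJ mB.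
  rewrite big_nil mul1r.
  transitivity (\int[P]_x \1_(\big[setI/setT]_(i <- J2) (X i @^-1` B i)) x).
    apply: eq_Rintegral => x _; rewrite big_nil mul1r.
    elim: J2 {uJ DJ} => [|j J2 IH]; first by rewrite !big_nil indicT.
    by rewrite !big_cons IH indicI.
  rewrite bmfE_indic; last first.
    by apply: bigsetI_measurable => i _; rewrite -[X in measurable X]setTI; exact: mX.
  rewrite ind//.
  have mXB j : measurable (X j @^-1` B j).
    by rewrite -[X in measurable X]setTI; exact: mX.
  elim: J2 {uJ DJ} => [|j J2 IH]; first by rewrite !big_nil.
  rewrite !big_cons -IH fineM//.
  - by congr (_ * _); rewrite -bmfE_indic.
  - exact: fin_num_measure.
  - elim: (J2) => [|k K fK]; first by rewrite big_nil.
    by rewrite big_cons fin_numM// fin_num_measure.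
rewrite !big_cons -mulrA.
move: uJ DJ => /andP[iJ uJ] /andP[Di DJ].
move: iJ; rewrite mem_cat negb_or => /andP[iJ1 iJ2].
rewrite -[RHS](expectation_indep_ext (W := fun x => (\prod_(i <- J1) f i (X i x)) *
   \prod_(i <- J2) \1_(B i) (X i x)))//.
- by apply: eq_Rintegral => x _; rewrite big_cons mulrA.
- by apply: bmfM; apply: bmf_prod => j //; apply: bmf_comp => //; exact: bmf_indic.
move=> A mA.
(* Against a test set [A], the index i joins the indicators; changing [B] at i is harmless because i
   is not in [J2]. *)
have Bi : {in J2, forall j, (if j == i then A else B j) = B j}.
  by move=> j jJ; case: eqP => // ji; rewrite -ji jJ in iJ2.
have := IH (i :: J2) (fun j => if j == i then A else B j).
rewrite big_cons eqxx mulrCA => E.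
transitivity (\int[P]_x (\prod_(j <- J1) f j (X j x) *
   \prod_(j <- i :: J2) \1_(if j == i then A else B j) (X j x))).
  apply: eq_Rintegral => x _; rewrite big_cons eqxx mulrCA; congr (_ * (_ * _)).
  rewrite big_seq [RHS]big_seq; apply: eq_bigr => j jJ.
  by rewrite Bi.
rewrite E.
- congr (_ * (_ * _)); rewrite big_seq [RHS]big_seq; apply: eq_bigr => j jJ.
  by rewrite Bi.
- have pJ : perm_eq (J1 ++ i :: J2) (i :: J1 ++ J2) by rewrite (perm_catCA J1 [:: i]).
  by rewrite (perm_uniq pJ)/= mem_cat negb_or iJ1 iJ2.
- by move: DJ; rewrite !all_cat /= => /andP[-> ->]; rewrite Di.
- by move=> j; case: ifP.
Qed.

End independence.

Section independent_sums.
Context d (T : measurableType d) (R : realType) (P : probability T R).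
Variables (I : eqType) (D : pred I) (X : I -> T -> R).
Hypothesis mX : forall i, measurable_fun setT (X i).
Hypothesis indX : mutually_independent P D X.
Variable Y : I -> R -> R.
Hypothesis mY : forall i, measurable_fun setT (Y i).

Let ecos i := \int[P]_x cos (Y i (X i x)).
Let esin i := \int[P]_x sin (Y i (X i x)).

(* [(A, B)] is the product of the complex numbers [E cos Y_i + i E sin Y_i]. *)
Lemma expectation_cos_sum_prod (J : seq I) : uniq J -> all D J ->
  exists A B, A ^+ 2 + B ^+ 2 = \prod_(i <- J) (ecos i ^+ 2 + esin i ^+ 2) /\
    forall a (K : seq I) (f : I -> R -> R), uniq (J ++ K) -> all D (J ++ K) ->
      (forall i, bmf (f i)) ->
      \int[P]_x (cos (a + \sum_(i <- J) Y i (X i x)) *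
                 \prod_(i <- K) f i (X i x)) =
      (A * cos a - B * sin a) * \prod_(i <- K) \int[P]_x f i (X i x).
Proof.
elim: J => [|j J IH] uJ DJ.
  exists 1, 0; split => [|a K f uK DK bf]; first by rewrite big_nil expr1n expr0n addr0.
  rewrite mul1r mul0r subr0 -(expectation_prod mX indX)//.
  rewrite -bmfEZ; last by apply: bmf_prod => i; exact: bmf_comp.
  by apply: eq_Rintegral => x _; rewrite big_nil addr0.
move: (uJ) (DJ) => /andP[jJ {}/IH IH] /andP[Dj {}/IH].
move=> [A [B [AB E]]].
exists (ecos j * A - esin j * B), (ecos j * B + esin j * A); split.
  by rewrite big_cons -AB; ring.
move=> a K f uK DK bf.
have uK' : uniq (J ++ j :: K).
  have pJ : perm_eq (J ++ j :: K) (j :: J ++ K) by rewrite (perm_catCA J [:: j]).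
  by rewrite (perm_uniq pJ).
have DK' : all D (J ++ j :: K).
  by move: DK; rewrite /= !all_cat/= => /and3P[-> -> ->].
have jK : j \notin K by move: uK; rewrite /= mem_cat negb_or => /andP[/andP[]].
pose g h i := if i == j then h else f i : R -> R.
have bg h : bmf h -> forall i, bmf (g h i) by move=> bh i; rewrite /g; case: ifP.
have gE (h : R -> R) x : \prod_(i <- j :: K) g h i (X i x) =
    h (X j x) * \prod_(i <- K) f i (X i x).
  rewrite big_cons {1}/g eqxx; congr (_ * _); rewrite big_seq [RHS]big_seq.
  by apply: eq_bigr => i iK; rewrite /g; case: eqP => // ij; rewrite -ij iK in jK.
have gE' (h : R -> R) : \prod_(i <- j :: K) \int[P]_x g h i (X i x) =
    (\int[P]_x h (X j x)) * \prod_(i <- K) \int[P]_x f i (X i x).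
  rewrite big_cons {1}/g eqxx; congr (_ * _); rewrite big_seq [RHS]big_seq.
  by apply: eq_bigr => i iK; rewrite /g; case: eqP => // ij; rewrite -ij iK in jK.
have bcY : bmf (cos \o Y j) by apply: bmf_comp => //; exact: bmf_cos.
have bsY : bmf (sin \o Y j) by apply: bmf_comp => //; exact: bmf_sin.
(* With S the sum over [J], cos (a + S + Y_j) = cos (a + S) cos Y_j + cos (a + pi/2 + S) sin Y_j:
   the shift a turns sines into cosines, and the extra list [K] carries the factor at j through the
   induction. *)
have E1 := E a _ _ uK' DK' (bg _ bcY).
have E2 := E (a + pi / 2) _ _ uK' DK' (bg _ bsY).
rewrite gE' in E1; rewrite gE' cosDpihalf sinDpihalf in E2.
have bS b : bmf (fun x => cos (b + \sum_(i <- J) Y i (X i x))).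
  apply: bmf_comp; first exact: bmf_cos.
  apply: measurable_funD => //; apply: measurable_sum => i.
  exact: measurableT_comp.
have bK h : bmf h -> bmf (fun x => \prod_(i <- j :: K) g h i (X i x)).
  by move=> bh; apply: bmf_prod => i; apply: bmf_comp => //; exact: bg.
transitivity (\int[P]_x (cos (a + \sum_(i <- J) Y i (X i x)) *
      \prod_(i <- j :: K) g (cos \o Y j) i (X i x) +
    cos (a + pi / 2 + \sum_(i <- J) Y i (X i x)) *
      \prod_(i <- j :: K) g (sin \o Y j) i (X i x))).
  apply: eq_Rintegral => x _; rewrite !gE big_cons /=.
  rewrite [a + pi / 2 + _]addrAC cosDpihalf.
  rewrite [a + (_ + _)]addrCA [Y j _ + _]addrC cosD; ring.
rewrite bmfED; [|by apply: bmfM => //; apply: bK..].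
by rewrite E1 E2 /ecos /esin /=; ring.
Qed.

(** By Cauchy-Schwarz, A cos a - B sin a is at most the length of (A, B), whatever the shift a. *)
Lemma expectation_cos_sum_le (J : seq I) (rho : I -> R) a :
  uniq J -> all D J ->
  (forall i, i \in J -> ecos i ^+ 2 + esin i ^+ 2 <= rho i) ->
  (\int[P]_x cos (a + \sum_(i <- J) Y i (X i x))) ^+ 2 <= \prod_(i <- J) rho i.
Proof.
move=> uJ DJ Jrho; have [A [B [AB E]]] := expectation_cos_sum_prod uJ DJ.
have E0 : \int[P]_x cos (a + \sum_(i <- J) Y i (X i x)) = A * cos a - B * sin a.
  pose z (i : I) (y : R) : R := 0.
  transitivity ((A * cos a - B * sin a) * \prod_(i <- [::]) \int[P]_x z i (X i x));
    last by rewrite [X in _ * X]big_nil mulr1.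
  rewrite -E ?cats0//; last by move=> i; exact: bmf_cst.
  by apply: eq_Rintegral => x _; rewrite big_nil mulr1.
apply: (@le_trans _ _ (A ^+ 2 + B ^+ 2)).
  have := cos2Dsin2 a; rewrite E0; move: (cos a) (sin a) => c s cs.
  have := sqr_ge0 (A * s + B * c); nra.
rewrite AB big_seq [leRHS]big_seq; apply: ler_prod => i iJ.
by rewrite addr_ge0 ?sqr_ge0//= Jrho.
Qed.

Lemma expectation_expR_sum (J : seq I) : uniq J -> all D J ->
  (forall i, bmf (Y i)) ->
  \int[P]_x expR (\sum_(i <- J) Y i (X i x)) =
  \prod_(i <- J) \int[P]_x expR (Y i (X i x)).
Proof.
move=> uJ DJ bY; rewrite -(expectation_prod mX indX (f := fun i => expR \o Y i))//.
  by apply: eq_Rintegral => x _; rewrite expR_sum.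
move=> i; have [mYi [M YM]] := bY i; split.
  by apply: measurableT_comp => //; exact: measurable_expR.
exists (expR M) => x /=; rewrite ger0_norm ?expR_ge0// ler_expR.
by apply: le_trans (YM x); exact: ler_norm.
Qed.

End independent_sums.

(** * Euler factors *)

Section euler_factor_series.
Variable R : realType.
Implicit Types q tau beta theta : R.

(* The term at [m = 0] vanishes because [x / 0 = 0]. *)
Definition eterm q tau beta theta (m : nat) : R :=
  2 * cos (m%:R * theta) / m%:R * q ^+ m * cos (m%:R * tau + beta).

(** With p^-s = q exp (- i tau), this is the scalar product of the logarithm of the Euler factor
    with the unit vector of angle beta: beta = 0 gives the real part and beta = pi/2 the imaginary
    part. *)
Definition elog q tau beta theta : R := limn (series (eterm q tau beta theta)).

Lemma eterm_le2 q tau beta theta m : 0 <= q -> `|eterm q tau beta theta m| <= 2 * q ^+ m.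
Proof.
move=> q0; rewrite /eterm !normrM normfV !normr_nat (ger0_norm (exprn_ge0 m q0)).
have c1 := cos_max (m%:R * theta); have c2 := cos_max (m%:R * tau + beta).
have qm : 0 <= q ^+ m by exact: exprn_ge0.
have m1 : 0 <= (m%:R : R)^-1 <= 1.
  case: m {c1 c2 qm} => [|m]; first by rewrite invr0 lexx ler01.
  by rewrite invr_ge0 ler0n invf_le1 ?ltr0n// ler1n.
move: m1 c1 c2 (normr_ge0 (cos (m%:R * theta))) (normr_ge0 (cos (m%:R * tau + beta))).
move: `|cos (_ * _)| `|cos (_ + _)| (m%:R^-1) (q ^+ m) qm => a b c e e0 /andP[c0 c1] a1 b1 a0 b0.
have ac : a * c <= 1 by rewrite mulr_ile1.
have acb : a * c * b <= 1 by rewrite mulr_ile1// mulr_ge0.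
have -> : 2 * a * c * e * b = 2 * e * (a * c * b) by ring.
by rewrite ler_piMr// mulr_ge0.
Qed.

Lemma eterm_le q tau beta theta m : 0 <= q -> (1 < m)%N ->
  `|eterm q tau beta theta m| <= q ^+ m.
Proof.
move=> q0 m1; rewrite /eterm !normrM normfV !normr_nat (ger0_norm (exprn_ge0 m q0)).
have c1 := cos_max (m%:R * theta); have c2 := cos_max (m%:R * tau + beta).
have qm : 0 <= q ^+ m by exact: exprn_ge0.
have m2 : 0 <= 2 / (m%:R : R) <= 1.
  by rewrite divr_ge0//= ler_pdivrMr ?mul1r ?ler_nat// ltr0n ltnW.
move: m2 c1 c2 (normr_ge0 (cos (m%:R * theta))) (normr_ge0 (cos (m%:R * tau + beta))).
move: `|cos (_ * _)| `|cos (_ + _)| (m%:R^-1) (q ^+ m) qm => a b c e e0 /andP[c0 c1] a1 b1 a0 b0.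
have ac : a * (2 * c) <= 1 by rewrite mulr_ile1.
have acb : a * (2 * c) * b <= 1 by rewrite mulr_ile1// mulr_ge0.
have -> : 2 * a * c * e * b = e * (a * (2 * c) * b) by ring.
by rewrite ler_piMr.
Qed.

Lemma cvg_elog q tau beta theta : 0 <= q < 1 ->
  series (eterm q tau beta theta) @ \oo --> elog q tau beta theta.
Proof.
move=> /andP[q0 q1]; apply: (@normed_cvg R R^o).
apply: (@series_le_cvg _ _ (geometric 2 q)) => [n|n|n|].
- exact: normr_ge0.
- by rewrite /geometric/= mulr_ge0// exprn_ge0.
- exact: eterm_le2.
- by apply: is_cvg_geometric_series; rewrite ger0_norm.
Qed.

Lemma normr_lim_subr_le (u : R ^nat) (l c e : R) : u @ \oo --> l ->
  (\forall n \near \oo, `|u n - c| <= e) -> `|l - c| <= e.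
Proof.
move=> ul h; have ulc : (fun n => `|u n - c|) @ \oo --> `|l - c|.
  by apply: cvg_norm; apply: cvgB; [exact: ul|exact: cvg_cst].
by apply: (ler_cvg_to ulc (cvg_cst e)).
Qed.

(** The main term is the one at m = 1; the tail is at most q^2 / (1 - q). The bound 3/4 is available
    because p^(- sigma) <= 2^(-1/2). *)
Lemma elog_approx q tau beta theta : 0 <= q <= 3 / 4 ->
  `|elog q tau beta theta - 2 * q * cos theta * cos (tau + beta)| <= 4 * q ^+ 2.
Proof.
move=> /andP[q0 q1].
have q1' : 0 <= q < 1 by apply/andP; split => //; lra.
apply: (normr_lim_subr_le (@cvg_elog _ tau beta theta q1')).
exists 2%N => // -[|[|n]] // _.
have -> : 2 * q * cos theta * cos (tau + beta) = \sum_(0 <= k < 2) eterm q tau beta theta k.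
  rewrite !big_nat_recr//= big_nil /eterm invr0 !mulr0 !mul0r !add0r divr1 expr1 !mul1r.
  by ring.
rewrite /series/= (@big_cat_nat _ _ _ 2 0 n.+2)//= addrAC subrr add0r.
rewrite (le_trans (ler_norm_sum _ _ _))//.
apply: (@le_trans _ _ (\sum_(2 <= k < n.+2) q ^+ k)).
  by rewrite !big_nat; apply: ler_sum => k /andP[k2 _]; exact: eterm_le.
have : (1 - q) * \sum_(2 <= k < n.+2) q ^+ k <= q ^+ 2.
  elim: n => [|n IH]; first by rewrite big_geq// mulr0 sqr_ge0.
  suff : (1 - q) * \sum_(2 <= k < n.+3) q ^+ k = q ^+ 2 - q ^+ n.+3.
    by move=> ->; rewrite gerBl exprn_ge0.
  elim: n {IH} => [|n IH]; first by rewrite big_nat1; ring.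
  by rewrite big_nat_recr//= mulrDr IH !exprS; ring.
have : 0 <= \sum_(2 <= k < n.+2) q ^+ k by apply: sumr_ge0 => k _; exact: exprn_ge0.
by nra.
Qed.

Lemma elog_le q tau beta theta : 0 <= q <= 3 / 4 -> `|elog q tau beta theta| <= 8 * q.
Proof.
move=> q01; have := elog_approx tau beta theta q01; move/andP: q01 => [q0 q1] h.
rewrite -[elog _ _ _ _](subrK (2 * q * cos theta * cos (tau + beta))).
rewrite (le_trans (ler_normD _ _))//.
have : `|2 * q * cos theta * cos (tau + beta)| <= 2 * q.
  rewrite -mulrA normrM ger0_norm ?mulr_ge0// ler_piMr ?mulr_ge0//.
  by rewrite normrM mulr_ile1// cos_max.
nra.
Qed.

Lemma measurable_elog q tau beta : 0 <= q < 1 -> measurable_fun setT (elog q tau beta).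
Proof.
move=> q01; apply: (@measurable_fun_cvg _ _ _ _ (fun m theta => series (eterm q tau beta theta) m)).
  move=> m; apply: measurable_sum => k.
  apply: measurable_funM => //; apply: measurable_funM => //.
  apply: measurable_funM => //; apply: measurable_funM => //.
  apply: (measurableT_comp (continuous_measurable_fun (@continuous_cos R))).
  exact: measurable_funM.
by move=> x _; exact: cvg_elog.
Qed.

Lemma elog_phase q tau beta theta : 0 <= q < 1 ->
  elog q tau beta theta =
  cos beta * elog q tau 0 theta + sin beta * elog q tau (pi / 2) theta.
Proof.
move=> q01; apply/cvg_lim => //.
have E : series (eterm q tau beta theta) = (fun n =>
    cos beta * series (eterm q tau 0 theta) n +
    sin beta * series (eterm q tau (pi / 2) theta) n).
  apply/funext => n; rewrite /series/= !mulr_sumr -big_split/=.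
  by apply: eq_bigr => m _; rewrite /eterm addr0 cosDpihalf cosD; ring.
rewrite E; apply: cvgD; apply: cvgM; do ?[exact: cvg_cst]; exact: cvg_elog.
Qed.

End euler_factor_series.

Ltac bmf_tac :=
  repeat first [assumption | exact: bmf_cst | apply: bmfM | apply: bmfB | apply: bmfD].

Section euler_factor_characteristic.
Context d (T : measurableType d) (R : realType) (P : probability T R).

(** Let v = E Y^2 and m = E Y. The cosine loses v / 8 and the sine gains at most |m| + v. By (C2), v
    >= y^2 (2 c^2 delta - 16 q^2); by (C1), m^2 <= y^2 (8 c1^2 + 32 q^2); and v <= 64 y^2. Then 66 =
    16/8 + 2 * 32 and 8192 = 2 * 64^2. *)
Lemma elog_characteristic_le (X : T -> R) (delta c1 r q tau alpha : R) :
  measurable_fun setT X ->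
  `|\int[P]_x cos (X x)| <= c1 -> delta <= \int[P]_x (cos (X x) ^+ 2) ->
  0 <= r -> 0 <= q <= 3 / 4 -> 64 * (r * q) ^+ 2 <= 1 ->
  (\int[P]_x cos (r * elog q tau alpha (X x))) ^+ 2 +
  (\int[P]_x sin (r * elog q tau alpha (X x))) ^+ 2 <=
  1 - (r * q) ^+ 2 * (cos (tau + alpha) ^+ 2 * delta / 4 -
    66 * q ^+ 2 - 16 * c1 ^+ 2 - 8192 * (r * q) ^+ 2).
Proof.
move=> mX hc1 hdelta r0 q34 y64; have /andP[q0 q1] := q34.
have q01 : 0 <= q < 1 by apply/andP; split => //; lra.
set y := r * q in y64 *; set c := cos (tau + alpha).
have y0 : 0 <= y by exact: mulr_ge0.
pose Y x := r * elog q tau alpha (X x).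
have y8 : 8 * y <= 1 by rewrite -(@expr_le1 _ 2) ?mulr_ge0// exprMn; lra.
have Y8 x : `|Y x| <= 8 * y.
  rewrite normrM (ger0_norm r0) (_ : 8 * y = r * (8 * q)); last by rewrite /y; ring.
  by rewrite ler_wpM2l// elog_le.
have Y1 x : `|Y x| <= 1 by exact: le_trans y8.
have mY : measurable_fun setT Y.
  by apply: measurable_funM => //; apply: measurableT_comp => //; exact: measurable_elog.
have bY : bmf Y by split => //; exists 1.
have bcY : bmf (fun x => cos (Y x)) by apply: bmf_comp => //; exact: bmf_cos.
have bsY : bmf (fun x => sin (Y x)) by apply: bmf_comp => //; exact: bmf_sin.
have bY2 : bmf (fun x => Y x ^+ 2) by under eq_fun do rewrite expr2; exact: bmfM.
have bcX : bmf (fun x => cos (X x)) by apply: bmf_comp => //; exact: bmf_cos.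
have bcX2 : bmf (fun x => cos (X x) ^+ 2) by under eq_fun do rewrite expr2; exact: bmfM.
have Y2 x : Y x ^+ 2 <= 64 * y ^+ 2.
  rewrite -real_normK ?num_real// (_ : 64 * y ^+ 2 = (8 * y) ^+ 2); last by ring.
  by rewrite lerXn2r// nnegrE ?mulr_ge0.
have errY x : `|Y x - 2 * y * c * cos (X x)| <= 4 * y * q.
  have := elog_approx tau alpha (X x) q34; move/(ler_wpM2l r0).
  rewrite -{1}(ger0_norm r0) -normrM => h.
  rewrite (_ : Y x - _ = r * (elog q tau alpha (X x) - 2 * q * cos (X x) * cos (tau + alpha))).
    by apply: (le_trans h); rewrite /y le_eqVlt; apply/orP; left; apply/eqP; ring.
  by rewrite /Y /y /c; ring.
pose v := \int[P]_x (Y x ^+ 2).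
pose m := \int[P]_x Y x.
have v0 : 0 <= v by apply: Rintegral_ge0 => x _; exact: sqr_ge0.
have vy : v <= 64 * y ^+ 2.
  rewrite -(bmfE_cst P (64 * _)); apply: bmfE_le => //; exact: bmf_cst.
(* If Y is its main term plus e, then Y^2 is at least half the square of the main term minus e^2,
   with |e| <= 4 y q. *)
have vlow : y ^+ 2 * (2 * c ^+ 2 * delta - 16 * q ^+ 2) <= v.
  apply: (@le_trans _ _ (\int[P]_x (2 * y ^+ 2 * c ^+ 2 * cos (X x) ^+ 2 - 16 * y ^+ 2 * q ^+ 2))).
    rewrite bmfEB ?bmfEZ ?bmfE_cst//; try by bmf_tac.
    have h : 0 <= 2 * y ^+ 2 * c ^+ 2 by rewrite mulr_ge0 ?sqr_ge0// mulr_ge0 ?sqr_ge0.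
    have := ler_wpM2l h hdelta; lra.
  apply: bmfE_le => //.
    apply: bmfB; last exact: bmf_cst.
    by apply: bmfM => //; exact: bmf_cst.
  move=> x; have := errY x; set e := Y x - _ => he.
  have -> : Y x = 2 * y * c * cos (X x) + e by rewrite /e; ring.
  have e2 : e ^+ 2 <= 16 * y ^+ 2 * q ^+ 2.
    rewrite -real_normK ?num_real// (_ : 16 * y ^+ 2 * q ^+ 2 = (4 * y * q) ^+ 2); last by ring.
    by rewrite lerXn2r// nnegrE ?mulr_ge0.
  have := sqr_ge0 (y * c * cos (X x) + e); rewrite !expr2 in e2 *; nra.
have mup : m ^+ 2 <= y ^+ 2 * (8 * c1 ^+ 2 + 32 * q ^+ 2).
  have mc : m = 2 * y * c * \int[P]_x cos (X x) + \int[P]_x (Y x - 2 * y * c * cos (X x)).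
    rewrite (bmfEB P bY); last by bmf_tac.
    rewrite (bmfEZ P (2 * y * c) bcX).
    by rewrite addrCA subrr addr0.
  pose e := \int[P]_x (Y x - 2 * y * c * cos (X x)).
  have he : `|e| <= 4 * y * q by apply: bmfE_norm => //; bmf_tac.
  have e2 : e ^+ 2 <= 16 * y ^+ 2 * q ^+ 2.
    rewrite -real_normK ?num_real// (_ : 16 * y ^+ 2 * q ^+ 2 = (4 * y * q) ^+ 2); last by ring.
    by rewrite lerXn2r// nnegrE ?mulr_ge0.
  have ec2 : (\int[P]_x cos (X x)) ^+ 2 <= c1 ^+ 2.
    rewrite -real_normK ?num_real// lerXn2r// nnegrE//.
    by apply: le_trans hc1.
  have c21 : c ^+ 2 <= 1 by rewrite /c -[X in _ <= X](cos2Dsin2 (tau + alpha)) lerDl sqr_ge0.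
  rewrite -/e in mc; rewrite mc; move: (\int[P]_x cos (X x)) ec2 => E ec2.
  have : (2 * y * c * E + e) ^+ 2 <= 2 * (4 * y ^+ 2 * (c ^+ 2 * E ^+ 2)) + 2 * e ^+ 2.
    by have := sqr_ge0 (2 * y * c * E - e); nra.
  have : c ^+ 2 * E ^+ 2 <= c1 ^+ 2.
    by apply: le_trans ec2; rewrite ler_piMl ?sqr_ge0.
  move/(ler_wpM2l (_ : 0 <= 4 * y ^+ 2)); rewrite mulr_ge0 ?sqr_ge0// => /(_ isT).
  by nra.
have Cup : \int[P]_x cos (Y x) <= 1 - v / 8.
  rewrite (_ : 1 - v / 8 = \int[P]_x (1 - 8^-1 * Y x ^+ 2)).
    apply: bmfE_le => //.
      by apply: bmfB; [exact: bmf_cst|apply: bmfM => //; exact: bmf_cst].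
    by move=> x; have := cos_le (Y1 x); lra.
  rewrite bmfEB ?bmfE_cst ?bmfEZ//; try by bmf_tac.
  by rewrite -/v; ring.
have C0 : 0 <= \int[P]_x cos (Y x).
  apply: Rintegral_ge0 => x _; have := cos_ge (Y x); have := Y2 x; lra.
have Sup : `|\int[P]_x sin (Y x)| <= `|m| + v.
  have -> : \int[P]_x sin (Y x) = m + \int[P]_x (sin (Y x) - Y x).
    by rewrite bmfEB// -/m; ring.
  rewrite (le_trans (ler_normD _ _))// lerD2l.
  rewrite ler_norml; apply/andP; split.
    rewrite -mulN1r -bmfEZ//; apply: bmfE_le => //.
    - by apply: bmfM => //; exact: bmf_cst.
    - exact: bmfB.
    by move=> x; have := normr_subr_sin (Y1 x); rewrite ler_norml mulN1r => /andP[].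
  apply: bmfE_le => //; first exact: bmfB.
  by move=> x; have := normr_subr_sin (Y1 x); rewrite ler_norml => /andP[].
move: (\int[P]_x cos _) (\int[P]_x sin _) Cup C0 Sup => C S Cup C0 Sup.
have C2 : C ^+ 2 <= (1 - v / 8) ^+ 2 by rewrite lerXn2r// nnegrE//; lra.
have S2 : S ^+ 2 <= (`|m| + v) ^+ 2.
  by rewrite -real_normK ?num_real// lerXn2r// nnegrE// addr_ge0.
have m2 : `|m| ^+ 2 = m ^+ 2 by rewrite real_normK ?num_real.
have v1 : v <= 1 by lra.
have S3 : S ^+ 2 <= 2 * m ^+ 2 + 2 * v ^+ 2.
  by have := sqr_ge0 (`|m| - v); rewrite -m2; nra.
have C3 : C ^+ 2 <= 1 - v / 8 by nra.
have v2 : v ^+ 2 <= 64 * y ^+ 2 * (64 * y ^+ 2).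
  by rewrite expr2 ler_pM.
move: vlow mup C3 S3 v2; rewrite -/c.
move: (y ^+ 2) (c ^+ 2) (q ^+ 2) (c1 ^+ 2) (m ^+ 2) (v ^+ 2) => y2 cc qq cc1 mm vv.
nra.
Qed.

End euler_factor_characteristic.

(** * Almost sure convergence of series over primes *)

Lemma trunc_log2_bounds n : (0 < n)%N ->
  (2 ^ trunc_log 2 n <= n <= 2 ^ (trunc_log 2 n).+1)%N.
Proof. by move=> n0; rewrite trunc_logP//= ltnW// trunc_log_ltn. Qed.

(** The increments between consecutive powers of two are summable, and any other index is compared
    with the power of two below it. *)
Lemma dyadic_cvg (R : realType) (S : R ^nat) (C z : R) : 0 < z < 1 ->
  (forall k M, (2 ^ k <= M <= 2 ^ k.+1)%N -> `|S M - S (2 ^ k)%N| <= C * z ^+ k) ->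
  cvgn S.
Proof.
move=> /andP[z0 z1] HS.
pose u k := S (2 ^ k)%N.
have C0 : 0 <= C.
  have /HS : (2 ^ 0 <= 1 <= 2 ^ 1)%N by [].
  by rewrite expr0 mulr1; apply: le_trans.
have cu : cvgn u.
  have ct : cvgn (series (telescope u)).
    apply: (@normed_cvg R R^o).
    apply: (@series_le_cvg _ _ (geometric C z)) => [n|n|n|].
    - exact: normr_ge0.
    - by rewrite /geometric/= mulr_ge0// exprn_ge0// ltW.
    - by rewrite /telescope/= HS// leqnn andbT leq_exp2l.
    - by apply: is_cvg_geometric_series; rewrite gtr0_norm.
  have -> : u = (fun n => u 0%N + series (telescope u) n).
    by apply/funext => n; rewrite -eq_sum_telescope.
  by apply: is_cvgD => //; exact: is_cvg_cst.
apply/cvg_ex; exists (limn u); apply/cvgrPdist_le => e e0.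
have e20 : 0 < e / 2 by rewrite divr_gt0.
have [N1 _ h1] : \forall n \near \oo, `|limn u - u n| <= e / 2.
  by move/cvgrPdist_le: cu; exact.
have [N2 _ h2] : \forall n \near \oo, `|0 - geometric C z n| <= e / 2.
  have /cvgrPdist_le : geometric C z @ \oo --> (0 : R).
    by apply: cvg_geometric; rewrite gtr0_norm.
  exact.
exists (2 ^ maxn N1 N2)%N => // M /= NM.
have M0 : (0 < M)%N by rewrite (leq_trans _ NM)// expn_gt0.
have /HS := trunc_log2_bounds M0; set k := trunc_log 2 M => hk.
have : (maxn N1 N2 <= k)%N by apply: trunc_log_max.
rewrite geq_max => /andP[k1 k2].
have := h1 k k1; have := h2 k k2; rewrite /= sub0r normrN ger0_norm; last first.
  by rewrite mulr_ge0// exprn_ge0// ltW.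
move=> g1 g2.
have -> : limn u - S M = (limn u - u k) - (S M - S (2 ^ k)%N) by rewrite /u; ring.
rewrite (le_trans (ler_normB _ _))// [e]splitr lerD//.
exact: le_trans g1.
Qed.

Lemma exprn_ge_lin (R : realFieldType) (x : R) n : 0 <= x -> n%:R * x <= (1 + x) ^+ n.
Proof.
move=> x0; apply: (@le_trans _ _ (1 + n%:R * x)); first by rewrite lerDr.
elim: n => [|n IH]; first by rewrite mul0r addr0 expr0.
rewrite exprS -natr1; have : 0 <= n%:R * x by rewrite mulr_ge0.
nra.
Qed.

(* Summing [4^-k E exp (lambda_k |S_M - S_(2^k)|)] over the dyadic blocks gives an
   almost surely finite random variable, which controls all increments at once. *)
Lemma ae_cvg_of_exp_moments d (T : measurableType d) (R : realType)
    (P : probability T R) (S : nat -> T -> R) (C : R) (theta : R) (A : R) :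
  (forall n, bmf (S n)) -> 1 < theta -> 0 < A ->
  (forall k M, (2 ^ k <= M <= 2 ^ k.+1)%N ->
     \int[P]_x expR (A * theta ^+ (2 * k) * `|S M x - S (2 ^ k)%N x|) <= C) ->
  \forall x \ae P, cvgn (S ^~ x).
Proof.
move=> bS theta1 A0 HC.
(* A block has at most 2^(k+1) indices, each of expectation at most C, so the weight 4^-k leaves the
   summable bound 2 C 2^-k. *)
pose G k x := 4^-1 ^+ k * \sum_(2 ^ k <= M < (2 ^ k.+1).+1)
   expR (A * theta ^+ (2 * k) * `|S M x - S (2 ^ k)%N x|).
have theta0 : 0 < theta by exact: lt_trans theta1.
have lam0 k : 0 <= A * theta ^+ (2 * k) by rewrite mulr_ge0 ?exprn_ge0// ltW.
have bE k M : bmf (fun x => expR (A * theta ^+ (2 * k) * `|S M x - S (2 ^ k)%N x|)).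
  have [mSM [c1 SM]] := bS M; have [mSN [c2 SN]] := bS (2 ^ k)%N; split.
    apply: measurableT_comp; first exact: measurable_expR.
    by apply: measurable_funM => //; apply: measurableT_comp => //; exact: measurable_funB.
  exists (expR (A * theta ^+ (2 * k) * (c1 + c2))) => x.
  rewrite ger0_norm ?expR_ge0// ler_expR ler_wpM2l//.
  by rewrite (le_trans (ler_normB _ _))// lerD.
have bG k : bmf (G k) by apply: bmfM; [exact: bmf_cst|exact: bmf_sum].
have G0 k x : 0 <= G k x.
  by rewrite mulr_ge0 ?exprn_ge0//; apply: sumr_ge0 => M _; exact: expR_ge0.
have EG k : \int[P]_x G k x <= 2 * C * 2^-1 ^+ k.
  rewrite bmfEZ; last exact: bmf_sum.
  rewrite bmfE_sum//.
  apply: (@le_trans _ _ (4^-1 ^+ k * \sum_(2 ^ k <= M < (2 ^ k.+1).+1) C)).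
    rewrite ler_wpM2l ?exprn_ge0// big_nat [leRHS]big_nat; apply: ler_sum => M MM.
    by apply: HC; move: MM; rewrite ltnS.
  rewrite sumr_const_nat subSn; last by rewrite leq_exp2l.
  have C0 : 0 <= C.
    apply: le_trans (HC 0%N 1%N _) => //.
    by apply: Rintegral_ge0 => x _; exact: expR_ge0.
  apply: (@le_trans _ _ (4^-1 ^+ k * (C * (2 * 2 ^+ k)))).
    rewrite ler_wpM2l ?exprn_ge0// -[C *+ _]mulr_natr ler_wpM2l//.
    rewrite -natrX -natrM ler_nat expnS.
    have : (0 < 2 ^ k)%N by rewrite expn_gt0.
    by move: (2 ^ k)%N => N; lia.
  rewrite le_eqVlt; apply/orP; left; apply/eqP.
  have -> : 4^-1 = 2^-1 * 2^-1 :> R by rewrite -invfM -natrM.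
  rewrite exprMn [_ ^+ k * _]mulrC.
  transitivity (2 * C * 2^-1 ^+ k * (2^-1 ^+ k * 2 ^+ k)); first by ring.
  by rewrite -exprMn mulVf// expr1n mulr1.
pose F x := (\sum_(0 <= k <oo) (G k x)%:E)%E.
have mF : measurable_fun setT F.
  apply: ge0_emeasurable_sum => //.
    by move=> k x _ _; rewrite lee_fin.
  by move=> k _; apply/measurable_EFinP; have [] := bG k.
have iF : P.-integrable setT F.
  apply/integrableP; split => //.
  under eq_integral => x _.
    rewrite gee0_abs; last by apply: nneseries_ge0 => k _ _; rewrite lee_fin.
    over.
  rewrite integral_nneseries//; last 2 first.
  - by move=> k; apply/measurable_EFinP; have [] := bG k.
  - by move=> k x _; rewrite lee_fin.
  apply: (@le_lt_trans _ _ (4 * C)%:E); last exact: ltry.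
  apply: lime_le.
    by apply: is_cvg_nneseries => k _ _; apply: integral_ge0 => x _; rewrite lee_fin.
  apply: nearW => n.
  have EGE k : (\int[P]_x (G k x)%:E)%E = (\int[P]_x G k x)%:E.
    rewrite /Rintegral fineK//; apply: integrable_fin_num => //; exact: bmf_integrable.
  under eq_bigr do rewrite EGE.
  rewrite sumEFin lee_fin.
  apply: (@le_trans _ _ (\sum_(0 <= k < n) 2 * C * 2^-1 ^+ k)).
    by apply: ler_sum => k _.
  have C0 : 0 <= C.
    apply: le_trans (HC 0%N 1%N _) => //.
    by apply: Rintegral_ge0 => x _; exact: expR_ge0.
  have := @geometric_le_lim R n (2 * C) 2^-1.
  rewrite /series/=; move=> h; apply: (le_trans (h _ _ _)); rewrite ?mulr_ge0//.
    by rewrite ger0_norm//; lra.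
  rewrite ler_pdivrMr; lra.
apply: filterS (integrable_ae measurableT iF) => x /(_ I) Ffin.
pose c := fine (F x).
have Gc k : G k x <= c.
  rewrite -lee_fin fineK//.
  have := @nneseries_lim_ge R (fun k => (G k x)%:E) xpredT 0%N k.+1.
  rewrite big_nat_recr//= => /(_ _) h; apply: le_trans (h _); last first.
    by move=> n _ _; rewrite lee_fin.
  by rewrite sumEFin leeDr// lee_fin; apply: sumr_ge0.
have c0 : 0 < c.
  apply: lt_le_trans (Gc 0%N); rewrite /G expr0 mul1r big_nat_recl//=.
  by rewrite ltr_pwDl ?expR_gt0//; apply: sumr_ge0 => M _; exact: expR_ge0.
(* From G_k <= c, the increment is at most (ln c + k ln 4) / (A theta^(2k)). One of the two factors
   theta^k absorbs the linear growth through k (theta - 1) <= theta^k; the other remains as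
   geometric decay. *)
pose L := `|ln c| + ln 4 / (theta - 1).
apply: (@dyadic_cvg _ _ (L / A) theta^-1).
  by rewrite invr_gt0 theta0 invf_lt1.
move=> k M /andP[M1 M2].
have th1 : 0 < theta - 1 by rewrite subr_gt0.
have ln40 : 0 <= ln 4 :> R by rewrite ln_ge0// ler1n.
have kt : k%:R * (theta - 1) <= theta ^+ k.
  by have := exprn_ge_lin k (ltW th1); rewrite [1 + _]addrC subrK.
have : expR (A * theta ^+ (2 * k) * `|S M x - S (2 ^ k)%N x|) <= c * 4 ^+ k.
  have := Gc k; rewrite /G mulrC exprVn ler_pdivrMr ?exprn_gt0//; apply: le_trans.
  rewrite (big_rem M) ?mem_index_iota ?M1 ?ltnS//=.
  by rewrite lerDl; apply: sumr_ge0 => j _; exact: expR_ge0.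
rewrite -[X in _ <= X]lnK ?posrE ?mulr_gt0 ?exprn_gt0// ler_expR.
rewrite lnM ?posrE ?exprn_gt0// lnXn// => h.
have {}h : A * theta ^+ (2 * k) * `|S M x - S (2 ^ k)%N x| <= L * theta ^+ k.
  apply: (le_trans h); rewrite /L mulrDl lerD//.
    rewrite (le_trans (ler_norm _))// ler_peMr// exprn_ege1//; exact: ltW.
  rewrite -(mulr_natl (ln 4)) -[leRHS]mulrA [leLHS]mulrC ler_wpM2l// [leRHS]mulrC.
  by rewrite ler_pdivlMr.
rewrite -(ler_pM2l (_ : 0 < A * theta ^+ (2 * k))); last by rewrite mulr_gt0 ?exprn_gt0.
apply: (le_trans h); rewrite le_eqVlt; apply/orP; left; apply/eqP.
rewrite mul2n -addnn exprD exprVn; field.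
by rewrite (gt_eqF A0)/= gt_eqF// exprn_gt0.
Qed.

Section prime_series.
Context d (T : measurableType d) (R : realType) (P : probability T R).
Variables (X : nat -> T -> R) (Y : nat -> R -> R) (A kappa : R).
Hypothesis mX : forall p, measurable_fun setT (X p).
Hypothesis indX : mutually_independent P prime X.
Hypothesis bY : forall p, bmf (Y p).
Hypothesis kappa0 : 0 < kappa.
Hypothesis A1 : 1 <= A.
Hypothesis Y2 : forall p y, prime p -> Y p y ^+ 2 <= A * p%:R `^ (- 1 - kappa).
Hypothesis EY : forall p, prime p ->
  `|\int[P]_x Y p (X p x)| <= A * p%:R `^ (- 1 - kappa).

Let A0 : 0 < A. Proof. exact: lt_le_trans A1. Qed.

(** The scale lam = N^(kappa/2) / A makes both lam |E Y_p| and lam^2 Y_p^2 at most 1 / N for p >= N.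
    Each factor is then at most exp ((1 + exp 1) / N), and a block has at most N primes. The two
    signs e = 1 and e = -1 serve to bound exp |w|. *)
Lemma exp_moment_block (e : R) (N M : nat) : `|e| = 1 -> (0 < N)%N -> (M <= 2 * N)%N ->
  \int[P]_x expR (e * (N%:R `^ (kappa / 2) / A *
     \sum_(N <= p < M | prime p) Y p (X p x))) <= expR (1 + expR 1).
Proof.
have k0 := kappa0; move=> e1 N0 MN; set lam := N%:R `^ (kappa / 2) / A.
have NR : 0 < N%:R :> R by rewrite ltr0n.
have lam0 : 0 <= lam by rewrite divr_ge0 ?powR_ge0// ltW.
set J := [seq p <- index_iota N M | prime p].
have uJ : uniq J by rewrite filter_uniq ?iota_uniq.
have pJ : all prime J by exact: filter_all.
have sJ : (size J <= N)%N.
  rewrite size_filter (leq_trans (count_size _ _))// size_iota; lia.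
have bY' p : bmf (fun y => e * lam * Y p y) by apply: bmfM => //; exact: bmf_cst.
rewrite (_ : \int[P]_x _ = \int[P]_x expR (\sum_(p <- J) e * lam * Y p (X p x))); last first.
  apply: eq_Rintegral => x _; by rewrite mulrA mulr_sumr big_filter.
rewrite (expectation_expR_sum mX indX (Y := fun p y => e * lam * Y p y))//.
have pN p : p \in J -> lam * (A * p%:R `^ (- 1 - kappa)) <= N%:R^-1 /\
    lam ^+ 2 * (A * p%:R `^ (- 1 - kappa)) <= N%:R^-1.
  rewrite mem_filter mem_index_iota => /and3P[pp Np _].
  have pow : p%:R `^ (- 1 - kappa) <= N%:R `^ (- 1 - kappa) :> R.
    rewrite -opprD !powRN lef_pV2 ?posrE ?powR_gt0 ?ltr0n ?(prime_gt0 pp)//.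
    by rewrite ler_powRl ?ler_nat// addr_ge0// ltW.
  have N1 : 1 <= N%:R :> R by rewrite ler1n.
  have powA (a b : R) : N%:R `^ (a + b) = N%:R `^ a * N%:R `^ b.
    by rewrite powRD//; apply/implyP => _; rewrite (gt_eqF NR).
  have h1 : N%:R `^ (kappa / 2) * N%:R `^ (- 1 - kappa) <= N%:R^-1 :> R.
    by rewrite -powA -(powR_inv1 (ltW NR)) ler_powR//; lra.
  have h2 : N%:R `^ (kappa / 2) ^+ 2 * N%:R `^ (- 1 - kappa) <= N%:R^-1 :> R.
    by rewrite expr2 -!powA -(powR_inv1 (ltW NR)) ler_powR//; lra.
  split.
    have -> : lam * (A * p%:R `^ (- 1 - kappa)) =
        N%:R `^ (kappa / 2) * p%:R `^ (- 1 - kappa).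
      by rewrite /lam; field; rewrite gt_eqF.
    by apply: le_trans h1; rewrite ler_wpM2l ?powR_ge0.
  have -> : lam ^+ 2 * (A * p%:R `^ (- 1 - kappa)) =
      N%:R `^ (kappa / 2) ^+ 2 * p%:R `^ (- 1 - kappa) / A.
    by rewrite /lam; field; rewrite gt_eqF.
  rewrite ler_pdivrMr// (le_trans _ (ler_peMr _ A1)) ?invr_ge0//.
  by apply: le_trans h2; rewrite ler_wpM2l ?sqr_ge0.
apply: (@le_trans _ _ (expR ((1 + expR 1) / N%:R) ^+ size J)); last first.
  by rewrite -expRM_natl ler_expR mulrA ler_pdivrMr// [leLHS]mulrC ler_wpM2l ?ler_nat//.
apply: prod_le_exp_size => p pp.
rewrite Rintegral_ge0/=; last by move=> x _; exact: expR_ge0.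
have [h1 h2] := pN p pp.
have pr : prime p by rewrite (allP pJ).
have N1 : N%:R^-1 <= 1 :> R by rewrite invf_le1// ler1n.
have Y1 x : (lam * Y p (X p x)) ^+ 2 <= N%:R^-1.
  by rewrite exprMn (le_trans _ h2)// ler_wpM2l ?sqr_ge0// Y2.
have bYX : bmf (fun x => Y p (X p x)) by exact: bmf_comp.
have e2 : e ^+ 2 = 1 by rewrite -real_normK ?num_real// e1 expr1n.
apply: (@le_trans _ _ (\int[P]_x ((1 + expR 1 * N%:R^-1) + e * lam * Y p (X p x)))).
  apply: bmfE_le.
  - split; last first.
      exists (expR 1) => x; rewrite ger0_norm ?expR_ge0// ler_expR.
      have /(le_trans (Y1 x)) : N%:R^-1 <= 1 :> R by [].
      rewrite -[X in X <= _]real_normK ?num_real// expr_le1// => /(le_trans _); apply.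
      by rewrite -mulrA (le_trans (ler_norm _))// normrM e1 mul1r.
    by apply: measurableT_comp => //; have [] := bmf_comp (bY' p) (mX p).
  - by bmf_tac.
  move=> x; set w := e * lam * Y p (X p x).
  have w2 : w ^+ 2 <= N%:R^-1 by rewrite /w -mulrA exprMn e2 mul1r.
  have w1 : `|w| <= 1.
    by rewrite -(@expr_le1 _ 2)// real_normK ?num_real// (le_trans w2).
  apply: (le_trans (expR_le_quad w1)).
  by rewrite addrAC lerD2r lerD2l ler_wpM2l ?expR_ge0.
rewrite bmfED ?bmfE_cst ?bmfEZ//; try by bmf_tac.
have hE : e * lam * \int[P]_x Y p (X p x) <= N%:R^-1.
  rewrite (le_trans (ler_norm _))// -mulrA normrM e1 mul1r normrM (ger0_norm lam0).
  by rewrite (le_trans _ h1)// ler_wpM2l// EY.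
apply: le_trans (expR_ge1Dx _); rewrite mulrDl mul1r; lra.
Qed.

Lemma ae_cvg_prime_series :
  \forall x \ae P, cvgn (fun N => \sum_(0 <= p < N | prime p) Y p (X p x)).
Proof.
pose S N x := \sum_(0 <= p < N | prime p) Y p (X p x).
have bS N : bmf (S N).
  rewrite /S; under eq_fun do rewrite big_mkcond/=.
  apply: bmf_sum => p; case: (prime p); last exact: bmf_cst.
  exact: bmf_comp.
(* With this base, z^(2k) = N^(kappa/2) for N = 2^k, the scale of the block estimate. *)
pose z : R := 2 `^ (kappa / 4).
have z1 : 1 < z.
  have k4 : 0 < kappa / 4 by rewrite divr_gt0.
  have := @gt0_ltr_powR _ _ k4 1 2; rewrite powR1 !nnegrE; apply => //.
  by rewrite ltr1n.
apply: (@ae_cvg_of_exp_moments _ _ _ _ S (2 * expR (1 + expR 1)) z A^-1) => //.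
  by rewrite invr_gt0.
move=> k M /andP[M1 M2].
set N := (2 ^ k)%N in M1 *.
have N0 : (0 < N)%N by rewrite expn_gt0.
have lamE : A^-1 * z ^+ (2 * k) = N%:R `^ (kappa / 2) / A.
  rewrite mulrC /z -powR_mulrn ?powR_ge0// -powRrM /N natrX -powR_mulrn// -powRrM.
  by congr (_ `^ _ / _); rewrite natrM; field.
rewrite lamE; set lam := _ / A.
have lam0 : 0 <= lam by rewrite divr_ge0 ?powR_ge0// ltW.
have SE x : S M x - S N x = \sum_(N <= p < M | prime p) Y p (X p x).
  by rewrite /S (@big_cat_nat _ _ _ N 0 M)//= addrAC subrr add0r.
have MN : (M <= 2 * N)%N by rewrite /N -expnS.
have bE e : bmf (fun x => expR (e * (lam * \sum_(N <= p < M | prime p) Y p (X p x)))).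
  have : bmf (fun x => e * (lam * (S M x - S N x))) by bmf_tac.
  under eq_fun do rewrite SE; move=> [mf [c fc]]; split.
    by apply: measurableT_comp => //; exact: measurable_expR.
  exists (expR c) => x; rewrite ger0_norm ?expR_ge0// ler_expR.
  by rewrite (le_trans (ler_norm _)).
apply: (@le_trans _ _ (\int[P]_x
    (expR (1 * (lam * \sum_(N <= p < M | prime p) Y p (X p x))) +
     expR (-1 * (lam * \sum_(N <= p < M | prime p) Y p (X p x)))))).
  apply: bmfE_le.
  - have [mSM [c1 SM]] := bS M; have [mSN [c2 SN]] := bS N; split.
      apply: measurableT_comp; first exact: measurable_expR.
      by apply: measurable_funM => //; apply: measurableT_comp => //; exact: measurable_funB.
    exists (expR (lam * (c1 + c2))) => x.
    rewrite ger0_norm ?expR_ge0// ler_expR ler_wpM2l//.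
    by rewrite (le_trans (ler_normB _ _))// lerD.
  - exact: bmfD.
  move=> x; rewrite SE mul1r mulN1r; set w := \sum_(_ <= _ < _ | _) _.
  case: (ltrP w 0) => w0; last by rewrite ger0_norm// lerDl expR_ge0.
  by rewrite ltr0_norm// mulrN lerDr expR_ge0.
rewrite bmfED// mulr_natl mulr2n lerD//; apply: exp_moment_block => //.
- by rewrite normr1.
- by rewrite normrN1.
Qed.

End prime_series.

(** * Fourier inversion *)

Section fourier_inversion.
Context d (T : measurableType d) (R : realType) (P : probability T R).
Context d1 (X : measurableType d1) (zeta : {sigma_finite_measure set X -> \bar R}).
Context d2 (V : measurableType d2) (mu : {sigma_finite_measure set V -> \bar R}).
Variables (h : X -> V -> T -> R) (e : nat -> X -> R) (einf : X -> R)
  (K : nat -> V -> T -> R) (Phi : X -> R).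
Hypothesis mh : forall u, measurable_fun setT (fun z : X * T => h z.1 u z.2).
Hypothesis h1 : forall xi u x, `|h xi u x| <= 1.
Hypothesis me : forall n, measurable_fun setT (e n).
Hypothesis e01 : forall n xi, 0 <= e n xi <= einf xi.
Hypothesis ie : forall n, zeta.-integrable setT (EFin \o e n).
Hypothesis e_cvg : forall xi, e ^~ xi @ \oo --> einf xi.
Hypothesis KE : forall n u x,
  (\int[zeta]_xi (e n xi * h xi u x)%:E)%E = (K n u x)%:E.
Hypothesis K0 : forall n u x, 0 <= K n u x.
Hypothesis mK : forall n, measurable_fun setT (fun z : V * T => K n z.1 z.2).
Hypothesis iPhi : zeta.-integrable setT (EFin \o Phi).
Hypothesis hPhi : forall xi u, einf xi * `|\int[P]_x h xi u x| <= Phi xi.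

(** One frame serves the line and the plane: [zeta] is Lebesgue measure on frequencies, [h] a cosine
    or a product of two, [e n] the damping and [K n] its cosine transform. This is pi, respectively
    pi^2, times the density. *)
Definition inversion_density (u : V) : R :=
  \int[zeta]_xi (einf xi * \int[P]_x h xi u x).

Let bh xi u : bmf (fun x => h xi u x).
Proof.
split; last by exists 1.
have := measurableT_comp (mh u) (measurable_pair1 xi).
by apply.
Qed.

Let mEh u : measurable_fun setT (fun xi => \int[P]_x h xi u x).
Proof.
(* Adding 1 makes the integrand nonnegative, so that Tonelli's theorem gives measurability. *)
have mf : measurable_fun setT (fun z : X * T => (h z.1 u z.2 + 1)%:E).
  by apply/measurable_EFinP; exact: measurable_funD.
have f0 (z : X * T) : (0 <= (h z.1 u z.2 + 1)%:E)%E.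
  by rewrite lee_fin; have := h1 z.1 u z.2; rewrite ler_norml; lra.
have mF := measurableT_comp (fine_measurable measurableT)
  (measurable_fun_fubini_tonelli_F (m2 := P) _ mf f0).
have -> : (fun xi => \int[P]_x h xi u x) =
    (fun xi => fine (\int[P]_y (h xi u y + 1)%:E)%E - 1).
  apply/funext => xi; rewrite -/(Rintegral _ _ _) bmfED ?bmfE_cst ?addrK//.
  exact: bmf_cst.
exact: measurable_funB.
Qed.

Let bnd (a : R) xi u : 0 <= a <= einf xi -> `|a * \int[P]_x h xi u x| <= Phi xi.
Proof.
move=> /andP[a0 a1]; rewrite normrM (ger0_norm a0).
by rewrite (le_trans _ (hPhi xi u))// ler_wpM2r.
Qed.

(** The damping makes Fubini legitimate: [e n] is integrable and |h| <= 1, whereas [einf] is not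
    assumed integrable. *)
Lemma expectation_kernelE n u :
  (\int[P]_x (K n u x)%:E)%E = (\int[zeta]_xi (e n xi * \int[P]_x h xi u x)%:E)%E.
Proof.
under eq_integral do rewrite -KE.
have mf : measurable_fun setT (fun z : X * T => (e n z.1 * h z.1 u z.2)%:E).
  apply/measurable_EFinP; apply: measurable_funM => //.
  by apply: measurableT_comp => //; exact: measurable_fst.
rewrite -(@Fubini _ _ _ _ _ zeta P (fun z : X * T => (e n z.1 * h z.1 u z.2)%:E)).
  apply: eq_integral => xi _ /=.
  rewrite -[LHS]fineK; last first.
    apply: integrable_fin_num => //; apply: bmf_integrable.
    by apply: bmfM => //; exact: bmf_cst.
  by congr EFin; rewrite -/(Rintegral _ _ _) bmfEZ.
apply/integrable12ltyP => //.
apply: (@le_lt_trans _ _ (\int[zeta]_xi (e n xi)%:E)%E); last first.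
  have /integrableP[_] := ie n; apply: le_lt_trans.
  apply: ge0_le_integral => //.
  - by move=> xi _; rewrite lee_fin; have /andP[] := e01 n xi.
  - exact/measurable_EFinP.
  - by apply: measurableT_comp => //; exact/measurable_EFinP.
  - by move=> xi _ /=; rewrite lee_fin ler_norm.
apply: ge0_le_integral => //.
- by move=> xi _; exact: integral_ge0.
- apply: (measurable_fun_fubini_tonelli_F (m2 := P)
    (fun z : X * T => `|(e n z.1 * h z.1 u z.2)%:E|%E)) => //.
  exact: measurableT_comp.
- exact/measurable_EFinP.
move=> xi _; apply: (@le_trans _ _ (\int[P]_x (e n xi)%:E)%E).
  apply: ge0_le_integral => //.
  - apply: measurableT_comp => //; apply/measurable_EFinP.
    apply: measurable_funM => /=; [exact: measurable_cst|by have [] := bh xi u].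
  - move=> x _; have /andP[e0 _] := e01 n xi.
    by rewrite /= lee_fin normrM (ger0_norm e0) ler_piMr.
by rewrite (integral_cst P measurableT (e n xi)%:E)/= (@probability_setT _ _ _ P) mule1.
Qed.

(** The damping is removed after averaging over [T]: only the expectation of [h] decays, and it is
    dominated by [Phi]. *)
Lemma inversion_density_cvg u :
  (\int[P]_x (K n u x)%:E)%E @[n --> \oo] --> (inversion_density u)%:E.
Proof.
have einf01 xi : 0 <= einf xi <= einf xi.
  by rewrite lexx andbT; have /andP[/le_trans] := e01 0 xi; apply.
have meinf : measurable_fun setT einf.
  by apply: (@measurable_fun_cvg _ _ _ _ e) => // xi _; exact: e_cvg.
have -> : (inversion_density u)%:E = (\int[zeta]_xi (einf xi * \int[P]_x h xi u x)%:E)%E.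
  rewrite -[RHS]fineK//; apply: integrable_fin_num => //.
  apply: (@le_integrable _ _ _ _ _ _ _ (EFin \o Phi)) => //.
    by apply/measurable_EFinP; exact: measurable_funM.
  move=> xi _ /=; rewrite lee_fin (le_trans (bnd u (einf01 xi)))//.
  exact: ler_norm.
under eq_cvg do rewrite expectation_kernelE.
apply: (@dominated_cvg _ _ _ _ _ _ _ _ (EFin \o Phi)) => //.
- by move=> n; apply/measurable_EFinP; exact: measurable_funM.
- move=> xi _; apply: cvg_EFin; first exact: nearW.
  by apply: cvgM; [exact: e_cvg|exact: cvg_cst].
- by move=> n xi _ /=; rewrite lee_fin bnd.
Qed.

(** The sign is invisible in the Fourier integral; it is inherited from the nonnegative kernels. *)
Lemma inversion_density_ge0 u : 0 <= inversion_density u.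
Proof.
rewrite -lee_fin; apply: (cvge_to_ge (@inversion_density_cvg u)).
by apply: nearW => n; apply: integral_ge0 => x _; rewrite lee_fin.
Qed.

Let c : R := fine (\int[zeta]_xi (Phi xi)%:E)%E.

Let EKc n u : (\int[P]_x (K n u x)%:E <= c%:E)%E.
Proof.
rewrite /c fineK; last exact: integrable_fin_num.
rewrite expectation_kernelE; apply: le_integral => //.
- apply: (@le_integrable _ _ _ _ _ _ _ (EFin \o Phi)) => //.
    by apply/measurable_EFinP; exact: measurable_funM.
  by move=> xi _ /=; rewrite lee_fin (le_trans _ (ler_norm _))// bnd.
by move=> xi _; rewrite lee_fin (le_trans (ler_norm _))// bnd.
Qed.

Lemma inversion_density_le u : inversion_density u <= c.
Proof.
rewrite -lee_fin; apply: (cvge_to_le (@inversion_density_cvg u)).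
by apply: nearW => n; exact: EKc.
Qed.

Lemma inversion_density_lip u v D :
  (forall xi, einf xi * `|\int[P]_x h xi u x - \int[P]_x h xi v x| <= D * Phi xi) ->
  `|inversion_density u - inversion_density v| <= D * c.
Proof.
move=> hD.
have iw w : zeta.-integrable setT (EFin \o (fun xi => einf xi * \int[P]_x h xi w x)).
  apply: (@le_integrable _ _ _ _ _ _ _ (EFin \o Phi)) => //.
    apply/measurable_EFinP; apply: measurable_funM => //.
    by apply: (@measurable_fun_cvg _ _ _ _ e) => // xi _; exact: e_cvg.
  move=> xi _ /=; rewrite lee_fin (le_trans _ (ler_norm _))// bnd// lexx andbT.
  by have /andP[/le_trans] := e01 0 xi; apply.
have iD : zeta.-integrable setT (EFin \o (fun xi =>
    einf xi * \int[P]_x h xi u x - einf xi * \int[P]_x h xi v x)).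
  exact: (integrableB measurableT (iw u) (iw v)).
rewrite /inversion_density -RintegralB// (le_trans (le_normr_Rintegral _ iD))//.
rewrite /c -[fine _]/(\int[zeta]_xi Phi xi) -RintegralZl//.
apply: le_Rintegral => //.
- exact: integrable_norm.
- exact: (integrableZl measurableT D iPhi).
move=> xi _; rewrite -mulrBr normrM ger0_norm//.
by have /andP[/le_trans] := e01 0 xi; apply.
Qed.

Let mEK n : measurable_fun setT (fun u => \int[P]_x (K n u x)%:E)%E.
Proof.
apply: (measurable_fun_fubini_tonelli_F (m2 := P) (fun z : V * T => (K n z.1 z.2)%:E)).
  exact/measurable_EFinP.
by move=> z; rewrite lee_fin.
Qed.

Lemma measurable_inversion_density : measurable_fun setT inversion_density.
Proof.
apply/measurable_EFinP.
apply: (@emeasurable_fun_cvg _ _ _ _ (fun n u => \int[P]_x (K n u x)%:E)%E) => //.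
by move=> u _; exact: inversion_density_cvg.
Qed.

(** The expected kernels are bounded by [c] uniformly in n and u, so a set of finite measure is
    enough for dominated convergence. *)
Lemma inversion_density_integral_cvg B : measurable B -> (mu B < +oo)%E ->
  (\int[P]_x \int[mu]_(u in B) (K n u x)%:E)%E @[n --> \oo] -->
  (\int[mu]_(u in B) (inversion_density u)%:E)%E.
Proof.
move=> mB Boo.
have swap n : (\int[P]_x \int[mu]_(u in B) (K n u x)%:E)%E =
    (\int[mu]_(u in B) \int[P]_x (K n u x)%:E)%E.
  pose f (z : V * T) := (K n z.1 z.2 * \1_B z.1)%:E.
  have f0 z : (0 <= f z)%E by rewrite lee_fin mulr_ge0.
  have mf : measurable_fun setT f.
    apply/measurable_EFinP; apply: measurable_funM => //.
    by apply: measurableT_comp => //; exact: measurable_indic.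
  have fE u x : f (u, x) = ((fun u => (K n u x)%:E) \_ B) u.
    by rewrite /f /patch indicE; case: ifPn; rewrite ?mulr1 ?mulr0.
  rewrite [RHS]integral_mkcond.
  transitivity (\int[P]_x \int[mu]_u f (u, x))%E.
    apply: eq_integral => x _; rewrite integral_mkcond.
    by apply: eq_integral => u _; rewrite fE.
  rewrite -(fubini_tonelli (m1 := mu) (m2 := P) f mf f0); apply: eq_integral => u _.
  rewrite /patch; case: ifPn => uB.
    by apply: eq_integral => x _; rewrite fE /patch uB.
  by under eq_integral do rewrite fE /patch (negPf uB); rewrite integral0.
under eq_cvg do rewrite swap.
apply: (@dominated_cvg _ _ _ _ _ _ _ _ (cst c%:E)) => //.
- by move=> n; exact: measurable_funTS.
- by move=> u _; exact: inversion_density_cvg.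
- by apply: (measurable_bounded_integrable (f := cst c) mB Boo) => //; exact: bounded_cst.
- move=> n u _; rewrite gee0_abs//; apply: integral_ge0 => x _; by rewrite lee_fin.
Qed.

End fourier_inversion.

(** * The Cauchy kernel as a damped cosine transform *)

Section cauchy_kernel.
Variable R : realType.
Notation leb := (@lebesgue_measure R).
Implicit Types (eps x xi : R).

(** A primitive of exp (- eps xi) (1 + cos (x xi)) that vanishes at infinity. The added 1 makes the
    integrand nonnegative, as the fundamental theorem on a half-line requires; it is subtracted
    afterwards. *)
Let F eps x xi := expR (- (eps * xi)) *
  ((x * sin (x * xi) - eps * cos (x * xi)) / (eps ^+ 2 + x ^+ 2) - eps^-1).

Let is_deriveF eps x xi : 0 < eps ->
  is_derive xi 1 (F eps x) (expR (- (eps * xi)) * (1 + cos (x * xi))).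
Proof.
move=> eps0; rewrite /F.
have ds : is_derive xi 1 (fun xi => sin (x * xi)) (x * cos (x * xi)).
  by apply: is_derive_eq; rewrite /GRing.scale/=; ring.
have dc : is_derive xi 1 (fun xi => cos (x * xi)) (- (x * sin (x * xi))).
  by apply: is_derive_eq; rewrite /GRing.scale/=; ring.
apply: is_derive_eq; rewrite /GRing.scale/=; field.
rewrite (gt_eqF eps0)/= gt_eqF// ltr_wpDr ?sqr_ge0// exprn_gt0//.
Qed.

Let cvgF eps x : 0 < eps -> F eps x xi @[xi --> +oo%R] --> 0.
Proof.
move=> eps0; pose C := (`|x| + eps) / (eps ^+ 2 + x ^+ 2) + eps^-1.
have d0 : 0 < eps ^+ 2 + x ^+ 2 by rewrite ltr_wpDr ?sqr_ge0// exprn_gt0.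
apply/norm_cvg0P.
apply: (@squeeze_cvgr _ _ _ _ (fun=> 0) (fun xi => expR (- (eps * xi)) * C)).
- apply: nearW => xi; rewrite normr_ge0/= normrM ger0_norm ?expR_ge0// ler_wpM2l ?expR_ge0//.
  rewrite (le_trans (ler_normB _ _))// lerD//; last by rewrite ger0_norm// invr_ge0 ltW.
  rewrite normrM normfV (gtr0_norm d0) ler_wpM2r ?invr_ge0 ?(ltW d0)//.
  rewrite (le_trans (ler_normB _ _))// !normrM (gtr0_norm eps0) lerD//.
    by rewrite ler_piMr// sin_max.
  by rewrite ler_piMr ?cos_max// ltW.
- exact: cvg_cst.
rewrite -[X in _ --> X](mul0r C); apply: cvgM; last exact: cvg_cst.
apply: (cvg_comp (fun xi => eps * xi) (fun y => expR (- y))); last exact: cvgr_expR.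
by apply: gt0_cvgMry => //; exact: cvg_id.
Qed.

Let continuous_f eps x : continuous (fun xi => expR (- (eps * xi)) * (1 + cos (x * xi))).
Proof.
move=> xi; apply: differentiable_continuous; apply/derivable1_diffP.
have dc : is_derive xi 1 (fun xi => cos (x * xi)) (- (x * sin (x * xi))).
  by apply: is_derive_eq; rewrite /GRing.scale/=; ring.
by apply: ex_derive.
Qed.

Let integral_f eps x : 0 < eps ->
  (\int[leb]_(xi in `[0%R, +oo[) (expR (- (eps * xi)) * (1 + cos (x * xi)))%:E =
   (eps / (eps ^+ 2 + x ^+ 2) + eps^-1)%:E)%E.
Proof.
move=> eps0.
have dF xi := @is_deriveF eps x xi eps0.
rewrite (@ge0_continuous_FTC2y R _ (F eps x) 0 0)//.
- rewrite /F !mulr0 oppr0 expR0 sin0 cos0; rewrite -EFinB; congr EFin; ring.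
- by apply: continuous_subspaceT; exact: continuous_f.
- exact: cvgF.
- apply: cvg_at_right_filter; apply: differentiable_continuous; apply/derivable1_diffP.
  exact: ex_derive.
- by move=> xi _; rewrite derive1E; apply: derive_val.
Qed.

Let measurable_expRZ eps : measurable_fun setT (fun xi => expR (- (eps * xi))).
Proof.
apply: measurableT_comp; first exact: measurable_expR.
by apply: measurableT_comp => //; exact: measurable_funM.
Qed.

Lemma measurable_cosZ x : measurable_fun setT (fun xi : R => cos (xi * x)).
Proof.
apply: (measurableT_comp (continuous_measurable_fun (@continuous_cos R))).
exact: measurable_funM.
Qed.

Let integral_expR eps : 0 < eps ->
  (\int[leb]_(xi in `[0%R, +oo[) (expR (- (eps * xi)))%:E = (eps^-1)%:E)%E.
Proof.
(* At x = 0 the factor 1 + cos is the constant 2. *)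
move=> eps0; have := integral_f 0 eps0.
under eq_integral => xi _ do rewrite mul0r cos0 -mulr2n -natr1 mulrC EFinM.
rewrite ge0_integralZl//; last first.
  by apply/measurable_EFinP; apply: measurable_funTS; exact: measurable_expRZ.
move=> E; rewrite -[LHS]mul1e.
rewrite -[1%E](_ : ((1 + 1)^-1%:E * (1 + 1)%:E)%E = 1%E); last first.
  by rewrite -EFinM mulVf.
rewrite -muleA E -EFinM; congr EFin; field.
by rewrite gt_eqF.
Qed.

Definition damp n xi : R := expR (- (n.+1%:R^-1 * xi)) * \1_(`[0, +oo[) xi.

Lemma measurable_damp n : measurable_fun setT (damp n).
Proof. by apply: measurable_funM => //; exact: measurable_indic. Qed.

Lemma damp_ge0_le n xi : 0 <= damp n xi <= \1_(`[0, +oo[) xi.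
Proof.
rewrite /damp mulr_ge0 ?expR_ge0//= indicE; case: (boolP (xi \in _)) => xi0.
  rewrite mulr1 -expR0 ler_expR oppr_le0 mulr_ge0// ?invr_ge0//.
  by move: xi0; rewrite inE/= in_itv/= andbT.
by rewrite mulr0.
Qed.

Lemma damp_cvg xi : damp ^~ xi @ \oo --> (\1_(`[0, +oo[) xi : R).
Proof.
have h0 : (fun n => - (n.+1%:R^-1 * xi)) @ \oo --> (0 : R).
  have := cvgN (cvgM (@cvg_harmonic R) (cvg_cst xi)).
  by rewrite mul0r oppr0; apply.
have h1 : (fun n => expR (- (n.+1%:R^-1 * xi))) @ \oo --> (1 : R).
  by have := cvg_comp _ _ h0 (@continuous_expR R 0); rewrite expR0; apply.
have := cvgM h1 (cvg_cst (\1_(`[0, +oo[) xi : R)).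
by rewrite mul1r; apply.
Qed.

Let damp_restrict n (g : R -> R) :
  (fun xi => (damp n xi * g xi)%:E) =
  (fun xi => (expR (- (n.+1%:R^-1 * xi)) * g xi)%:E) \_ `[0, +oo[.
Proof.
apply/funext => xi; rewrite /damp patchE indicE.
by case: (_ \in _); rewrite ?mulr1// mulr0 mul0r.
Qed.

Lemma integrable_damp n : leb.-integrable setT (EFin \o damp n).
Proof.
apply/integrableP; split; first by apply/measurable_EFinP; exact: measurable_damp.
under eq_integral => xi _.
  rewrite /= ger0_norm; last by have /andP[] := damp_ge0_le n xi.
  rewrite -[damp n xi]mulr1.
  over.
rewrite (damp_restrict n (fun=> 1)) -integral_mkcond.
under eq_integral do rewrite mulr1.
by rewrite integral_expR// ltry.
Qed.

(** This is pi times the Cauchy density of scale 1 / (n + 1). *)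
Definition ckern n x : R := n.+1%:R^-1 / (n.+1%:R^-1 ^+ 2 + x ^+ 2).

Lemma integral_damp_cos n x :
  (\int[leb]_xi (damp n xi * cos (xi * x))%:E = (ckern n x)%:E)%E.
Proof.
rewrite (damp_restrict n (fun xi => cos (xi * x))) -integral_mkcond.
set eps := n.+1%:R^-1.
have eps0 : 0 < eps by rewrite invr_gt0.
have ie : leb.-integrable `[0, +oo[ (EFin \o (fun xi => expR (- (eps * xi)))).
  apply/integrableP; split; first by apply/measurable_EFinP; apply: measurable_funTS; exact: measurable_expRZ.
  under eq_integral do rewrite /= ger0_norm ?expR_ge0//.
  by rewrite integral_expR// ltry.
have i1 : leb.-integrable `[0, +oo[
    (EFin \o (fun xi => expR (- (eps * xi)) * (1 + cos (x * xi)))).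
  apply/integrableP; split.
    apply/measurable_EFinP; apply: measurable_funTS.
    by apply: continuous_measurable_fun; exact: continuous_f.
  under eq_integral => xi _.
    rewrite /= ger0_norm; last first.
      by rewrite mulr_ge0 ?expR_ge0//; have := cos_geN1 (x * xi); lra.
    over.
  by rewrite integral_f// ltry.
transitivity (\int[leb]_(xi in `[0%R, +oo[)
   ((expR (- (eps * xi)) * (1 + cos (x * xi)))%:E - (expR (- (eps * xi)))%:E))%E.
  apply: eq_integral => xi _; rewrite -EFinB; congr EFin; rewrite [xi * x]mulrC; ring.
rewrite integralB_EFin//= integral_f// integral_expR// -EFinB; congr EFin.
by rewrite addrK.
Qed.

Lemma ckern_ge0 n x : 0 <= ckern n x.
Proof. by rewrite divr_ge0 ?invr_ge0// addr_ge0 ?sqr_ge0. Qed.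

Lemma continuous_ckern n : continuous (ckern n).
Proof.
move=> x; apply: cvgM; first exact: cvg_cst.
apply: cvgV.
  by rewrite gt_eqF// ltr_wpDr ?sqr_ge0// exprn_gt0// invr_gt0.
by apply: cvgD; [exact: cvg_cst|exact: exprn_continuous].
Qed.

Lemma integral_ckern n a b x : a < b ->
  (\int[leb]_(u in `[a, b]) (ckern n (u - x))%:E =
   (atan ((b - x) * n.+1%:R) - atan ((a - x) * n.+1%:R))%:E)%E.
Proof.
move=> ab.
pose G (u : R) := atan ((u - x) * n.+1%:R).
have dG (u : R) : is_derive u 1 G (ckern n (u - x)).
  rewrite /G; apply: is_derive_eq; rewrite /GRing.scale/= /ckern mulr0 add0r subr0 mulr1.
  have d1 : 1 + ((u - x) * n.+1%:R) ^+ 2 != 0.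
    by rewrite gt_eqF// ltr_pwDl// sqr_ge0.
  have m0 : n.+1%:R != 0 :> R by rewrite pnatr_eq0.
  have -> : n.+1%:R^-1 ^+ 2 + (u - x) ^+ 2 =
      (1 + ((u - x) * n.+1%:R) ^+ 2) * n.+1%:R^-1 ^+ 2.
    by field; rewrite addrC natr1.
  move: n.+1%:R (1 + _) m0 d1 => m c m0 c0; field.
  by rewrite m0 c0.
have cG : continuous G.
  move=> u; apply: differentiable_continuous; apply/derivable1_diffP; exact: ex_derive.
rewrite (@continuous_FTC2 R _ G a b ab).
- by rewrite EFinB.
- apply: continuous_subspaceT => u; apply: (@continuous_comp _ _ _ (fun u : R => u - x) (ckern n)).
    by apply: cvgB; [exact: cvg_id|exact: cvg_cst].
  exact: continuous_ckern.
- split; [by move=> u _; exact: ex_derive| |].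
    by apply: cvg_at_right_filter; exact: cG.
  by apply: cvg_at_left_filter; exact: cG.
- by move=> u _; rewrite derive1E; apply: derive_val.
Qed.

Definition invoneDsq xi : R := (1 + xi ^+ 2)^-1 * \1_(`[0, +oo[) xi.

Lemma integrable_invoneDsq : leb.-integrable setT (EFin \o invoneDsq).
Proof.
have inv0 xi : 0 <= (1 + xi ^+ 2)^-1 by rewrite invr_ge0 addr_ge0 ?sqr_ge0.
apply/integrableP; split.
  apply/measurable_EFinP; apply: measurable_funM; last exact: measurable_indic.
  by apply: continuous_measurable_fun; exact: continuous_oneDsqrV.
rewrite (_ : (fun xi => _) = (fun xi => ((oneDsqr xi)^-1)%:E) \_ `[0, +oo[); last first.
  apply/funext => xi; rewrite /= /invoneDsq patchE indicE.
  by case: (_ \in _); rewrite ?mulr1 ?mulr0 ?normr0// ger0_norm.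
by rewrite -integral_mkcond integral0y_oneDsqr ltry.
Qed.

End cauchy_kernel.

(** * From the Cauchy kernel to indicators of intervals *)

Section cauchy_limit.
Variable R : realType.

Lemma atan_scale_cvg (y : R) : (fun n => atan (y * n.+1%:R)) @ \oo --> pi / 2 * Num.sg y.
Proof.
have pos (z : R) : 0 < z -> (fun n => atan (z * n.+1%:R)) @ \oo --> pi / 2.
  move=> z0; have zy : (fun n => z * n.+1%:R) @ \oo --> +oo.
    apply/cvgryPge => A; exists (Num.truncn (A / z)) => // n /= An.
    rewrite mulrC -ler_pdivrMr// (le_trans (ltW (truncnS_gt _)))//.
    by rewrite ler_nat ltnS.
  exact: (cvg_comp _ _ zy (@cvgy_atan R)).
case: (ltrgtP y 0) => [y0|y0|->].
- rewrite ltr0_sg// mulrN1.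
  have yN : 0 < - y by rewrite oppr_gt0.
  rewrite (_ : (fun n => _) = (fun n => - atan (- y * n.+1%:R))).
    exact: cvgN (pos _ yN).
  by apply/funext => n; rewrite mulNr atanN opprK.
- by rewrite gtr0_sg// mulr1; exact: pos.
- by rewrite sgr0 mulr0; under eq_fun do rewrite mul0r atan0; exact: cvg_cst.
Qed.

(* The indicator of [a, b] with the value 1/2 at the endpoints. *)
Definition box (a b x : R) : R := (Num.sg (b - x) - Num.sg (a - x)) / 2.

Lemma atan_box_cvg (a b x : R) :
  (fun n => atan ((b - x) * n.+1%:R) - atan ((a - x) * n.+1%:R)) @ \oo -->
  pi * box a b x.
Proof.
have := cvgB (@atan_scale_cvg (b - x)) (@atan_scale_cvg (a - x)).
by rewrite -mulrBr mulrAC -mulrA; apply.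
Qed.

Lemma box01 (a b x : R) : a <= b -> 0 <= box a b x <= 1.
Proof.
move=> ab; rewrite /box.
case: (ltrgtP (b - x) 0) => [y0|y0|y0]; rewrite ?(ltr0_sg y0) ?(gtr0_sg y0) ?y0 ?sgr0;
case: (ltrgtP (a - x) 0) => [z0|z0|z0]; rewrite ?(ltr0_sg z0) ?(gtr0_sg z0) ?z0 ?sgr0; lra.
Qed.

(** Moving both endpoints to the right removes the values 1/2: a point at a is eventually outside
    and a point at b eventually inside. No knowledge about atoms at the endpoints is needed. *)
Lemma box_shift_cvg (a b x : R) : a < b ->
  (fun n => box (a + n.+1%:R^-1) (b + n.+1%:R^-1) x) @ \oo --> (\1_(`]a, b]) x : R).
Proof.
move=> ab; apply/cvgrPdist_le => e e0.
suff : \forall n \near \oo, box (a + n.+1%:R^-1) (b + n.+1%:R^-1) x = \1_(`]a, b]) x.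
  by apply: filterS => n ->; rewrite subrr normr0 ltW.
have inv0 n : 0 < n.+1%:R^-1 :> R by rewrite invr_gt0.
have small (c : R) : 0 < c -> \forall n \near \oo, n.+1%:R^-1 < c.
  move=> c0; have /cvgrPdist_lt/(_ _ c0) := @cvg_harmonic R.
  by apply: filterS => n; rewrite sub0r normrN /harmonic/= gtr0_norm.
have boxE n : box (a + n.+1%:R^-1) (b + n.+1%:R^-1) x =
    (Num.sg (b - x + n.+1%:R^-1) - Num.sg (a - x + n.+1%:R^-1)) / 2.
  by rewrite /box; congr ((Num.sg _ - Num.sg _) / 2); ring.
case: (leP x a) => xa.
  apply: nearW => n; rewrite boxE; move: (n.+1%:R^-1) (inv0 n) => z z0.
  rewrite gtr0_sg; last by lra.
  rewrite gtr0_sg; last by lra.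
  by rewrite subrr mul0r indicE memNset//= in_itv/= ltNge xa.
case: (leP x b) => xb.
  have ax : 0 < x - a by rewrite subr_gt0.
  apply: filterS (small _ ax) => n; rewrite boxE; move: (n.+1%:R^-1) (inv0 n) => z z0 nax.
  rewrite gtr0_sg; last by lra.
  rewrite ltr0_sg; last by lra.
  rewrite indicE mem_set/=; last by rewrite in_itv/= xa.
  by rewrite opprK -mulr2n divff.
have bx : 0 < x - b by rewrite subr_gt0.
apply: filterS (small _ bx) => n; rewrite boxE; move: (n.+1%:R^-1) (inv0 n) => z z0 nbx.
rewrite ltr0_sg; last by lra.
rewrite ltr0_sg; last by lra.
by rewrite subrr mul0r indicE memNset//= in_itv/= xa leNgt xb.
Qed.

Lemma measurable_atan_box (a b : R) n :
  measurable_fun setT (fun x : R => atan ((b - x) * n%:R) - atan ((a - x) * n%:R)).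
Proof.
have matan (c : R) : measurable_fun setT (fun x : R => atan ((c - x) * n%:R)).
  apply: (measurableT_comp (continuous_measurable_fun (@continuous_atan R))).
  by apply: measurable_funM => //; exact: measurable_funB.
exact: measurable_funB.
Qed.

Lemma measurable_box (a b : R) : measurable_fun setT (box a b).
Proof.
have : measurable_fun setT (fun x : R => pi^-1 * (pi * box a b x)).
  apply: measurable_funM => //.
  apply: (@measurable_fun_cvg _ _ R setT
    (fun n (x : measurableTypeR R) => atan ((b - x) * n.+1%:R) - atan ((a - x) * n.+1%:R))).
    by move=> n; exact: measurable_atan_box.
  by move=> x _; exact: atan_box_cvg.
by under eq_fun do rewrite mulrA mulVf ?mul1r ?gt_eqF ?pi_gt0//.
Qed.

Lemma normr_atan_box_le (a b x : R) : `|atan b - atan a| <= pi.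
Proof.
have := atan_gtNpi2 a; have := atan_gtNpi2 b; have := atan_ltpi2 a; have := atan_ltpi2 b.
rewrite ler_norml; lra.
Qed.

End cauchy_limit.

(** * Laws determined by their values on half-open boxes *)

Section density_measure.
Context d (V : measurableType d) (R : realType) (mu : {measure set V -> \bar R}).
Variable f : V -> R.
Hypothesis f0 : forall u, 0 <= f u.
Hypothesis mf : measurable_fun setT f.

Definition mdensity (A : set V) := (\int[mu]_(u in A) (f u)%:E)%E.

Let mdensity0 : mdensity set0 = 0%E.
Proof. by rewrite /mdensity integral_set0. Qed.

Let mdensity_ge0 A : (0 <= mdensity A)%E.
Proof. by rewrite /mdensity integral_ge0//= => x _; rewrite lee_fin. Qed.

Let mdensity_sigma_additive : semi_sigma_additive mdensity.
Proof.
move=> /= F mF tF mUF; rewrite /mdensity; apply: cvg_toP.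
  apply: ereal_nondecreasing_is_cvgn => m n mn.
  apply: lee_sum_nneg_natr => // k _ _; apply: integral_ge0 => /= x Fkx.
  by rewrite lee_fin.
rewrite ge0_integral_bigcup//=.
- by apply/measurable_funTS/measurableT_comp => //.
- by move=> x _; rewrite lee_fin.
Qed.

HB.instance Definition _ := isMeasure.Build _ _ _
  mdensity mdensity0 mdensity_ge0 mdensity_sigma_additive.

(** The law and the measure with density f agree on a generating pi-system with a countable cover;
    finiteness on the cover comes from the total mass 1 of the law. *)
Lemma pushforward_density d' (T : measurableType d') (P : probability T R) (X : T -> V)
    (G : set (set V)) (g : (set V)^nat) : measurable_fun setT X ->
  measurable = <<s G >> -> setI_closed G -> (forall n, G (g n)) ->
  \bigcup_n g n = setT ->
  (forall A, G A -> P (X @^-1` A) = \int[mu]_(u in A) (f u)%:E)%E ->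
  forall A, measurable A -> (P (X @^-1` A) = \int[mu]_(u in A) (f u)%:E)%E.
Proof.
move=> measX mG GI Gg gT eqG A mA.
pose X' : {mfun T >-> V} := mfun_Sub (mem_set measX).
rewrite -[RHS]/(mdensity A) -[LHS]/(distribution P X' A).
rewrite (@measure_unique _ _ _ G g mG GI Gg gT (distribution P X')
  [the measure _ _ of mdensity])// => n.
have mgn : measurable (g n) by rewrite mG; exact: sub_sigma_algebra.
rewrite /distribution /pushforward (le_lt_trans (probability_le1 P _)) ?ltry//.
by rewrite -[X in measurable X]setTI; exact: (measX measurableT _ mgn).
Qed.

End density_measure.

Section ocitv_generator.
Variable R : realType.

Lemma ocitv_cover : \bigcup_n [set` `](- n%:R), n%:R]] = [set: R].
Proof.
apply/seteqP; split => // x _.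
exists (Num.truncn `|x|).+1 => //=; rewrite in_itv/=.
have := truncnS_gt `|x|; rewrite ltr_norml => /andP[-> /ltW].
by [].
Qed.

Definition ocbox : set (set (measurableTypeR R * measurableTypeR R)) :=
  [set A `*` B | A in @ocitv R & B in @ocitv R].

(** A cylinder over a half-open interval is a countable union of half-open rectangles, so both
    projections are measurable for the generated sigma-algebra. *)
Lemma measurable_ocbox :
  @measurable _ (measurableTypeR R * measurableTypeR R)%type = <<s ocbox >>.
Proof.
set S := <<s ocbox >>.
have sS : sigma_algebra setT S by exact: smallest_sigma_algebra.
have ocS A B : @ocitv R A -> @ocitv R B -> S (A `*` B).
  by move=> oA oB; apply: sub_sigma_algebra; exists A => //; exists B.
have mfst (A : set (measurableTypeR R)) : measurable A -> S (fst @^-1` A).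
  move=> mA; suff : image_set_system setT fst S A by rewrite /image_set_system/= setTI.
  move: A mA; apply: smallest_sub; first exact: sigma_algebra_image.
  move=> A oA; rewrite /image_set_system/= setTI.
  rewrite (_ : _ @^-1` _ = \bigcup_n (A `*` [set` `](- n%:R), n%:R]])).
    apply: sigma_algebra_bigcup => n; apply: ocS => //; exact: is_ocitv.
  rewrite -setX_bigcupr ocitv_cover; apply/seteqP; split => -[x y] //=.
  by case.
have msnd (A : set (measurableTypeR R)) : measurable A -> S (snd @^-1` A).
  move=> mA; suff : image_set_system setT snd S A by rewrite /image_set_system/= setTI.
  move: A mA; apply: smallest_sub; first exact: sigma_algebra_image.
  move=> A oA; rewrite /image_set_system/= setTI.
  rewrite (_ : _ @^-1` _ = \bigcup_n ([set` `](- n%:R), n%:R]] `*` A)).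
    apply: sigma_algebra_bigcup => n; apply: ocS => //; exact: is_ocitv.
  rewrite -setX_bigcupl ocitv_cover; apply/seteqP; split => -[x y] //=.
  by case.
apply/seteqP; split.
  rewrite measurable_prod_measurableType; apply: smallest_sub => // _ [A mA [B mB <-]].
  have -> : A `*` B = fst @^-1` A `&` snd @^-1` B by [].
  have := @measurableI _ (g_sigma_algebraType ocbox) (fst @^-1` A) (snd @^-1` B).
  by apply; [exact: mfst|exact: msnd].
apply: smallest_sub; first exact: sigma_algebra_measurable.
move=> _ [A oA [B oB <-]]; apply: measurableX; exact: sub_sigma_algebra.
Qed.

Lemma setI_closed_ocbox : setI_closed ocbox.
Proof.
move=> _ _ [A oA [B oB <-]] [A' oA' [B' oB' <-]]; rewrite -setXI.
by exists (A `&` A'); [exact: ocitvI|exists (B `&` B'); [exact: ocitvI|]].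
Qed.

End ocitv_generator.

Section limit_boxes.
Context d (T : measurableType d) (R : realType) (P : probability T R).
Context d2 (V : measurableType d2) (mu : {measure set V -> \bar R}).
Variables (N : V -> R) (c : R) (B : (set V)^nat) (Binf B' : set V).
Variables (g : nat -> T -> R) (ginf : T -> R).
Hypothesis N0 : forall u, 0 <= N u.
Hypothesis Nc : forall u, N u <= c.
Hypothesis mN : measurable_fun setT N.
Hypothesis mB : forall n, measurable (B n).
Hypothesis mB' : measurable B'.
Hypothesis B'oo : (mu B' < +oo)%E.
Hypothesis BB' : forall n, B n `<=` B'.
Hypothesis B_cvg : forall u, (fun n => \1_(B n) u : R) @ \oo --> (\1_Binf u : R).
Hypothesis mg : forall n, measurable_fun setT (g n).
Hypothesis g1 : forall n x, `|g n x| <= 1.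
Hypothesis g_cvg : forall x, g ^~ x @ \oo --> ginf x.
Hypothesis E : forall n,
  (\int[mu]_(u in B n) (N u)%:E = \int[P]_x (g n x)%:E)%E.

(** Passes from closed boxes, weighted by 1/2 at the ends, to half-open ones: [B n] and [g n] are
    the shifted versions, and [B'], of finite measure, contains every [B n] and provides the
    domination. *)
Lemma integral_limit_boxes :
  (\int[mu]_(u in Binf) (N u)%:E = \int[P]_x (ginf x)%:E)%E.
Proof.
have indE (A : set V) : (\int[mu]_(u in A) (N u)%:E = \int[mu]_u (N u * \1_A u)%:E)%E.
  rewrite integral_mkcond; apply: eq_integral => u _.
  by rewrite patchE indicE; case: (_ \in _); rewrite ?mulr1 ?mulr0.
have h1 : (fun n => \int[mu]_u (N u * \1_(B n) u)%:E)%E @ \oo -->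
    (\int[mu]_u (N u * \1_Binf u)%:E)%E.
  apply: (@dominated_cvg _ _ _ _ _ _ _ _ (fun u => (c * \1_B' u)%:E)) => //.
  - by move=> n; apply/measurable_EFinP; apply: measurable_funM => //; exact: measurable_indic.
  - move=> u _; apply: cvg_EFin; first exact: nearW.
    by apply: cvgM; [exact: cvg_cst|exact: B_cvg].
  - have : mu.-integrable B' (EFin \o cst c).
      by apply: measurable_bounded_integrable => //; exact: bounded_cst.
    move/(integrable_mkcond _ mB'); apply: eq_integrable => // u _.
    by rewrite patchE indicE; case: (_ \in _); rewrite ?mulr1 ?mulr0.
  - move=> n u _; rewrite lee_fin ger0_norm ?mulr_ge0//.
    have c0 : 0 <= c := le_trans (N0 u) (Nc u).
    rewrite !indicE; case: (boolP (u \in B n)) => uB; last by rewrite mulr0 mulr_ge0.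
    by rewrite mem_set ?mulr1//; apply: (@BB' n); rewrite inE in uB.
have h2 : (fun n => \int[P]_x (g n x)%:E)%E @ \oo --> (\int[P]_x (ginf x)%:E)%E.
  apply: (@dominated_cvg _ _ _ _ _ _ _ _ (cst 1%E)) => //.
  - by move=> n; exact/measurable_EFinP.
  - by move=> x _; apply: cvg_EFin; [exact: nearW|exact: g_cvg].
  - exact: finite_measure_integrable_cst.
  - by move=> n x _; rewrite lee_fin.
rewrite (indE Binf); apply: (cvg_unique _ h1) => //.
by move: h2; under eq_cvg do rewrite -E indE.
Qed.

End limit_boxes.

Section itv_shift.
Variable R : realType.

Lemma itv_shift_cvg (a b u : R) :
  (fun n => \1_(`[a + n.+1%:R^-1, b + n.+1%:R^-1]) u : R) @ \oo -->
  (\1_(`]a, b]) u : R).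
Proof.
apply/cvgrPdist_le => e e0.
suff : \forall n \near \oo,
    \1_(`[a + n.+1%:R^-1, b + n.+1%:R^-1]) u = \1_(`]a, b]) u :> R.
  by apply: filterS => n ->; rewrite subrr normr0 ltW.
have inv0 n : 0 < n.+1%:R^-1 :> R by rewrite invr_gt0.
have small (c : R) : 0 < c -> \forall n \near \oo, n.+1%:R^-1 < c.
  move=> c0; have /cvgrPdist_lt/(_ _ c0) := @cvg_harmonic R.
  by apply: filterS => n; rewrite sub0r normrN /harmonic/= gtr0_norm.
case: (leP u a) => ua.
  apply: nearW => n; move: (n.+1%:R^-1) (inv0 n) => z z0.
  rewrite !indicE !memNset//= in_itv/=; first by rewrite ltNge ua.
  by apply/negP; rewrite negb_and -ltNge; apply/orP; left; lra.
have ua0 : 0 < u - a by rewrite subr_gt0.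
case: (leP u b) => ub.
  apply: filterS (small _ ua0) => n; move: (n.+1%:R^-1) (inv0 n) => z z0 zu.
  by rewrite !indicE !mem_set//= in_itv/=; apply/andP; split; lra.
have ub0 : 0 < u - b by rewrite subr_gt0.
apply: filterS (small _ ub0) => n; move: (n.+1%:R^-1) (inv0 n) => z z0 zu.
rewrite !indicE !memNset//= in_itv/=; first by rewrite ua leNgt ub.
by apply/negP; rewrite negb_and -!ltNge; apply/orP; right; lra.
Qed.

Lemma cosB_mul (x y : R) : cos x - cos y = - 2 * sin ((x - y) / 2) * sin ((x + y) / 2).
Proof.
have -> : cos x - cos y = cos ((x + y) / 2 + (x - y) / 2) - cos ((x + y) / 2 - (x - y) / 2).
  by congr (cos _ - cos _); field.
by rewrite cosD cosB; ring.
Qed.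

End itv_shift.

(** * Inversion on the line *)

Section inversion1.
Context d (T : measurableType d) (R : realType) (P : probability T R).
Notation leb := (@lebesgue_measure R).
Variables (X : T -> R) (C : R).
Hypothesis mX : measurable_fun setT X.
Hypothesis XC : forall xi a,
  `|\int[P]_x cos (a - xi * X x)| <= C * ((1 + xi ^+ 2)^-1) ^+ 2.

Let h (xi u : R) (x : T) := cos (xi * (u - X x)).
Let K n u x := ckern n (u - X x).
Let Phi xi := C * @invoneDsq R xi.
Let einf : R -> R := \1_(`[0, +oo[).
Let N := inversion_density P leb h einf.

Let C0 : 0 <= C.
Proof.
by have := le_trans (normr_ge0 _) (XC 0 0); rewrite expr0n addr0 invr1 expr1n mulr1.
Qed.

Let s01 (xi : R) : 0 <= (1 + xi ^+ 2)^-1 <= 1.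
Proof.
rewrite invr_ge0 addr_ge0 ?sqr_ge0//= invf_le1 ?lerDl ?sqr_ge0//.
by rewrite ltr_pwDl ?sqr_ge0.
Qed.

Let ei0 xi : 0 <= einf xi.
Proof. by rewrite /einf indicE; case: (_ \in _). Qed.

Let mh u : measurable_fun setT (fun z : R * T => h z.1 u z.2).
Proof.
apply: (measurableT_comp (continuous_measurable_fun (@continuous_cos R))).
apply: measurable_funM => //; apply: measurable_funB => //.
exact: measurableT_comp.
Qed.

Let h1 xi u x : `|h xi u x| <= 1. Proof. exact: cos_max. Qed.

Let KE n u x : (\int[leb]_xi (damp n xi * h xi u x)%:E)%E = (K n u x)%:E.
Proof. exact: integral_damp_cos. Qed.

Let K0 n u x : 0 <= K n u x. Proof. exact: ckern_ge0. Qed.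

Let mK n : measurable_fun setT (fun z : R * T => K n z.1 z.2).
Proof.
apply: (measurableT_comp (continuous_measurable_fun (@continuous_ckern R n))).
apply: measurable_funB => //; exact: measurableT_comp.
Qed.

Let iPhi : leb.-integrable setT (EFin \o Phi).
Proof. exact: (integrableZl measurableT C (integrable_invoneDsq R)). Qed.

Let hPhi xi u : einf xi * `|\int[P]_x h xi u x| <= Phi xi.
Proof.
rewrite /Phi /invoneDsq mulrA [leRHS]mulrC ler_wpM2l//.
have -> : \int[P]_x h xi u x = \int[P]_x cos (xi * u - xi * X x).
  by apply: eq_Rintegral => x _; rewrite /h mulrBr.
have /andP[s0 s1] := s01 xi.
by rewrite (le_trans (XC _ _))// ler_wpM2l// expr2 ler_piMr.
Qed.

Let c := fine (\int[leb]_xi (Phi xi)%:E)%E.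

(** The difference of two cosines is a product of sines. One yields |xi| |u - v|, and |xi| (1 +
    xi^2)^-1 <= 1 spends the second power of decay. The other is a cosine of a shifted phase,
    covered by [XC] because the shift a there is arbitrary. *)
Let N_lip u v : `|N u - N v| <= `|u - v| * c.
Proof.
have H := @inversion_density_lip _ _ _ P _ _ leb _ _ h (@damp R) einf Phi mh h1 (@measurable_damp R)
  (@damp_ge0_le R) (@damp_cvg R) iPhi hPhi u v `|u - v|.
apply: H => xi.
rewrite /Phi /invoneDsq mulrA mulrA [leRHS]mulrC ler_wpM2l//.
have bh w : bmf (h xi w).
  apply: bmf_comp; first exact: bmf_cos.
  by apply: measurable_funM => //; exact: measurable_funB.
rewrite -bmfEB//.
have -> : \int[P]_x (h xi u x - h xi v x) =
    - 2 * sin (xi * (u - v) / 2) *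
    \int[P]_x cos (xi * (u + v) / 2 - pi / 2 - xi * X x).
  rewrite -bmfEZ; last first.
    by apply: bmf_comp; [exact: bmf_cos|apply: measurable_funB => //; exact: measurable_funM].
  apply: eq_Rintegral => x _; rewrite /h cosB_mul; congr (_ * sin _ * _).
    by field.
  have -> : xi * (u + v) / 2 - pi / 2 - xi * X x =
      (xi * (u + v) / 2 - xi * X x) - pi / 2 by ring.
  by rewrite cosBpihalf; congr sin; field.
have /andP[s0 s1] := s01 xi.
rewrite normrM [leLHS]mulrC.
apply: (@le_trans _ _ (C * (1 + xi ^+ 2)^-1 ^+ 2 * (`|xi| * `|u - v|))).
  apply: ler_pM; [exact: normr_ge0|exact: normr_ge0|exact: XC|].
  rewrite normrM normrN normr_nat.
  apply: (@le_trans _ _ (2 * `|xi * (u - v) / 2|)); first by rewrite ler_wpM2l// normr_sin_le.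
  by rewrite !normrM [`|2^-1|]ger0_norm// mulrC divfK.
have xs : `|xi| * (1 + xi ^+ 2)^-1 <= 1.
  rewrite ler_pdivrMr ?mul1r; last by rewrite ltr_pwDl ?sqr_ge0.
  by rewrite -[X in 1 + X]real_normK ?num_real//; have := normr_ge0 xi; nra.
have -> : C * (1 + xi ^+ 2)^-1 ^+ 2 * (`|xi| * `|u - v|) =
   `|u - v| * C * (1 + xi ^+ 2)^-1 * (`|xi| * (1 + xi ^+ 2)^-1) by ring.
by rewrite ler_piMr// mulr_ge0// mulr_ge0.
Qed.

Let N0 u : 0 <= N u.
Proof.
exact: (@inversion_density_ge0 _ _ _ P _ _ leb _ _ h (@damp R) einf K Phi mh h1
  (@measurable_damp R) (@damp_ge0_le R) (@integrable_damp R) (@damp_cvg R) KE K0 iPhi hPhi).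
Qed.

Let Nc u : N u <= c.
Proof.
exact: (@inversion_density_le _ _ _ P _ _ leb _ _ h (@damp R) einf K Phi mh h1
  (@measurable_damp R) (@damp_ge0_le R) (@integrable_damp R) (@damp_cvg R) KE iPhi hPhi).
Qed.

Let mN : measurable_fun setT N.
Proof.
exact: (@measurable_inversion_density _ _ _ P _ _ leb _ _ h (@damp R) einf K Phi mh h1
  (@measurable_damp R) (@damp_ge0_le R) (@integrable_damp R) (@damp_cvg R) KE K0 mK iPhi hPhi).
Qed.

(** Both sides are limits of the expected mass that the kernels centred at [X] put on [a, b], a
    difference of arctangents bounded by pi. *)
Let N_itv a b : a < b ->
  (\int[leb]_(u in `[a, b]) (N u)%:E = \int[P]_x (pi * box a b (X x))%:E)%E.
Proof.
move=> ab.
have l1 := @inversion_density_integral_cvg _ _ _ P _ _ leb _ _ leb h (@damp R) einf K Phi mh h1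
  (@measurable_damp R) (@damp_ge0_le R) (@integrable_damp R) (@damp_cvg R) KE K0 mK iPhi hPhi
  `[a, b]%classic.
have {}l1 := l1 (measurable_itv _).
have {}l1 : (\int[P]_x \int[leb]_(u in `[a, b]) (K n u x)%:E)%E @[n --> \oo] -->
    (\int[leb]_(u in `[a, b]) (N u)%:E)%E.
  by apply: l1; rewrite /= lebesgue_measure_itv/= lte_fin ab -EFinB ltry.
have h2 : (\int[P]_x (atan ((b - X x) * n.+1%:R) - atan ((a - X x) * n.+1%:R))%:E)%E
    @[n --> \oo] --> (\int[P]_x (pi * box a b (X x))%:E)%E.
  apply: (@dominated_cvg _ _ _ _ _ _ _ _ (cst pi%:E)) => //.
  - move=> n; apply/measurable_EFinP.
    by apply: (measurableT_comp (measurable_atan_box a b n.+1)).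
  - by move=> x _; apply: cvg_EFin; [exact: nearW|exact: atan_box_cvg].
  - exact: finite_measure_integrable_cst.
  - by move=> n x _; rewrite lee_fin normr_atan_box_le.
apply: (cvg_unique _ l1) => //; apply: cvg_trans h2; apply: near_eq_cvg; apply: nearW => n.
by apply: eq_integral => x _; rewrite integral_ckern.
Qed.

Lemma continuous_density1 : exists M : R -> R,
  [/\ continuous M, forall u, 0 <= M u &
    forall A : set R, measurable A ->
      P (X @^-1` A) = (\int[leb]_(u in A) (M u)%:E)%E].
Proof.
have pi0 : 0 < pi :> R by exact: pi_gt0.
pose M u := pi^-1 * N u.
have M0 u : 0 <= M u by rewrite mulr_ge0// invr_ge0 ltW.
have mM : measurable_fun setT M by exact: measurable_funM.
exists M; split => //.
  move=> u; apply: cvgM; first exact: cvg_cst.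
  apply/cvgrPdist_le => e e0; have c1 : 0 < `|c| + 1 by rewrite ltr_pwDr.
  near=> v; rewrite (le_trans (@N_lip _ _))//.
  apply: (@le_trans _ _ (`|u - v| * (`|c| + 1))).
    by rewrite ler_wpM2l// (le_trans (ler_norm _))// lerDl.
  rewrite -ler_pdivlMr// ltW//; near: v.
  by apply: cvgr_dist_lt => //; rewrite divr_gt0.
have Moc a b : a < b -> (\int[leb]_(u in `]a, b]) (M u)%:E = \int[P]_x (\1_(`]a, b]) (X x))%:E)%E.
  move=> ab.
  apply: (@integral_limit_boxes _ _ _ P _ _ leb M (pi^-1 * c)
    (fun n => [set` `[a + n.+1%:R^-1, b + n.+1%:R^-1]]) _ [set` `[a, b + 1]]
    (fun n x => box (a + n.+1%:R^-1) (b + n.+1%:R^-1) (X x))) => //.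
  - by move=> u; rewrite ler_wpM2l// invr_ge0 ltW.
  - rewrite /= lebesgue_measure_itv/=; case: ifP => _; by rewrite ?ltry// -EFinB ltry.
  - move=> n u /=; rewrite !in_itv/= => /andP[u1 u2].
    have n0 : 0 < (n.+1%:R^-1 : R) <= 1 by rewrite invr_gt0 ltr0n/= invf_le1// ler1n.
    move: (n.+1%:R^-1) n0 u1 u2 => z /andP[z0 z1] u1 u2; apply/andP; split; lra.
  - by move=> u; exact: itv_shift_cvg.
  - move=> n; exact: (measurableT_comp (measurable_box _ _)).
  - move=> n x; have : a + n.+1%:R^-1 <= b + n.+1%:R^-1 by rewrite lerD2r ltW.
    by move=> /(box01 (X x))/andP[b0 b1]; rewrite ger0_norm.
  - by move=> x; exact: box_shift_cvg.
  move=> n; under eq_integral do rewrite EFinM.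
  rewrite ge0_integralZl//.
  - rewrite N_itv ?ltrD2r// -ge0_integralZl//.
    + by apply: eq_integral => x _; rewrite -EFinM mulrA mulVf ?mul1r ?gt_eqF.
    + apply/measurable_EFinP; apply: measurable_funM => //.
      exact: (measurableT_comp (measurable_box _ _)).
    + move=> x _; have : a + n.+1%:R^-1 <= b + n.+1%:R^-1 by rewrite lerD2r ltW.
      by move=> /(box01 (X x))/andP[b0 _]; rewrite lee_fin mulr_ge0// ltW.
    + by rewrite lee_fin invr_ge0 ltW.
  - by apply/measurable_EFinP; exact: measurable_funTS.
  - by move=> x _; rewrite lee_fin.
  - by rewrite lee_fin invr_ge0 ltW.
move=> A mA.
have mXA B : measurable B -> measurable (X @^-1` B).
  by move=> mB; rewrite -[_ @^-1` _]setTI; exact: mX.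
apply: (@pushforward_density _ _ _ leb M M0 mM _ _ P X (@ocitv R)
  (fun n => [set` `](- n%:R), n%:R]])) => //.
- exact: ocitvI.
- by move=> n; exact: is_ocitv.
- exact: ocitv_cover.
- move=> _ [[a b] _ <-] /=.
  case: (ltP a b) => ab.
    rewrite Moc//; transitivity (\int[P]_x (\1_(X @^-1` [set` `]a, b]]) x)%:E)%E => //.
    by rewrite integral_indic ?setIT//; exact: mXA.
  have -> : [set` `]a, b]] = set0 :> set R by rewrite set_itv_ge// -leNgt.
  by rewrite preimage_set0 measure0 integral_set0.
Unshelve. all: by end_near. Qed.

End inversion1.

Section product_integral.
Variable R : realType.
Notation leb := (@lebesgue_measure R).

(* The sigma-finite structure of the product measure is not inferred by itself. *)
Definition lebesgue2 : set (measurableTypeR R * measurableTypeR R) -> \bar R :=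
  (leb \x leb)%E.
HB.instance Definition _ := Measure.on lebesgue2.

Lemma lebesgue2_prod (A B : set R) : measurable A -> measurable B ->
  (lebesgue2 (A `*` B) = leb A * leb B)%E.
Proof. move=> mA mB; exact: (@product_measure1E _ _ (measurableTypeR R) (measurableTypeR R) R leb leb A B mA mB). Qed.

Let lebesgue2_sigma_finite : sigma_finite setT lebesgue2.
Proof.
exists (fun n => [set` `](- n%:R), n%:R]] `*` [set` `](- n%:R), n%:R]]).
  apply/seteqP; split => // -[x y] _.
  exists (Num.truncn (Num.max `|x| `|y|)).+1 => //=; rewrite !in_itv/=.
  have := truncnS_gt (Num.max `|x| `|y|); rewrite gt_max => /andP[].
  by rewrite !ltr_norml => /andP[-> /ltW->] /andP[-> /ltW->].
move=> n; split; first exact: measurableX.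
rewrite lebesgue2_prod//.
have -> : leb [set` `](- n%:R), n%:R]] = (n%:R - - n%:R)%:E :> \bar R.
  rewrite lebesgue_measure_itv/= lte_fin; case: ltP => // nn.
  by have -> : n%:R = 0 :> R; [have := @ler0n R n; move: (n%:R) nn => z; lra|rewrite oppr0 subrr].
by rewrite -EFinM ltry.
Qed.

HB.instance Definition _ := Measure_isSigmaFinite.Build _ _ _ lebesgue2 lebesgue2_sigma_finite.

Variables f g : R -> R.
Hypothesis intf : leb.-integrable setT (EFin \o f).
Hypothesis intg : leb.-integrable setT (EFin \o g).

Let mfg : measurable_fun setT (fun z : measurableTypeR R * measurableTypeR R => (f z.1 * g z.2)%:E).
Proof.
have /measurable_int/measurable_EFinP mf := intf.
have /measurable_int/measurable_EFinP mg := intg.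
by apply/measurable_EFinP; apply: measurable_funM; exact: measurableT_comp.
Qed.

Lemma integrable_lebesgue2M :
  lebesgue2.-integrable setT (fun z => (f z.1 * g z.2)%:E).
Proof.
have intnf := integrable_norm intf.
have intng := integrable_norm intg.
apply/(@integrable12ltyP _ _ _ _ _ leb leb) => //=.
under eq_integral => x _.
  under eq_integral do rewrite normrM EFinM.
  rewrite (integralZl measurableT intng).
  over.
have fin := integrable_fin_num measurableT intng.
rewrite -(fineK fin) (integralZr measurableT intnf).
by rewrite ltey_eq fin_numM// (integrable_fin_num measurableT intnf).
Qed.

Lemma integral_lebesgue2M :
  (\int[lebesgue2]_z (f z.1 * g z.2)%:E =
   \int[leb]_x (f x)%:E * \int[leb]_y (g y)%:E)%E.
Proof.
rewrite -(@integral12_prod_meas1 _ _ _ _ _ leb leb (fun z => (f z.1 * g z.2)%:E));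
  last exact: integrable_lebesgue2M.
rewrite /fubini_F/=.
under eq_integral => x _.
  under eq_integral do rewrite EFinM.
  rewrite (integralZl measurableT intg).
  over.
have fin := integrable_fin_num measurableT intg.
by rewrite -(fineK fin) (integralZr measurableT intf).
Qed.

End product_integral.

(** * Inversion on the plane *)

Section inversion2.
Context d (T : measurableType d) (R : realType) (P : probability T R).
Notation leb := (@lebesgue_measure R).
Notation leb2 := (@lebesgue2 R).
Notation V2 := (measurableTypeR R * measurableTypeR R)%type.
Variables (X1 X2 : T -> R) (C : R).
Hypothesis mX1 : measurable_fun setT X1.
Hypothesis mX2 : measurable_fun setT X2.
Hypothesis XC : forall xi1 xi2 a,
  `|\int[P]_x cos (a - (xi1 * X1 x + xi2 * X2 x))| <=
  C * (((1 + xi1 ^+ 2)^-1) ^+ 2 * ((1 + xi2 ^+ 2)^-1) ^+ 2).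

Let h (xi u : V2) (x : T) := cos (xi.1 * (u.1 - X1 x)) * cos (xi.2 * (u.2 - X2 x)).
Let K n (u : V2) x := ckern n (u.1 - X1 x) * ckern n (u.2 - X2 x).
Let Phi (xi : V2) := C * (@invoneDsq R xi.1 * @invoneDsq R xi.2).
Let e n (xi : V2) : R := damp n xi.1 * damp n xi.2.
Let einf (xi : V2) : R := \1_(`[0, +oo[) xi.1 * \1_(`[0, +oo[) xi.2.
Let N := inversion_density P leb2 h einf.

Let C0 : 0 <= C.
Proof.
have := le_trans (normr_ge0 _) (XC 0 0 0).
by rewrite expr0n addr0 invr1 expr1n !mulr1.
Qed.

Let s01 (xi : R) : 0 <= (1 + xi ^+ 2)^-1 <= 1.
Proof.
rewrite invr_ge0 addr_ge0 ?sqr_ge0//= invf_le1 ?lerDl ?sqr_ge0//.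
by rewrite ltr_pwDl ?sqr_ge0.
Qed.

Let ind0 (xi : R) : 0 <= (\1_(`[0, +oo[) xi : R).
Proof. by rewrite indicE; case: (_ \in _). Qed.

Let ei0 xi : 0 <= einf xi.
Proof. by rewrite mulr_ge0. Qed.

Let mcosZ (f : V2 * T -> R) : measurable_fun setT f -> measurable_fun setT (fun z => cos (f z)).
Proof. exact: (measurableT_comp (continuous_measurable_fun (@continuous_cos R))). Qed.

Let mh (u : V2) : measurable_fun setT (fun z : V2 * T => h z.1 u z.2).
Proof.
apply: measurable_funM; apply: mcosZ; apply: measurable_funM => //=.
- exact: (measurableT_comp measurable_fst measurable_fst).
- by apply: measurable_funB => //; exact: measurableT_comp.
- exact: (measurableT_comp measurable_snd measurable_fst).
- by apply: measurable_funB => //; exact: measurableT_comp.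
Qed.

Let h1 xi u x : `|h xi u x| <= 1.
Proof. by rewrite normrM mulr_ile1// cos_max. Qed.

Let me n : measurable_fun setT (e n).
Proof. by apply: measurable_funM; apply: measurableT_comp => //; exact: measurable_damp. Qed.

Let e01 n xi : 0 <= e n xi <= einf xi.
Proof.
have /andP[a0 a1] := damp_ge0_le n xi.1; have /andP[b0 b1] := damp_ge0_le n xi.2.
by rewrite mulr_ge0//= ler_pM.
Qed.

Let ie n : leb2.-integrable setT (EFin \o e n).
Proof. exact: (integrable_lebesgue2M (integrable_damp R n) (integrable_damp R n)). Qed.

Let e_cvg xi : e ^~ xi @ \oo --> einf xi.
Proof. by apply: cvgM; exact: damp_cvg. Qed.

Let KE n u x : (\int[leb2]_xi (e n xi * h xi u x)%:E)%E = (K n u x)%:E.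
Proof.
have idc y : leb.-integrable setT (EFin \o (fun xi => damp n xi * cos (xi * y))).
  apply: (@le_integrable _ _ _ leb _ measurableT _ (EFin \o damp n)) => //.
    apply/measurable_EFinP; apply: measurable_funM; first exact: measurable_damp.
    exact: measurable_cosZ.
  - by move=> xi _; rewrite /= lee_fin normrM ler_piMr// cos_max.
  - exact: integrable_damp.
have := integral_lebesgue2M (idc (u.1 - X1 x)) (idc (u.2 - X2 x)).
rewrite !integral_damp_cos -EFinM => <-.
by apply: eq_integral => xi _; congr EFin; rewrite /e /h; ring.
Qed.

Let K0 n u x : 0 <= K n u x. Proof. by rewrite mulr_ge0// ckern_ge0. Qed.

Let mK n : measurable_fun setT (fun z : V2 * T => K n z.1 z.2).
Proof.
apply: measurable_funM;
  apply: (measurableT_comp (continuous_measurable_fun (@continuous_ckern R n)));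
  apply: measurable_funB => //=; exact: measurableT_comp.
Qed.

Let iPhi : leb2.-integrable setT (EFin \o Phi).
Proof.
exact: (integrableZl measurableT C
  (integrable_lebesgue2M (integrable_invoneDsq R) (integrable_invoneDsq R))).
Qed.

Let bX xi1 xi2 a : bmf (fun x => cos (a - (xi1 * X1 x + xi2 * X2 x))).
Proof.
apply: bmf_comp; first exact: bmf_cos.
by apply: measurable_funB => //; apply: measurable_funD; exact: measurable_funM.
Qed.

(** The product of cosines splits into cosines of the linear forms with frequencies (xi1, xi2) and
    (xi1, - xi2); the bound [XC] depends on squares only and covers both. *)
Let Eh xi u : \int[P]_x h xi u x =
  2^-1 * \int[P]_x cos (xi.1 * u.1 + xi.2 * u.2 - (xi.1 * X1 x + xi.2 * X2 x)) +
  2^-1 * \int[P]_x cos (xi.1 * u.1 - xi.2 * u.2 - (xi.1 * X1 x + (- xi.2) * X2 x)).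
Proof.
rewrite -!bmfEZ// -bmfED//; [|by apply: bmfM => //; exact: bmf_cst..].
apply: eq_Rintegral => x _; rewrite /h.
have -> : xi.1 * u.1 + xi.2 * u.2 - (xi.1 * X1 x + xi.2 * X2 x) =
  xi.1 * (u.1 - X1 x) + xi.2 * (u.2 - X2 x) by ring.
have -> : xi.1 * u.1 - xi.2 * u.2 - (xi.1 * X1 x + - xi.2 * X2 x) =
  xi.1 * (u.1 - X1 x) - xi.2 * (u.2 - X2 x) by ring.
by rewrite cosD cosB; field.
Qed.

Let hPhi xi u : einf xi * `|\int[P]_x h xi u x| <= Phi xi.
Proof.
have /andP[s0 s1] := s01 xi.1; have /andP[r0 r1] := s01 xi.2.
have -> : Phi xi = einf xi * (C * ((1 + xi.1 ^+ 2)^-1 * (1 + xi.2 ^+ 2)^-1)).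
  by rewrite /Phi /einf /invoneDsq; ring.
rewrite ler_wpM2l// Eh.
apply: (@le_trans _ _ (C * (((1 + xi.1 ^+ 2)^-1) ^+ 2 * ((1 + xi.2 ^+ 2)^-1) ^+ 2))).
  have h2 := XC xi.1 xi.2 (xi.1 * u.1 + xi.2 * u.2).
  have := XC xi.1 (- xi.2) (xi.1 * u.1 - xi.2 * u.2); rewrite sqrrN => h3.
  rewrite (le_trans (ler_normD _ _))// !normrM [`|2^-1|]ger0_norm//.
  move: (C * _) h2 h3 => c h2 h3; lra.
rewrite ler_wpM2l// ler_pM ?sqr_ge0// expr2 ler_piMr//.
Qed.

Let c := fine (\int[leb2]_xi (Phi xi)%:E)%E.

Let Elip xi1 xi2 a b :
  `|\int[P]_x cos (a - (xi1 * X1 x + xi2 * X2 x)) -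
    \int[P]_x cos (b - (xi1 * X1 x + xi2 * X2 x))| <=
  `|a - b| * (C * (((1 + xi1 ^+ 2)^-1) ^+ 2 * ((1 + xi2 ^+ 2)^-1) ^+ 2)).
Proof.
rewrite -bmfEB//.
have -> : \int[P]_x (cos (a - (xi1 * X1 x + xi2 * X2 x)) - cos (b - (xi1 * X1 x + xi2 * X2 x))) =
    - 2 * sin ((a - b) / 2) *
    \int[P]_x cos ((a + b) / 2 - pi / 2 - (xi1 * X1 x + xi2 * X2 x)).
  rewrite -bmfEZ//; apply: eq_Rintegral => x _; rewrite cosB_mul.
  congr (_ * sin _ * _); first by field.
  have -> : (a + b) / 2 - pi / 2 - (xi1 * X1 x + xi2 * X2 x) =
      ((a + b) / 2 - (xi1 * X1 x + xi2 * X2 x)) - pi / 2 by ring.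
  by rewrite cosBpihalf; congr sin; field.
rewrite normrM; apply: ler_pM; [exact: normr_ge0|exact: normr_ge0| |exact: XC].
rewrite normrM normrN normr_nat.
apply: (@le_trans _ _ (2 * `|(a - b) / 2|)); first by rewrite ler_wpM2l// normr_sin_le.
by rewrite normrM [`|2^-1|]ger0_norm// mulrC divfK.
Qed.

Let N_lip u v : `|N u - N v| <= (`|u.1 - v.1| + `|u.2 - v.2|) * c.
Proof.
have H := @inversion_density_lip _ _ _ P _ _ leb2 _ _ h e einf Phi mh h1 me e01 e_cvg iPhi hPhi
  u v (`|u.1 - v.1| + `|u.2 - v.2|).
apply: H => xi.
have /andP[s0 s1] := s01 xi.1; have /andP[r0 r1] := s01 xi.2.
set D := `|u.1 - v.1| + `|u.2 - v.2|.
have -> : D * Phi xi = einf xi * (D * (C * ((1 + xi.1 ^+ 2)^-1 * (1 + xi.2 ^+ 2)^-1))).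
  by rewrite /Phi /einf /invoneDsq; ring.
rewrite ler_wpM2l// !Eh.
set s := (1 + xi.1 ^+ 2)^-1 in s0 s1 *; set r := (1 + xi.2 ^+ 2)^-1 in r0 r1 *.
set E1 := \int[P]_x _; set E2 := \int[P]_x _; set E3 := \int[P]_x _; set E4 := \int[P]_x _.
have le1 : `|E1 - E3| <= (`|xi.1| * `|u.1 - v.1| + `|xi.2| * `|u.2 - v.2|) * (C * (s ^+ 2 * r ^+ 2)).
  rewrite (le_trans (Elip _ _ _ _))// ler_wpM2r//.
    by rewrite mulr_ge0// mulr_ge0 ?sqr_ge0.
  have -> : xi.1 * u.1 + xi.2 * u.2 - (xi.1 * v.1 + xi.2 * v.2) =
    xi.1 * (u.1 - v.1) + xi.2 * (u.2 - v.2) by ring.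
  by rewrite (le_trans (ler_normD _ _))// !normrM.
have le2 : `|E2 - E4| <= (`|xi.1| * `|u.1 - v.1| + `|xi.2| * `|u.2 - v.2|) * (C * (s ^+ 2 * r ^+ 2)).
  rewrite (le_trans (Elip _ _ _ _))//; rewrite sqrrN ler_wpM2r//.
    by rewrite mulr_ge0// mulr_ge0 ?sqr_ge0.
  have -> : xi.1 * u.1 - xi.2 * u.2 - (xi.1 * v.1 - xi.2 * v.2) =
    xi.1 * (u.1 - v.1) - xi.2 * (u.2 - v.2) by ring.
  by rewrite (le_trans (ler_normB _ _))// !normrM.
have absle (x : R) : `|x| * (1 + x ^+ 2)^-1 <= 1.
  rewrite ler_pdivrMr ?mul1r; last by rewrite ltr_pwDl ?sqr_ge0.
  by rewrite -[X in 1 + X]real_normK ?num_real//; have := normr_ge0 x; nra.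
have xs : `|xi.1| * s <= 1 by exact: absle.
have xr : `|xi.2| * r <= 1 by exact: absle.
have -> : 2^-1 * E1 + 2^-1 * E2 - (2^-1 * E3 + 2^-1 * E4) = 2^-1 * ((E1 - E3) + (E2 - E4)) by ring.
rewrite normrM [`|2^-1|]ger0_norm//.
apply: (@le_trans _ _ ((`|xi.1| * `|u.1 - v.1| + `|xi.2| * `|u.2 - v.2|) * (C * (s ^+ 2 * r ^+ 2)))).
  have := ler_normD (E1 - E3) (E2 - E4); move: le1 le2; set w := (_ * (C * _)).
  by move: `|E1 - E3| `|E2 - E4| => x y; lra.
(* Each |xi_i| is absorbed by one of the two factors (1 + xi_i^2)^-1; the remaining ones form the
   majorant. *)
have -> : (`|xi.1| * `|u.1 - v.1| + `|xi.2| * `|u.2 - v.2|) * (C * (s ^+ 2 * r ^+ 2)) =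
  ((`|xi.1| * s * r) * `|u.1 - v.1| + (`|xi.2| * r * s) * `|u.2 - v.2|) * (C * (s * r)) by ring.
rewrite ler_wpM2r//; first by rewrite mulr_ge0// mulr_ge0.
by rewrite /D lerD// ler_piMl// mulr_ile1// mulr_ge0.
Qed.

Let N0 u : 0 <= N u.
Proof.
exact: (@inversion_density_ge0 _ _ _ P _ _ leb2 _ _ h e einf K Phi mh h1
  me e01 ie e_cvg KE K0 iPhi hPhi).
Qed.

Let Nc u : N u <= c.
Proof.
exact: (@inversion_density_le _ _ _ P _ _ leb2 _ _ h e einf K Phi mh h1
  me e01 ie e_cvg KE iPhi hPhi).
Qed.

Let mN : measurable_fun setT N.
Proof.
exact: (@measurable_inversion_density _ _ _ P _ _ leb2 _ _ h e einf K Phi mh h1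
  me e01 ie e_cvg KE K0 mK iPhi hPhi).
Qed.

Let ckern_itv n (x a b : R) : a < b ->
  leb.-integrable setT (EFin \o (fun u => ckern n (u - x) * \1_(`[a, b]) u)) /\
  (\int[leb]_u (ckern n (u - x) * \1_(`[a, b]) u)%:E =
   (atan ((b - x) * n.+1%:R) - atan ((a - x) * n.+1%:R))%:E)%E.
Proof.
move=> ab.
have E : (\int[leb]_u (ckern n (u - x) * \1_(`[a, b]) u)%:E =
   (atan ((b - x) * n.+1%:R) - atan ((a - x) * n.+1%:R))%:E)%E.
  rewrite -integral_ckern// [RHS]integral_mkcond; apply: eq_integral => u _.
  by rewrite patchE indicE; case: (_ \in _); rewrite ?mulr1 ?mulr0.
have f0 u : 0 <= ckern n (u - x) * \1_(`[a, b]) u.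
  by rewrite mulr_ge0 ?ckern_ge0// indicE; case: (_ \in _).
split=> //; apply/integrableP; split.
  apply/measurable_EFinP; apply: measurable_funM; last exact: measurable_indic.
  apply: (measurableT_comp (continuous_measurable_fun (@continuous_ckern R n))).
  exact: measurable_funB.
under eq_integral do rewrite /= ger0_norm//.
by rewrite E ltry.
Qed.

Let indicX (A B : set R) (z : V2) : \1_(A `*` B) z = \1_A z.1 * \1_B z.2 :> R.
Proof. by rewrite !indicE in_setX -natrM mulnb. Qed.

Let N_box a b a' b' : a < b -> a' < b' ->
  (\int[leb2]_(u in `[a, b] `*` `[a', b']) (N u)%:E =
   \int[P]_x ((pi * box a b (X1 x)) * (pi * box a' b' (X2 x)))%:E)%E.
Proof.
move=> ab ab'.
have mB : measurable (`[a, b] `*` `[a', b'] : set V2) by exact: measurableX.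
have l1 : (\int[P]_x \int[leb2]_(u in `[a, b] `*` `[a', b']) (K n u x)%:E)%E @[n --> \oo] -->
    (\int[leb2]_(u in `[a, b] `*` `[a', b']) (N u)%:E)%E.
  apply: (@inversion_density_integral_cvg _ _ _ P _ _ leb2 _ _ leb2 h e einf K Phi mh h1
    me e01 ie e_cvg KE K0 mK iPhi hPhi _ mB).
  rewrite [X in (X < _)%E](@lebesgue2_prod R `[a, b] `[a', b'])// !lebesgue_measure_itv/= !lte_fin ab ab' -!EFinB -EFinM.
  exact: ltry.
have h2 : (\int[P]_x ((atan ((b - X1 x) * n.+1%:R) - atan ((a - X1 x) * n.+1%:R)) *
      (atan ((b' - X2 x) * n.+1%:R) - atan ((a' - X2 x) * n.+1%:R)))%:E)%E
    @[n --> \oo] --> (\int[P]_x ((pi * box a b (X1 x)) * (pi * box a' b' (X2 x)))%:E)%E.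
  apply: (@dominated_cvg _ _ _ _ _ _ _ _ (cst (pi * pi)%:E)) => //.
  - move=> n; apply/measurable_EFinP; apply: measurable_funM.
      by apply: (measurableT_comp (measurable_atan_box a b n.+1)).
    by apply: (measurableT_comp (measurable_atan_box a' b' n.+1)).
  - move=> x _; apply: cvg_EFin; first exact: nearW.
    by apply: cvgM; exact: atan_box_cvg.
  - exact: finite_measure_integrable_cst.
  - by move=> n x _; rewrite lee_fin normrM ler_pM ?normr_atan_box_le.
apply: (cvg_unique _ l1) => //; apply: cvg_trans h2; apply: near_eq_cvg; apply: nearW => n.
apply: eq_integral => x _; rewrite integral_mkcond.
have [i1 e1] := ckern_itv n (X1 x) ab; have [i2 e2] := ckern_itv n (X2 x) ab'.
rewrite EFinM -e1 -e2 -integral_lebesgue2M//; apply: eq_integral => u _.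
rewrite patchE /K; have := indicX `[a, b] `[a', b'] u; rewrite indicE.
by case: (_ \in _) => /= H; rewrite mulrACA -H ?mulr1 ?mulr0.
Qed.

(** The explicit Lipschitz estimate replaces continuity because it transfers directly from pairs of
    reals to the topology of the complex modulus. *)
Lemma lipschitz_density2 : exists M : V2 -> R,
  [/\ measurable_fun setT M,
    exists L, forall u v, `|M u - M v| <= L * (`|u.1 - v.1| + `|u.2 - v.2|),
    forall u, 0 <= M u &
    forall A : set V2, measurable A ->
      (P [set x | A (X1 x, X2 x)] = \int[leb2]_(u in A) (M u)%:E)%E].
Proof.
have pi0 : 0 < pi :> R by exact: pi_gt0.
pose M u := (pi^-1 * pi^-1) * N u.
have p0 : 0 <= pi^-1 * pi^-1 :> R by rewrite mulr_ge0// invr_ge0 ltW.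
have M0 u : 0 <= M u by rewrite mulr_ge0.
have mM : measurable_fun setT M by exact: measurable_funM.
exists M; split => //.
  exists (pi^-1 * pi^-1 * c) => u v; rewrite -mulrBr normrM ger0_norm//.
  by have := ler_wpM2l p0 (N_lip u v); rewrite [(_ + _) * c]mulrC mulrA.
have Moc a b a' b' : a < b -> a' < b' -> (\int[leb2]_(u in `]a, b] `*` `]a', b']) (M u)%:E =
    \int[P]_x (\1_(`]a, b]) (X1 x) * \1_(`]a', b']) (X2 x))%:E)%E.
  move=> ab ab'.
  have shift n (r s : R) : r < s -> r + n.+1%:R^-1 <= s + n.+1%:R^-1 by move=> ?; rewrite lerD2r ltW.
  have sub n (r s : R) : [set` `[r + n.+1%:R^-1, s + n.+1%:R^-1]] `<=` [set` `[r, s + 1]].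
    move=> u /=; rewrite !in_itv/= => /andP[u1 u2].
    have n0 : 0 < (n.+1%:R^-1 : R) <= 1 by rewrite invr_gt0 ltr0n/= invf_le1// ler1n.
    move: (n.+1%:R^-1) n0 u1 u2 => z /andP[z0 z1] u1 u2; apply/andP; split; lra.
  have litv (r s : R) : (leb `[r, s] < +oo)%E.
    by rewrite lebesgue_measure_itv/=; case: ifP => _; rewrite ?ltry// -EFinB ltry.
  apply: (@integral_limit_boxes _ _ _ P _ _ leb2 M (pi^-1 * pi^-1 * c)
    (fun n => [set` `[a + n.+1%:R^-1, b + n.+1%:R^-1]] `*` [set` `[a' + n.+1%:R^-1, b' + n.+1%:R^-1]]) _
    ([set` `[a, b + 1]] `*` [set` `[a', b' + 1]])
    (fun n x => box (a + n.+1%:R^-1) (b + n.+1%:R^-1) (X1 x) *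
                box (a' + n.+1%:R^-1) (b' + n.+1%:R^-1) (X2 x))) => //.
  - by move=> u; rewrite ler_wpM2l.
  - by move=> n; exact: measurableX.
  - by apply: (@measurableX _ _ (measurableTypeR R) (measurableTypeR R)).
  - rewrite [X in (X < _)%E](@lebesgue2_prod R [set` `[a, b + 1]] [set` `[a', b' + 1]])//.
    by rewrite lte_mul_pinfty// ?ge0_fin_numE// ?litv.
  - by move=> n [u v] [/= /sub uu /sub vv].
  - move=> u; rewrite indicX; under eq_cvg do rewrite indicX.
    by apply: cvgM; exact: itv_shift_cvg.
  - by move=> n; apply: measurable_funM; exact: (measurableT_comp (measurable_box _ _)).
  - move=> n x; rewrite normrM.
    have /andP[? ?] := box01 (X1 x) (shift n _ _ ab).
    have /andP[? ?] := box01 (X2 x) (shift n _ _ ab').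
    by rewrite !ger0_norm// mulr_ile1.
  - by move=> x; apply: cvgM; exact: box_shift_cvg.
  move=> n; under eq_integral do rewrite EFinM.
  have mB : measurable ([set` `[a + n.+1%:R^-1, b + n.+1%:R^-1]] `*`
      [set` `[a' + n.+1%:R^-1, b' + n.+1%:R^-1]] : set V2) by exact: measurableX.
  rewrite ge0_integralZl//.
  - rewrite N_box ?ltrD2r// -ge0_integralZl//.
    + apply: eq_integral => x _; rewrite -EFinM; congr EFin.
      move: (box _ _ _) (box _ _ _) (@pi R) pi0 => r s q q0; field.
      by rewrite gt_eqF.
    + apply/measurable_EFinP; apply: measurable_funM; apply: measurable_funM => //;
      exact: (measurableT_comp (measurable_box _ _)).
    + move=> x _; have /andP[? _] := box01 (X1 x) (shift n _ _ ab).
      have /andP[? _] := box01 (X2 x) (shift n _ _ ab').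
      by rewrite lee_fin; apply: mulr_ge0; rewrite mulr_ge0// ltW.
  - by apply/measurable_EFinP; exact: measurable_funTS.
  - by move=> x _; rewrite lee_fin.
move=> A mA.
have mX : measurable_fun setT (fun x => (X1 x, X2 x) : V2) by exact/measurable_fun_pairP.
have mXA B : measurable B -> measurable ((fun x => (X1 x, X2 x) : V2) @^-1` B).
  by move=> mB; rewrite -[_ @^-1` _]setTI; exact: mX.
apply: (@pushforward_density _ _ _ leb2 M M0 mM _ _ P (fun x => (X1 x, X2 x)) (@ocbox R)
  (fun n => [set` `](- n%:R), n%:R]] `*` [set` `](- n%:R), n%:R]])) => //.
- exact: measurable_ocbox.
- exact: setI_closed_ocbox.
- move=> n; exists [set` `](- n%:R), n%:R]]; first exact: is_ocitv.
  by exists [set` `](- n%:R), n%:R]]; first exact: is_ocitv.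
- apply/seteqP; split => // -[x y] _.
  exists (Num.truncn (Num.max `|x| `|y|)).+1 => //=; rewrite !in_itv/=.
  have := truncnS_gt (Num.max `|x| `|y|); rewrite gt_max => /andP[].
  by rewrite !ltr_norml => /andP[-> /ltW->] /andP[-> /ltW->].
- move=> _ [_ [[a b] _ <-] [_ [[a' b'] _ <-] <-]] /=.
  case: (ltP a b) => ab; last first.
    have -> : [set` `]a, b]] = set0 :> set R by rewrite set_itv_ge// -leNgt.
    by rewrite set0X preimage_set0 measure0 integral_set0.
  case: (ltP a' b') => ab'; last first.
    have -> : [set` `]a', b']] = set0 :> set R by rewrite set_itv_ge// -leNgt.
    by rewrite setX0 preimage_set0 measure0 integral_set0.
  rewrite Moc//; transitivity (\int[P]_x (\1_((fun x => (X1 x, X2 x) : V2) @^-1`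
      ([set` `]a, b]] `*` [set` `]a', b']])) x)%:E)%E.
    by rewrite integral_indic ?setIT//; apply: mXA; exact: measurableX.
  apply: eq_integral => x _; congr EFin.
  by rewrite -[RHS](indicX _ _ (X1 x, X2 x)).
Qed.

End inversion2.

(** * The random Euler product *)

Section prime_factors.
Variables (R : realType) (sigma t : R).
Hypothesis sigma2 : 2^-1 < sigma.

(** The value 0 off the primes keeps the whole family measurable and bounded; at p = 1 the ratio q
    would be 1. *)
Definition prime_elog (beta : R) (p : nat) (y : R) : R :=
  if prime p then elog (p%:R `^ (- sigma)) (t * ln p%:R) beta y else 0.

Lemma sqr_powR (x a : R) : (x `^ a) ^+ 2 = x `^ (a * 2).
Proof. by rewrite powRrM -powR_mulrn ?powR_ge0. Qed.

Lemma ler_prime_powR p (a b : R) : prime p -> a <= b -> p%:R `^ a <= p%:R `^ b.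
Proof. by move=> /prime_gt1 p1 ab; rewrite ler_powR// ler1n ltnW. Qed.

Lemma prime_powR_le34 p : prime p -> 0 <= (p%:R `^ (- sigma) : R) <= 3 / 4.
Proof.
move=> pp; rewrite powR_ge0/=.
apply: (le_trans (ler_prime_powR pp (_ : - sigma <= - 2^-1))).
  by rewrite lerN2 ltW.
rewrite -(@ler_pXn2r _ 2) ?nnegrE ?powR_ge0//.
rewrite sqr_powR mulNr mulVf// powR_inv1//.
apply: (@le_trans _ _ 2^-1); last by lra.
by rewrite lef_pV2 ?posrE ?ltr0n ?prime_gt0// ler_nat prime_gt1.
Qed.

Lemma measurable_prime_elog beta p : measurable_fun setT (prime_elog beta p).
Proof.
rewrite /prime_elog; case: (boolP (prime p)) => // pp; apply: measurable_elog.
by have /andP[-> q1] := prime_powR_le34 pp; rewrite (le_lt_trans q1)//; lra.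
Qed.

Lemma prime_elog_phase beta p y :
  prime_elog beta p y = cos beta * prime_elog 0 p y + sin beta * prime_elog (pi / 2) p y.
Proof.
rewrite /prime_elog; case: ifP => pp; last by rewrite !mulr0 addr0.
apply: elog_phase.
by have /andP[-> q1] := prime_powR_le34 pp; rewrite (le_lt_trans q1)//; lra.
Qed.

Lemma polar_coordinates (x y : R) : exists r alpha,
  [/\ 0 <= r, r ^+ 2 = x ^+ 2 + y ^+ 2, x = r * cos alpha & y = r * sin alpha].
Proof.
pose r := Num.sqrt (x ^+ 2 + y ^+ 2).
have s0 : 0 <= x ^+ 2 + y ^+ 2 by rewrite addr_ge0 ?sqr_ge0.
have r2 : r ^+ 2 = x ^+ 2 + y ^+ 2 by rewrite sqr_sqrtr.
have r0 : 0 <= r by exact: sqrtr_ge0.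
have [rz|rn0] := eqVneq r 0.
  exists 0, 0; move: r2; rewrite rz expr0n/= => /esym/eqP.
  rewrite paddr_eq0 ?sqr_ge0// !sqrf_eq0 => /andP[/eqP-> /eqP->].
  by rewrite !mul0r expr0n/= addr0.
have rp : 0 < r by rewrite lt_def rn0.
have xr : -1 <= x / r <= 1.
  rewrite -ler_norml normrM normfV (gtr0_norm rp) ler_pdivrMr// mul1r.
  by rewrite -(@ler_pXn2r _ 2) ?nnegrE// real_normK ?num_real// r2 lerDl sqr_ge0.
have ck : cos (acos (x / r)) = x / r by apply: acosK; rewrite in_itv.
have ys : (y / r) ^+ 2 = sin (acos (x / r)) ^+ 2.
  by rewrite sin2cos2 ck !expr_div_n r2; field; rewrite -r2 expf_neq0.
move/eqP: ys; rewrite eqf_sqr => /orP[] /eqP ys.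
  exists r, (acos (x / r)); split => //; first by rewrite ck mulrC divfK.
  by rewrite -ys mulrC divfK.
exists r, (- acos (x / r)); split => //; first by rewrite cosN ck mulrC divfK.
by rewrite sinN -ys mulrC divfK.
Qed.

End prime_factors.

(** * Decay of the characteristic function *)

Section characteristic_decay.
Context d (T : measurableType d) (R : realType) (P : probability T R).
Variables (X : nat -> T -> R) (sigma t delta : R).
Hypothesis mX : forall p, measurable_fun setT (X p).
Hypothesis indX : mutually_independent P prime X.
Hypothesis sigma2 : 2^-1 < sigma.
Hypothesis C1 : exists C : R, forall p, prime p ->
  `|\int[P]_x cos (X p x)| <= C * p%:R `^ (- 4^-1).
Hypothesis delta0 : 0 < delta.
Hypothesis C2 : forall p, prime p -> delta <= \int[P]_x (cos (X p x) ^+ 2).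

(** With a and b the two expectations, the mean of (cos f - a)^2 + (sin f - b)^2 is 1 - a^2 -
    b^2. *)
Lemma expectation_cos2_sin2_le1 (f : T -> R) : measurable_fun setT f ->
  (\int[P]_x cos (f x)) ^+ 2 + (\int[P]_x sin (f x)) ^+ 2 <= 1.
Proof.
move=> mf; have bc : bmf (fun x => cos (f x)) by exact: bmf_comp (bmf_cos R) mf.
have bs : bmf (fun x => sin (f x)) by exact: bmf_comp (bmf_sin R) mf.
set a := \int[P]_x cos (f x); set b := \int[P]_x sin (f x).
have H : 0 <= \int[P]_x (1 + (- 2 * a) * cos (f x) + (- 2 * b) * sin (f x) + (a ^+ 2 + b ^+ 2)).
  rewrite -(bmfE_cst P 0); apply: bmfE_le; first exact: bmf_cst.
    by do !apply: bmfD; do ?exact: bmf_cst; apply: bmfM => //; exact: bmf_cst.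
  move=> x; have := cos2Dsin2 (f x).
  have := sqr_ge0 (cos (f x) - a); have := sqr_ge0 (sin (f x) - b).
  by move: (cos (f x)) (sin (f x)) => u v; nra.
move: H; rewrite !bmfED ?bmfEZ ?bmfE_cst//; do ?[by do ?apply: bmfD; do ?apply: bmfM => //; exact: bmf_cst].
by rewrite -/a -/b; nra.
Qed.

(** Primes outside [J] contribute factors at most 1, so the bound holds with the same [B] for every
    [N] beyond the largest prime of [J]. *)
Lemma partial_sum_characteristic_decay (m : nat) : exists2 B : R, 0 < B &
  forall r alpha, 1 <= r -> t != 0 \/ `|cos alpha| = 1 ->
  \forall N \near \oo, forall a,
    (\int[P]_x cos (a + r * \sum_(0 <= p < N | prime p) prime_elog sigma t alpha p (X p x))) ^+ 2
    <= B / r ^+ m.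
Proof.
have [C hC] := C1; have d0 := delta0; have s2 := sigma2.
(* [K'] collects the three error constants of the estimate at one prime. In [K], the part 8 K' /
   delta makes the errors at most half of the gain delta c^2 / 4, and the part 64 gives 64 y^2 <=
   1. *)
pose K' : R := 66 + 16 * C ^+ 2 + 8192.
have K'0 : 0 < K' by rewrite /K'; have := sqr_ge0 C; lra.
pose K := 8 * K' / delta + 64.
have K0 : 0 < K by rewrite ltr_wpDl// divr_ge0 ?mulr_ge0// ltW.
have k0 : 0 < delta / 8 by rewrite divr_gt0.
have [B B0 HB] := @prime_phase_decay R sigma t K (delta / 8) m s2 K0 k0.
exists B => // r alpha r1 ta; have [J [uJ pJ HJ prodJ]] := HB r alpha r1 ta.
have r0 : 0 <= r by rewrite (le_trans ler01).
exists (\max_(p <- J) p).+1 => // N /= JN a.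
have JN' p : p \in J -> (p < N)%N.
  by move=> /= pJ'; apply: leq_trans JN; rewrite ltnS; exact: (@leq_bigmax_seq _ _ xpredT id).
pose L := [seq p <- index_iota 0 N | prime p].
have uL : uniq L by rewrite filter_uniq// iota_uniq.
have pL : all prime L by exact: filter_all.
pose Y p y := r * prime_elog sigma t alpha p y.
have mY p : measurable_fun setT (Y p).
  by apply: measurable_funM => //; exact: measurable_prime_elog.
pose rho p := if p \in J then expR (- (delta / 8 * (r * p%:R `^ (- sigma)) ^+ 2 *
          cos (t * ln p%:R + alpha) ^+ 2)) else 1.
have rhoP p : p \in L -> (\int[P]_x cos (Y p (X p x))) ^+ 2 + (\int[P]_x sin (Y p (X p x))) ^+ 2 <= rho p.
  move=> pLp; have pp : prime p by move/allP: pL; exact.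
  rewrite /rho; case: ifP => pJp; last first.
    by apply: expectation_cos2_sin2_le1; exact: measurableT_comp.
  have q34 := prime_powR_le34 s2 pp.
  have q2 : (p%:R `^ (- sigma)) ^+ 2 <= p%:R `^ (- 2^-1) :> R.
    by rewrite sqr_powR ler_prime_powR//; lra.
  have c2 : (C * p%:R `^ (- 4^-1)) ^+ 2 = C ^+ 2 * p%:R `^ (- 2^-1).
    by rewrite exprMn sqr_powR; congr (_ * _ `^ _); field.
  have := HJ p pJp.
  set z := p%:R `^ (- 2^-1) in q2 c2 *; set q := p%:R `^ (- sigma) in q34 q2 *.
  set y := r * q; set c := cos _ => cz.
  have z0 : 0 <= z by exact: powR_ge0.
  have c1 : c ^+ 2 <= 1 by rewrite -[c ^+ 2]real_normK ?num_real// expr_le1// cos_max.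
  have y2 := sqr_ge0 y; have cc := sqr_ge0 c.
  have y64 : 64 * y ^+ 2 <= 1.
    apply: le_trans c1; apply: le_trans cz.
    apply: (@le_trans _ _ (K * y ^+ 2)).
      by rewrite ler_wpM2r// /K lerDr divr_ge0 ?mulr_ge0// ltW.
    by rewrite ler_wpM2l ?(ltW K0)// lerDr.
  have czK : K' * (z + y ^+ 2) <= delta / 8 * c ^+ 2.
    have : 8 * K' / delta * (z + y ^+ 2) <= c ^+ 2.
      by apply: le_trans cz; rewrite ler_wpM2r ?addr_ge0// /K lerDl.
    have E k s : delta / 8 * (8 * k / delta * s) = k * s by field; rewrite gt_eqF.
    by rewrite -(ler_pM2l k0) E.
  have := @elog_characteristic_le _ _ _ P (X p) delta (C * p%:R `^ (- 4^-1)) r q (t * ln p%:R) alpha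
    (mX p) (hC p pp) (C2 pp) r0 q34 y64.
  have YE x : Y p (X p x) = r * elog q (t * ln p%:R) alpha (X p x) by rewrite /Y /prime_elog pp.
  under eq_Rintegral do rewrite -YE.
  under [X in _ + X ^+ 2 <= _]eq_Rintegral do rewrite -YE.
  rewrite -/y -/c c2 => H; apply: (le_trans H).
  apply: le_trans (expR_ge1Dx _); rewrite (_ : delta / 8 * _ * _ = y ^+ 2 * (delta / 8 * c ^+ 2)); last by ring.
  rewrite lerD2l lerN2 ler_wpM2l//.
  have Q : 16 * (C ^+ 2 * z) + 66 * q ^+ 2 + 8192 * y ^+ 2 <= K' * (z + y ^+ 2).
    rewrite /K'; have := sqr_ge0 C; move: (C ^+ 2) (y ^+ 2) y2 (q ^+ 2) q2 => C2' Y2 Y20 Q2 Q2z C20; nra.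
  move: (c ^+ 2) cc czK => w w0 czK.
  by move: Q; set kk := K' * _ in czK *; move: (C ^+ 2 * z) => ww; lra.
have key := expectation_cos_sum_le mX indX mY a uL pL rhoP.
have -> : \int[P]_x cos (a + r * \sum_(0 <= p < N | prime p) prime_elog sigma t alpha p (X p x)) =
    \int[P]_x cos (a + \sum_(i <- L) Y i (X i x)).
  by apply: eq_Rintegral => x _; rewrite mulr_sumr big_filter.
apply: (le_trans key); apply: le_trans prodJ.
have pJL : perm_eq [seq p <- L | p \in J] J.
  apply: uniq_perm => // [|p]; first exact: filter_uniq.
  rewrite !mem_filter mem_index_iota leq0n/=; apply/idP/idP => [/andP[]//|pJp].
  by rewrite pJp JN'// andbT; move/allP: pJ; exact.
by rewrite /rho -big_mkcond/= -big_filter (perm_big _ pJL).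
Qed.

(** For t = 0 the imaginary part is zero and nothing decays in xi2, hence the alternative. Decay in
    r becomes decay in each coordinate because the inversion kernel on the plane is a product. *)
Lemma characteristic_decay (S1 S2 : T -> R) :
  measurable_fun setT S1 -> measurable_fun setT S2 ->
  (\forall x \ae P, (fun N => \sum_(0 <= p < N | prime p) prime_elog sigma t 0 p (X p x)) @ \oo
     --> S1 x) ->
  (\forall x \ae P, (fun N => \sum_(0 <= p < N | prime p) prime_elog sigma t (pi / 2) p (X p x)) @ \oo
     --> S2 x) ->
  exists C, forall xi1 xi2 a, t != 0 \/ xi2 = 0 ->
    `|\int[P]_x cos (a - (xi1 * S1 x + xi2 * S2 x))| <=
    C * (((1 + xi1 ^+ 2)^-1) ^+ 2 * ((1 + xi2 ^+ 2)^-1) ^+ 2).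
Proof.
(* For r >= 1, (1 + xi1^2) (1 + xi2^2) <= 4 r^4, and the square of the target weight is the inverse
   fourth power of the left side: hence 16, with a loss of 4^4 = 256 = 16^2. For r < 1 the weight
   itself is at least 1/16. *)
move=> mS1 mS2 cS1 cS2; have [B B0 HB] := partial_sum_characteristic_decay 16.
exists (16 * (1 + B)) => xi1 xi2 a txi.
have [r [alpha [r0 r2 xi1E xi2E]]] := polar_coordinates xi1 xi2.
set w1 := (1 + xi1 ^+ 2)^-1; set w2 := (1 + xi2 ^+ 2)^-1.
have h1 : 0 < 1 + xi1 ^+ 2 by rewrite ltr_pwDl ?sqr_ge0.
have h2 : 0 < 1 + xi2 ^+ 2 by rewrite ltr_pwDl ?sqr_ge0.
pose Z x := cos (a - (xi1 * S1 x + xi2 * S2 x)).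
have bZ : bmf Z.
  apply: bmf_comp; first exact: bmf_cos.
  by apply: measurable_funB => //; apply: measurable_funD; exact: measurable_funM.
have ww0 : 0 <= w1 ^+ 2 * w2 ^+ 2 by rewrite mulr_ge0 ?sqr_ge0.
have wwE : w1 ^+ 2 * w2 ^+ 2 = (((1 + xi1 ^+ 2) * (1 + xi2 ^+ 2)) ^+ 2)^-1.
  by rewrite /w1 /w2 !exprMn invfM !exprVn.
have [r1|r1] := ltP r 1.
  apply: (@le_trans _ _ 1); first by apply: bmfE_norm => // x; exact: cos_max.
  suff l16 : 16^-1 <= w1 ^+ 2 * w2 ^+ 2.
    have : 0 <= B * (w1 ^+ 2 * w2 ^+ 2) by rewrite mulr_ge0// ltW.
    by move: l16; move: (w1 ^+ 2 * w2 ^+ 2) => w; lra.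
  rewrite wwE lef_pV2 ?posrE ?exprn_gt0 ?mulr_gt0//.
  have r21 : r ^+ 2 <= 1 by rewrite expr_le1// ltW.
  have x1 : 1 + xi1 ^+ 2 <= 2 by have := sqr_ge0 xi2; lra.
  have x2 : 1 + xi2 ^+ 2 <= 2 by have := sqr_ge0 xi1; lra.
  have : (1 + xi1 ^+ 2) * (1 + xi2 ^+ 2) <= 4.
    have -> : 4 = 2 * 2 :> R by lra.
    by apply: ler_pM => //; exact: ltW.
  rewrite -(@ler_pXn2r _ 2) ?nnegrE ?mulr_ge0 ?(ltW h1) ?(ltW h2)//.
  by move=> /le_trans; apply; lra.
have rp : 0 < r by rewrite (lt_le_trans ltr01).
have ta : t != 0 \/ `|cos alpha| = 1.
  case: txi => [t0|z]; [by left|right].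
  have /eqP : r * sin alpha = 0 by rewrite -xi2E.
  rewrite mulf_eq0 gt_eqF//= => /eqP sa0.
  have := cos2Dsin2 alpha; rewrite sa0 expr0n/= addr0 => c1.
  by apply/eqP; rewrite -(@eqrXn2 _ 2)// ?expr1n ?real_normK ?num_real ?c1.
(* The bound on partial sums is uniform in the shift and in large [N], so it passes to the limit;
   the argument changes sign, cosine being even. *)
have Zcvg : (fun N => \int[P]_x cos (- a + r * \sum_(0 <= p < N | prime p)
    prime_elog sigma t alpha p (X p x))) @ \oo --> \int[P]_x Z x.
  pose F N x := cos (- a + r * \sum_(0 <= p < N | prime p) prime_elog sigma t alpha p (X p x)).
  have mF N : measurable_fun setT (F N).
    apply: (measurableT_comp (continuous_measurable_fun (@continuous_cos R))).
    apply: measurable_funD => //; apply: measurable_funM => //.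
    rewrite [X in measurable_fun _ X](_ : _ = (fun x => \sum_(p <- [seq p <- index_iota 0 N | prime p])
      prime_elog sigma t alpha p (X p x))); last by apply/funext => x; rewrite big_filter.
    apply: measurable_sum => p; apply: measurableT_comp => //.
    exact: measurable_prime_elog.
  have [_ _ H] : [/\ P.-integrable setT (EFin \o Z),
     (\int[P]_x `|(F n x)%:E - (Z x)%:E| @[n --> \oo] --> 0)%E &
     (\int[P]_x (F n x)%:E @[n --> \oo] --> \int[P]_x (Z x)%:E)%E].
    apply: (@dominated_convergence _ _ _ P setT measurableT (fun n x => (F n x)%:E)
      (EFin \o Z) (cst 1%E)) => //.
    - by move=> n; exact/measurable_EFinP.
    - by apply/measurable_EFinP; have [] := bZ.
    - apply: filterS2 cS1 cS2 => x c1 c2 _; apply: cvg_EFin; first exact: nearW.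
      have -> : Z x = cos (- a + r * (cos alpha * S1 x + sin alpha * S2 x)).
        rewrite /Z -cosN; congr cos; rewrite xi1E xi2E; ring.
      apply: continuous_cvg; first exact: continuous_cos.
      apply: cvgD; [exact: cvg_cst|apply: cvgM; first exact: cvg_cst].
      rewrite (_ : (fun N => _) = (fun N =>
        cos alpha * (\sum_(0 <= p < N | prime p) prime_elog sigma t 0 p (X p x)) +
        sin alpha * (\sum_(0 <= p < N | prime p) prime_elog sigma t (pi / 2) p (X p x)))).
        by apply: cvgD; (apply: cvgM; [exact: cvg_cst|]).
      apply/funext => N; rewrite !mulr_sumr -big_split/=; apply: eq_bigr => p _.
      exact: prime_elog_phase.
    - exact: finite_measure_integrable_cst.
    - by apply: aeW => x n _; rewrite lee_fin cos_max.
  have Zfin : (\int[P]_x (Z x)%:E \is a fin_num)%E.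
    exact: (integrable_fin_num measurableT (bmf_integrable P bZ)).
  by rewrite -(fineK Zfin) in H; have := fine_cvg H; apply.
have : (\int[P]_x Z x) ^+ 2 <= B / r ^+ 16.
  have Zcvg2 := cvgM Zcvg Zcvg; have {}Zcvg2 := Zcvg2 eventually_filter.
  have H := ler_cvg_to Zcvg2 (cvg_cst (B / r ^+ 16)).
  rewrite expr2; apply: H.
  by apply: filterS (HB r alpha r1 ta) => N /(_ (- a)); rewrite expr2.
move=> ZB.
rewrite -(@ler_pXn2r _ 2) ?nnegrE//; last by rewrite mulr_ge0// mulr_ge0// addr_ge0// ltW.
rewrite real_normK ?num_real//; apply: (le_trans ZB).
have ww2 : (w1 ^+ 2 * w2 ^+ 2) ^+ 2 = ((1 + xi1 ^+ 2) * (1 + xi2 ^+ 2))^-1 ^+ 4.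
  by rewrite wwE -exprVn -exprM.
rewrite exprMn ww2.
have r4 : (1 + xi1 ^+ 2) * (1 + xi2 ^+ 2) <= 4 * r ^+ 4.
  have -> : r ^+ 4 = (xi1 ^+ 2 + xi2 ^+ 2) ^+ 2 by rewrite -r2 -exprM.
  have : 1 <= xi1 ^+ 2 + xi2 ^+ 2 by rewrite -r2 exprn_ege1.
  have := sqr_ge0 xi1; have := sqr_ge0 xi2.
  by move: (xi1 ^+ 2) (xi2 ^+ 2) => u v; nra.
have {}r4 : (r ^+ 16)^-1 <= 256 * ((1 + xi1 ^+ 2) * (1 + xi2 ^+ 2))^-1 ^+ 4.
  have W0 : 0 < (1 + xi1 ^+ 2) * (1 + xi2 ^+ 2) by rewrite mulr_gt0.
  move: ((1 + xi1 ^+ 2) * (1 + xi2 ^+ 2)) W0 r4 => W W0 r4.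
  have -> : 256 * W^-1 ^+ 4 = ((W / 4) ^+ 4)^-1 by field; rewrite gt_eqF.
  rewrite lef_pV2 ?posrE ?exprn_gt0 ?divr_gt0// (_ : 16 = 4 * 4)%N// exprM.
  by rewrite ler_pXn2r ?nnegrE ?divr_ge0 ?exprn_ge0 ?(ltW W0)// ler_pdivrMr// mulrC.
apply: (@le_trans _ _ (B * (256 * ((1 + xi1 ^+ 2) * (1 + xi2 ^+ 2))^-1 ^+ 4))).
  by rewrite ler_wpM2l// ltW.
rewrite mulrA ler_wpM2r ?exprn_ge0 ?invr_ge0 ?mulr_ge0 ?(ltW h1) ?(ltW h2)//.
by rewrite exprMn; nra.
Qed.

End characteristic_decay.

(** * Almost sure convergence of the logarithm of the Euler product *)

Section almost_sure_convergence.
Context d (T : measurableType d) (R : realType) (P : probability T R).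
Variables (X : nat -> T -> R) (sigma t : R).
Hypothesis mX : forall p, measurable_fun setT (X p).
Hypothesis indX : mutually_independent P prime X.
Hypothesis sigma2 : 2^-1 < sigma.
Hypothesis C1 : forall eps : R, 0 < eps -> exists C : R, forall p, prime p ->
  `|\int[P]_x cos (X p x)| <= C * p%:R `^ (- 2^-1 + eps).

Lemma prime_elog_le beta p y : prime p ->
  `|prime_elog sigma t beta p y| <= 8 * p%:R `^ (- sigma).
Proof.
by move=> pp; rewrite /prime_elog pp; apply: elog_le; exact: prime_powR_le34.
Qed.

Lemma bmf_prime_elog beta p : bmf (prime_elog sigma t beta p).
Proof.
split; first exact: measurable_prime_elog.
exists (8 * p%:R `^ (- sigma)) => y; have [pp|npp] := boolP (prime p).
  exact: prime_elog_le.
by rewrite /prime_elog (negPf npp) normr0 mulr_ge0 ?powR_ge0.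
Qed.

Lemma ae_cvg_prime_elog beta :
  \forall x \ae P, cvgn (fun N => \sum_(0 <= p < N | prime p) prime_elog sigma t beta p (X p x)).
Proof.
(* With sigma = 1/2 + 2 kappa, the second moments are of order p^(-2 sigma) <= p^(-1 - kappa), and
   (C1) with eps = kappa bounds the mean of the main term by a multiple of p^(- sigma - 1/2 + kappa)
   = p^(-1 - kappa). *)
have s2 := sigma2; pose kappa := (sigma - 2^-1) / 2.
have k0 : 0 < kappa by rewrite /kappa; lra.
have [C hC] := C1 k0.
(* 64 is the square of the bound 8 q; 4 and 2 |C| bound the mean of the error and of the main
   term. *)
pose A := 68 + 2 * `|C|; have A1 : 1 <= A by rewrite /A; have := normr_ge0 C; lra.
have q2 p : prime p -> (p%:R `^ (- sigma)) ^+ 2 <= p%:R `^ (- 1 - kappa) :> R.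
  by move=> pp; rewrite sqr_powR ler_prime_powR// /kappa; lra.
apply: (@ae_cvg_prime_series _ _ _ P X (prime_elog sigma t beta) A kappa mX indX
  (bmf_prime_elog beta) k0 A1) => [p y pp|p pp].
  rewrite -real_normK ?num_real//.
  apply: (@le_trans _ _ ((8 * p%:R `^ (- sigma)) ^+ 2)).
    by rewrite ler_pXn2r ?nnegrE ?mulr_ge0 ?powR_ge0//; exact: prime_elog_le.
  rewrite exprMn; apply: ler_pM; rewrite ?sqr_ge0 ?q2//.
  by rewrite /A; have := normr_ge0 C; lra.
have q34 := prime_powR_le34 s2 pp.
pose c := 2 * p%:R `^ (- sigma) * cos (t * ln p%:R + beta).
have bcX : bmf (fun x => c * cos (X p x)).
  by apply: bmfM; [exact: bmf_cst|exact: (bmf_comp (bmf_cos R) (mX p))].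
have bE : bmf (fun x => prime_elog sigma t beta p (X p x)).
  exact: (bmf_comp (bmf_prime_elog beta p) (mX p)).
have h1 : `|\int[P]_x (prime_elog sigma t beta p (X p x) - c * cos (X p x))| <=
    4 * (p%:R `^ (- sigma)) ^+ 2.
  apply: bmfE_norm; first exact: bmfB.
  move=> x; rewrite /prime_elog pp.
  have := elog_approx (t * ln p%:R) beta (X p x) q34.
  by congr (`|_ - _| <= _); rewrite /c; ring.
have h2 : `|\int[P]_x (c * cos (X p x))| <= 2 * `|C| * p%:R `^ (- 1 - kappa).
  rewrite bmfEZ; last exact: (bmf_comp (bmf_cos R) (mX p)).
  rewrite normrM; apply: (@le_trans _ _ (2 * p%:R `^ (- sigma) * (`|C| * p%:R `^ (- 2^-1 + kappa)))).
    apply: ler_pM; rewrite ?normr_ge0//.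
      have q0 : 0 <= 2 * p%:R `^ (- sigma) :> R by rewrite mulr_ge0 ?powR_ge0.
      by rewrite /c normrM (ger0_norm q0) ler_piMr// cos_max.
    by rewrite (le_trans (hC p pp))// ler_wpM2r ?powR_ge0// ler_norm.
  rewrite (_ : 2 * p%:R `^ (- sigma) * _ = 2 * `|C| * (p%:R `^ (- sigma) * p%:R `^ (- 2^-1 + kappa))); last by ring.
  rewrite -powRD; last by rewrite pnatr_eq0 -lt0n prime_gt0// implybT.
  rewrite (_ : - sigma + _ = - 1 - kappa)// /kappa; lra.
rewrite bmfEB// in h1.
rewrite -[leLHS](subrK (`|\int[P]_x (c * cos (X p x))|)).
apply: (@le_trans _ _ (4 * p%:R `^ (- 1 - kappa) + 2 * `|C| * p%:R `^ (- 1 - kappa))).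
  apply: lerD => //; apply: le_trans (lerB_dist _ _) _.
  by apply: (le_trans h1); rewrite ler_wpM2l// q2.
by rewrite -mulrDl ler_wpM2r ?powR_ge0// /A; have := normr_ge0 C; lra.
Qed.

End almost_sure_convergence.

(** * Complex limits and Borel sets *)

Section convergence_set.
Context d (T : measurableType d) (R : realType).

(** The Cauchy criterion with countable quantifiers only, so that the set of convergence is visibly
    measurable. *)
Lemma cvgn_cauchyP (u : R ^nat) : cvgn u <->
  forall k : nat, exists N : nat, forall n, (N <= n)%N -> `|u n - u N| <= k.+1%:R^-1.
Proof.
have inv0 k : 0 < k.+1%:R^-1 :> R by rewrite invr_gt0.
split=> [cu k|H].
  have k2 : 0 < k.+1%:R^-1 / 2 :> R by rewrite divr_gt0.
  have [N _ HN] := (@cvgrPdist_le _ _ _ _ _ u (limn u)).1 cu _ k2.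
  exists N => n Nn; have h1 := HN n Nn; have h2 := HN N (leqnn N).
  have := ler_distD (limn u) (u n) (u N); rewrite [`|u n - limn u|]distrC.
  by move: h1 h2 => /=; move: (k.+1%:R^-1) => z; lra.
apply/cauchy_cvgP/cauchy_exP => e e0.
have [N _ HN] := (@cvgrPdist_lt _ _ _ _ _ (@harmonic R) 0).1 (@cvg_harmonic R) _ e0.
have [M HM] := H N; exists (u M), M => // n /= Mn.
rewrite /ball/= distrC (le_lt_trans (HM n Mn))//.
by have := HN N (leqnn N); rewrite sub0r normrN /harmonic/= gtr0_norm.
Qed.

Lemma measurable_cvg_set (f : nat -> T -> R) : (forall n, measurable_fun setT (f n)) ->
  measurable [set x | cvgn (f ^~ x)].
Proof.
move=> mf; rewrite (_ : [set x | _] = \bigcap_k \bigcup_N \bigcap_(n in [set n | (N <= n)%N])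
   [set x | `|f n x - f N x| <= k.+1%:R^-1]).
  apply: bigcap_measurable => // k _; apply: bigcup_measurable => N _.
  apply: bigcap_measurable => [|n _]; first by exists N => /=.
  rewrite -[X in measurable X]setTI; apply: measurable_fun_le => //.
  by apply: measurableT_comp => //; exact: measurable_funB.
apply/seteqP; split => x /=.
  by move=> /cvgn_cauchyP H k _; have [N HN] := H k; exists N => // n /= /HN.
move=> H; apply/cvgn_cauchyP => k; have [N _ HN] := H k I; exists N => n Nn.
exact: HN.
Qed.

End convergence_set.

Section complex_plane.
Variable R : realType.
Notation V2 := (measurableTypeR R * measurableTypeR R)%type.

Lemma normc_ge_ReIm (z : R[i]) :
  (`|complex.Re z|%:C <= `|z|) /\ (`|complex.Im z|%:C <= `|z|).
Proof.
rewrite normc_def !lecR -!sqrtr_sqr; split; rewrite ler_wsqrtr//.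
  by rewrite lerDl sqr_ge0.
by rewrite lerDr sqr_ge0.
Qed.

Lemma normc_le_ReIm (z : R[i]) : `|z| <= (`|complex.Re z| + `|complex.Im z|)%:C.
Proof.
rewrite normc_def lecR -(@ler_pXn2r _ 2) ?nnegrE ?addr_ge0 ?sqrtr_ge0//.
rewrite sqr_sqrtr ?addr_ge0 ?sqr_ge0// -(real_normK (num_real (complex.Re z))).
rewrite -(real_normK (num_real (complex.Im z))).
have := mulr_ge0 (normr_ge0 (complex.Re z)) (normr_ge0 (complex.Im z)); nra.
Qed.

Lemma cvg_complex (a b : R ^nat) (la lb : R) : a @ \oo --> la -> b @ \oo --> lb ->
  (fun n => a n +i* b n : R[i]^o) @ \oo --> (la +i* lb : R[i]^o).
Proof.
move=> ca cb; apply/cvgrPdist_lt => -[e e'] /=; rewrite ltcE/= => /andP[/eqP -> e0].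
have e2 : 0 < e / 2 by rewrite divr_gt0.
move/cvgrPdist_lt : ca => /(_ _ e2) ca; move/cvgrPdist_lt : cb => /(_ _ e2) cb.
apply: filterS2 ca cb => n ha hb.
apply: le_lt_trans (normc_le_ReIm _) _.
by rewrite complexr0 ltcR /=; lra.
Qed.

Lemma is_cvg_complex (a b : R ^nat) : cvgn (fun n => a n +i* b n : R[i]^o) ->
  cvgn a /\ cvgn b.
Proof.
move=> /cvg_ex[l cl].
have H (e : R) : 0 < e -> \forall n \near \oo, `|complex.Re l - a n| < e /\ `|complex.Im l - b n| < e.
  move=> e0; have /cvgrPdist_lt/(_ e%:C) := cl; rewrite ltcR => /(_ e0).
  apply: filterS => n /= hn.
  have [h1 h2] := normc_ge_ReIm (l - (a n +i* b n)).
  move: (le_lt_trans h1 hn) (le_lt_trans h2 hn); rewrite !ltcR.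
  by case: l {cl hn h1 h2}.
split; apply/cvg_ex.
  by exists (complex.Re l); apply/cvgrPdist_lt => e /H; apply: filterS => n [].
by exists (complex.Im l); apply/cvgrPdist_lt => e /H; apply: filterS => n [].
Qed.

(** Every open set is a countable union of open squares with rational centre and half-side 1 / (k +
    1), and such squares are measurable in the product. *)
Lemma measurable_borelC (A : set R[i]) : borelC A ->
  measurable [set z : V2 | A (z.1 +i* z.2)].
Proof.
pose f (z : V2) : R[i]^o := z.1 +i* z.2.
rewrite /borelC.
suff : <<s [set U : set R[i]^o | open U] >> `<=` image_set_system setT f measurable.
  by move=> H /H; rewrite /image_set_system/= setTI.
apply: smallest_sub.
  apply: sigma_algebra_image; exact: sigma_algebra_measurable.
move=> U oU; rewrite /image_set_system/= setTI.
pose B (abk : rat * rat * nat) : set V2 :=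
  `](ratr abk.1.1 - abk.2.+1%:R^-1), (ratr abk.1.1 + abk.2.+1%:R^-1)[ `*`
  `](ratr abk.1.2 - abk.2.+1%:R^-1), (ratr abk.1.2 + abk.2.+1%:R^-1)[.
rewrite (_ : f @^-1` U = \bigcup_(i in [set i | B i `<=` f @^-1` U]) B i).
  rewrite bigcup_mkcond; apply: countable_bigcupT_measurable => // i.
  by case: ifP => // _; exact: measurableX.
apply/seteqP; split=> [[u v] Uuv|z [i Bi]]; last exact: Bi.
have /nbhs_ballP[[e e'] /=] : nbhs (f (u, v)) U by exact: open_nbhs_nbhs.
rewrite ltcE/= => /andP[/eqP -> e0] ballU.
(* Two points of such a square differ by less than 2 / (k + 1) in each coordinate, and the modulus
   is at most the sum of both. *)
have [k hk] : exists k : nat, 4 * k.+1%:R^-1 < e.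
  have e4 : 0 < e / 4 by rewrite divr_gt0.
  have [N _ HN] := (@cvgrPdist_lt _ _ _ _ _ (@harmonic R) 0).1 (@cvg_harmonic R) _ e4.
  exists N; have := HN N (leqnn N); rewrite sub0r normrN /harmonic/= gtr0_norm ?invr_gt0//.
  by move: (N.+1%:R^-1) => z; lra.
have k0 : 0 < k.+1%:R^-1 :> R by rewrite invr_gt0.
have near_rat (w : R) : exists q : rat, w - k.+1%:R^-1 < ratr q < w + k.+1%:R^-1.
  have /rat_in_itvoo[q] : w - k.+1%:R^-1 < w + k.+1%:R^-1.
    by move: (k.+1%:R^-1) k0 => z; lra.
  by rewrite in_itv/=; exists q.
have [a /andP[a1 a2]] := near_rat u; have [b /andP[b1 b2]] := near_rat v.
exists (a, b, k) => /=; last first.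
  rewrite /B/= !in_itv/=; move: (k.+1%:R^-1) (ratr a) (ratr b) a1 a2 b1 b2 => z x y *.
  by split; apply/andP; split; lra.
move=> [u' v']; rewrite /B/= !in_itv/= => -[/andP[c1 c2] /andP[d1 d2]].
apply: ballU; rewrite /ball/=.
apply: le_lt_trans (normc_le_ReIm _) _; rewrite complexr0 ltcR /=.
have : `|u - u'| < 2 * k.+1%:R^-1.
  rewrite ltr_norml; move: (k.+1%:R^-1) (ratr a) a1 a2 c1 c2 => z x *.
  by apply/andP; split; lra.
have : `|v - v'| < 2 * k.+1%:R^-1.
  rewrite ltr_norml; move: (k.+1%:R^-1) (ratr b) b1 b2 d1 d2 => z x *.
  by apply/andP; split; lra.
by move: (k.+1%:R^-1) hk => z; lra.
Qed.

End complex_plane.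

Section almost_sure_limit.
Context d (T : measurableType d) (R : realType) (P : probability T R).
Notation V2 := (measurableTypeR R * measurableTypeR R)%type.

Lemma probability_eq_on (D E F : set T) : measurable D -> P (~` D) = 0%E ->
  measurable E -> measurable F -> E `&` D = F `&` D -> P E = P F.
Proof.
move=> mD PD mE mF EF.
have H A : measurable A -> P A = P (A `&` D).
  move=> mA; suff PAD : P (A `\` D) = 0%E.
    by rewrite [LHS](measureDI P mA mD) [X in (X + _)%E]PAD add0e.
  apply: (@subset_measure0 _ _ _ P (A `\` D) (~` D)) => //.
  - exact: measurableD.
  - exact: measurableC.
by rewrite (H E mE) (H F mF) EF.
Qed.

(** Off the convergence set [D] the complex limit is the default [point], so there the event is
    empty or the whole complement of [D]. It is thus measurable, and the null complement does not
    affect its probability. *)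
Lemma ae_limn_complex (f g : nat -> T -> R) :
  (forall n, measurable_fun setT (f n)) -> (forall n, measurable_fun setT (g n)) ->
  (\forall x \ae P, cvgn (f ^~ x)) -> (\forall x \ae P, cvgn (g ^~ x)) ->
  exists F G : T -> R, [/\ measurable_fun setT F, measurable_fun setT G,
    \forall x \ae P, f ^~ x @ \oo --> F x /\ g ^~ x @ \oo --> G x &
    forall B : set R[i], measurable [set z : V2 | B (z.1 +i* z.2)] ->
      P [set x | B (limn (fun n => f n x +i* g n x : R[i]^o))] =
      P [set x | B (F x +i* G x)]].
Proof.
move=> mf mg cf cg.
pose D := [set x | cvgn (f ^~ x)] `&` [set x | cvgn (g ^~ x)].
have mD : measurable D by apply: measurableI; exact: measurable_cvg_set.
have PD : P (~` D) = 0%E.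
  apply: (measure_negligible (measurableC mD)).
  exact: (filterI cf cg).
(* Multiplying by the indicator of [D] makes the sequence converge everywhere, which gives a limit
   measurable on the whole space. *)
have lim_on (h : nat -> T -> R) : (forall n, measurable_fun setT (h n)) ->
    (forall x, D x -> cvgn (h ^~ x)) -> exists H : T -> R,
    measurable_fun setT H /\ forall x, D x -> h ^~ x @ \oo --> H x.
  move=> mh ch; exists (fun x => limn (fun n => h n x * \1_D x)); split.
    apply: (@measurable_fun_cvg _ _ R setT (fun n x => h n x * \1_D x)) => [n|x _].
      by apply: measurable_funM => //; exact: measurable_indic.
    have [Dx|Dx] := boolP (x \in D).
      by rewrite indicE Dx; under eq_fun do rewrite mulr1; apply: ch; rewrite inE in Dx.
    rewrite indicE (negPf Dx); under eq_fun do rewrite mulr0.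
    exact: is_cvg_cst.
  move=> x Dx; rewrite indicE mem_set//; under [X in _ --> limn X]eq_fun do rewrite mulr1.
  exact: ch.
have [F [mF cF]] := lim_on f mf (fun x Dx => Dx.1).
have [G [mG cG]] := lim_on g mg (fun x Dx => Dx.2).
exists F, G; split => //.
  apply: filterS2 cf cg => x fx gx; have Dx : D x by [].
  by split; [exact: cF|exact: cG].
move=> B mB.
pose L x := limn (fun n => f n x +i* g n x : R[i]^o).
have LD x : D x -> L x = F x +i* G x.
  by move=> Dx; apply: cvg_lim => //; apply: cvg_complex; [exact: cF|exact: cG].
have LnD x : ~ D x -> L x = point.
  move=> nDx; apply: dvgP => cL; apply: nDx.
  by have [] := is_cvg_complex cL.
have mFG : measurable [set x | B (F x +i* G x)].
  have mX : measurable_fun setT (fun x => (F x, G x) : V2) by exact/measurable_fun_pairP.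
  by have := mX measurableT _ mB; rewrite setTI.
rewrite -[LHS]/(P [set x | B (L x)]).
apply: (@probability_eq_on D) => //; last first.
  by apply/seteqP; split => x [/= Bx Dx]; split => //; move: Bx; rewrite LD.
rewrite (_ : [set x | _] = ([set x | B (F x +i* G x)] `&` D) `|`
    (~` D `&` [set x | B (point : R[i]^o)])).
  apply: measurableU; first exact: measurableI.
  have [Bp|nBp] := pselect (B (point : R[i]^o)).
    rewrite (_ : [set x | _] = setT) ?setIT; first exact: measurableC.
    by apply/seteqP; split.
  by rewrite (_ : [set x | _] = set0) ?setI0//; apply/seteqP; split.
apply/seteqP; split => x /=.
  move=> BL; have [Dx|Dx] := pselect (D x); first by left; split => //; rewrite -LD.
  by right; split => //; rewrite -(LnD x).
by move=> [[BF Dx]|[Dx Bp]]; [rewrite LD|rewrite LnD].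
Qed.

End almost_sure_limit.

Section euler_factor.
Variable R : realType.

Lemma sum_complex (I : Type) (r : seq I) (Q : pred I) (a b : I -> R) :
  \sum_(i <- r | Q i) (a i +i* b i) =
  (\sum_(i <- r | Q i) a i) +i* (\sum_(i <- r | Q i) b i).
Proof.
elim/big_rec3: _ => [|i y1 y2 y3 _ ->] //; by rewrite /=.
Qed.

(** p^(- m s) has argument - m t log p; its imaginary part involves - sin (m tau), the cosine
    shifted by pi/2, so both parts are instances of [eterm]. *)
Lemma eterm_natpowC (sigma t theta : R) (p m : nat) : prime p ->
  (2 * cos (m%:R * theta) / m%:R)%:C * natpowC p (- (m%:R * (sigma +i* t))) =
  eterm (p%:R `^ (- sigma)) (t * ln p%:R) 0 theta m +i*
  eterm (p%:R `^ (- sigma)) (t * ln p%:R) (pi / 2) theta m.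
Proof.
move=> pp; rewrite /natpowC /cexp /eterm.
have p0 : p%:R != 0 :> R by rewrite pnatr_eq0 -lt0n prime_gt0.
have -> : - (m%:R * (sigma +i* t)) * (ln p%:R)%:C =
    (- (m%:R * sigma * ln p%:R)) +i* (- (m%:R * t * ln p%:R)).
  have -> : (m%:R : R[i]) = (m%:R : R)%:C by rewrite rmorph_nat.
  by apply/eqP; rewrite eq_complex /=; apply/andP; split; apply/eqP; ring.
rewrite /= addr0 cosDpihalf cosN sinN.
have -> : expR (- (m%:R * sigma * ln p%:R)) = (p%:R `^ (- sigma)) ^+ m :> R.
  by rewrite /powR (negPf p0) -expRM_natl; congr expR; ring.
rewrite [m%:R * (t * _)]mulrA.
by apply/eqP; rewrite eq_complex /=; apply/andP; split; apply/eqP; ring.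
Qed.

Lemma limn_euler_factor (sigma t theta : R) (p : nat) : 2^-1 < sigma -> prime p ->
  limn (fun K => \sum_(1 <= m < K)
      (2 * cos (m%:R * theta) / m%:R)%:C * natpowC p (- (m%:R * (sigma +i* t))) : R[i]^o) =
  prime_elog sigma t 0 p theta +i* prime_elog sigma t (pi / 2) p theta.
Proof.
move=> s2 pp; have q34 := prime_powR_le34 s2 pp.
have q01 : 0 <= (p%:R `^ (- sigma) : R) < 1.
  by have /andP[-> q1] := q34; rewrite (le_lt_trans q1)//; lra.
apply: cvg_lim => //; rewrite /prime_elog pp.
have := cvg_complex (@cvg_elog _ _ (t * ln p%:R) 0 theta q01)
  (@cvg_elog _ _ (t * ln p%:R) (pi / 2) theta q01).
rewrite (_ : (fun n => _) = (fun K => \sum_(1 <= m < K)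
      (2 * cos (m%:R * theta) / m%:R)%:C * natpowC p (- (m%:R * (sigma +i* t))) : R[i]^o))//.
apply/funext => K; rewrite /series/= -sum_complex.
case: K => [|K]; first by rewrite !big_geq.
have e0 beta : eterm (p%:R `^ (- sigma)) (t * ln p%:R) beta theta 0 = 0 :> R.
  by rewrite /eterm !(invr0, mulr0, mul0r).
rewrite [LHS]big_ltn//= !e0 [X in X + _](_ : _ = 0) ?add0r//.
by apply: eq_bigr => m _; rewrite eterm_natpowC.
Qed.

End euler_factor.

(** * The law of log L and its density *)

Lemma bmf_expectation d (T : measurableType d) (R : realType) (P : probability T R)
  (f : T -> R) : bmf f -> ('E_P[f] = (\int[P]_x f x)%:E)%E.
Proof.
move=> bf; rewrite unlock /Rintegral fineK//.
exact: (integrable_fin_num measurableT (bmf_integrable P bf)).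
Qed.

Lemma prime_elog_pihalf0 (R : realType) (sigma : R) p y :
  prime_elog sigma 0 (pi / 2) p y = 0.
Proof.
rewrite /prime_elog; case: ifP => // _; rewrite /elog mul0r.
rewrite (_ : series _ = fun=> 0); first exact: lim_cst.
apply/funext => n; rewrite /series/= big1// => m _.
by rewrite /eterm mulr0 add0r cos_pihalf mulr0.
Qed.

Lemma continuous_complex_lipschitz (R : realType) (f : R[i]^o -> R) (K : R) :
  (forall w w', `|f w - f w'| <=
    K * (`|complex.Re w - complex.Re w'| + `|complex.Im w - complex.Im w'|)) ->
  continuous f.
Proof.
move=> fK w; apply/(@cvgrPdist_lt _ _ _ (nbhs w)) => e e0.
have K1 : 0 < `|K| + 1 by rewrite ltr_wpDl.
have k0 : 0 < e / (2 * (`|K| + 1)) by rewrite divr_gt0// mulr_gt0.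
apply/nbhs_ballP; exists (e / (2 * (`|K| + 1)))%:C => [|w' ww' /=]; first by rewrite /= ltcR.
have [g1 g2] := normc_ge_ReIm (w - w').
move: (le_lt_trans g1 ww') (le_lt_trans g2 ww'); rewrite !ltcR.
have -> : complex.Re (w - w') = complex.Re w - complex.Re w' by case: w {g1 g2 ww'}; case: w'.
have -> : complex.Im (w - w') = complex.Im w - complex.Im w' by case: w {g1 g2 ww'}; case: w'.
move=> h1 h2; apply: le_lt_trans (fK _ _) _.
apply: (@le_lt_trans _ _ ((`|K| + 1) *
    (`|complex.Re w - complex.Re w'| + `|complex.Im w - complex.Im w'|))).
  by rewrite ler_wpM2r// (le_trans (ler_norm _))// lerDl.
rewrite -ltr_pdivlMl//; apply: lt_le_trans (ltrD h1 h2) _.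
rewrite le_eqVlt; apply/orP; left; apply/eqP.
by move: (`|K| + 1) K1 => l l0; field; rewrite gt_eqF.
Qed.

(** Both cases of the theorem start here: the law of [logL] is that of a pair of measurable real
    limits, to which the inversion on the plane applies for t <> 0 and that on the line for t =
    0. *)
Lemma logL_law (R : realType) (d : measure_display) (T : measurableType d)
    (P : probability T R) (Theta : nat -> T -> R) (sigma t : R) :
  (forall p, measurable_fun setT (Theta p)) ->
  mutually_independent P prime Theta ->
  (forall eps : R, 0 < eps -> exists C : R, forall p, prime p ->
    `|\int[P]_x cos (Theta p x)| <= C * p%:R `^ (- 2^-1 + eps)) ->
  (exists2 delta : R, 0 < delta & forall p, prime p ->
    delta <= \int[P]_x (cos (Theta p x) ^+ 2)) ->
  2^-1 < sigma ->
  exists F G : T -> R, [/\ measurable_fun setT F, measurable_fun setT G,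
    exists C, forall xi1 xi2 a, t != 0 \/ xi2 = 0 ->
      `|\int[P]_x cos (a - (xi1 * F x + xi2 * G x))| <=
      C * (((1 + xi1 ^+ 2)^-1) ^+ 2 * ((1 + xi2 ^+ 2)^-1) ^+ 2),
    t = 0 -> \forall x \ae P, G x = 0 &
    forall B : set R[i], measurable [set z : measurableTypeR R * measurableTypeR R | B (z.1 +i* z.2)] ->
      P [set x | B (logL Theta (sigma +i* t) x)] = P [set x | B (F x +i* G x)]].
Proof.
move=> mX indX C1 [delta delta0 C2] s2.
pose S beta N x := \sum_(0 <= p < N | prime p) prime_elog sigma t beta p (Theta p x).
have mS beta N : measurable_fun setT (S beta N).
  rewrite (_ : S beta N = (fun x => \sum_(p <- [seq p <- index_iota 0 N | prime p])
    prime_elog sigma t beta p (Theta p x))); last by apply/funext => x; rewrite big_filter.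
  apply: measurable_sum => p; apply: measurableT_comp => //.
  exact: measurable_prime_elog.
have cS beta : \forall x \ae P, cvgn (S beta ^~ x) by exact: ae_cvg_prime_elog.
have [F [G [mF mG cFG lawE]]] := ae_limn_complex (mS 0) (mS (pi / 2)) (cS 0) (cS (pi / 2)).
exists F, G; split => //.
- apply: (@characteristic_decay _ _ _ P Theta sigma t delta) => //.
  (* The choice eps = 1/4 turns the exponent -1/2 + eps into -1/4. *)
  + have [C HC] := C1 4^-1 ltac:(by rewrite invr_gt0).
    exists C => p pp; have := HC p pp; congr (_ <= _ * _ `^ _); lra.
  + by apply: filterS cFG => x [].
  + by apply: filterS cFG => x [].
- move=> t0; apply: filterS cFG => x [_ cG].
  apply: (cvg_unique _ cG) => //.
  rewrite (_ : S (pi / 2) ^~ x = fun=> 0); first exact: cvg_cst.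
  by apply/funext => N; rewrite /S big1// => p _; rewrite t0 prime_elog_pihalf0.
move=> B mB; rewrite -lawE//.
have E x : logL Theta (sigma +i* t) x = limn (fun N => S 0 N x +i* S (pi / 2) N x : R[i]^o).
  rewrite /logL (_ : (fun N => \sum_(0 <= p < N | prime p) _) =
    (fun N => S 0 N x +i* S (pi / 2) N x))//.
  apply/funext => N; rewrite /S -sum_complex.
  by apply: eq_bigr => p pp; rewrite limn_euler_factor.
by under eq_set do rewrite E.
Qed.

Theorem theorem1p1 (R : realType) (d : measure_display) (T : measurableType d)
    (P : probability T R) (Theta : nat -> {RV P >-> R})
    (Theta_range : forall p, prime p -> forall x, 0 <= Theta p x <= pi)
    (Theta_indep :
      mutually_independent P prime (fun p => Theta p : T -> R))
    (C1 : forall eps : R, 0 < eps -> exists C : R, forall p, prime p ->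
      (`| 'E_P[fun x => cos (Theta p x)] | <=
        (C * p%:R `^ (- 2^-1 + eps))%:E)%E)
    (C2 : exists2 delta : R, 0 < delta & forall p, prime p ->
      (delta%:E <= 'E_P[fun x => (cos (Theta p x) ^+ 2)%R])%E) :
  (forall s : R[i], 2^-1 < complex.Re s -> complex.Im s != 0 ->
    exists M : R[i]^o -> R,
      [/\ continuous M,
          forall w, 0 <= M w &
          forall A : set R[i], borelC A ->
            P [set x | A (logL Theta s x)] = integral_dw A M]) /\
  (forall sigma : R, 2^-1 < sigma ->
    exists M : R -> R,
      [/\ continuous M,
          forall u, 0 <= M u &
          forall A : set R, measurable A ->
            P [set x | ([set u%:C | u in A]) (logL Theta sigma%:C x)] =
            integral_du A M]).
Proof.
have mX p : measurable_fun setT (Theta p) by [].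
have bcos p : bmf (fun x => cos (Theta p x)) by exact: (bmf_comp (bmf_cos R) (mX p)).
have c1 (eps : R) : 0 < eps -> exists C : R, forall p, prime p ->
    `|\int[P]_x cos (Theta p x)| <= C * p%:R `^ (- 2^-1 + eps).
  move=> /C1[C HC]; exists C => p /HC.
  by rewrite (bmf_expectation P (bcos p)) lee_fin.
have c2 : exists2 delta : R, 0 < delta & forall p, prime p ->
    delta <= \int[P]_x (cos (Theta p x) ^+ 2).
  have [delta d0 H] := C2; exists delta => // p /H.
  by rewrite (bmf_expectation P (bmfM (bcos p) (bcos p))) lee_fin.
have law sigma t s2 := @logL_law R d T P (fun p => Theta p) sigma t mX Theta_indep c1 c2 s2.
have pi2 : 0 < 2 * pi :> R by rewrite mulr_gt0// pi_gt0.
split.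
  move=> [sigma t] /= s2 t0.
  have [F [G [mF mG [C decay] _ lawE]]] := law sigma t s2.
  have [M [mM [L ML] M0 HM]] := lipschitz_density2 mF mG
    (fun xi1 xi2 a => decay xi1 xi2 a (or_introl t0)).
  (* The factor 2 pi undoes the normalisation of |dw|. *)
  exists (fun w => 2 * pi * M (complex.Re w, complex.Im w)); split.
  - apply: (@continuous_complex_lipschitz _ _ (2 * pi * L)) => w w'.
    by rewrite -mulrBr normrM gtr0_norm// -[leRHS]mulrA ler_wpM2l ?(ltW pi2)// ML.
  - by move=> w; rewrite mulr_ge0// ltW.
  move=> A /measurable_borelC mA.
  rewrite lawE// -[LHS]/(P [set x | [set z | A (z.1 +i* z.2)] (F x, G x)]) HM//.
  rewrite /integral_dw.
  rewrite [X in (_ * X)%E](_ : _ = (2 * pi)%:E * \int[@lebesgue2 R]_(z in [set z | A (z.1 +i* z.2)]) (M z)%:E)%E.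
    by rewrite muleA -EFinM mulVf ?mul1e// gt_eqF.
  rewrite -ge0_integralZl//.
  - by apply: eq_integral => -[u v] _.
  - by apply/measurable_EFinP; exact: measurable_funTS.
  - by move=> z _; rewrite lee_fin.
  - by rewrite lee_fin ltW.
move=> sigma s2.
have [F [G [mF mG [C decay] G0 lawE]]] := law sigma 0 s2.
have XC xi a : `|\int[P]_x cos (a - xi * F x)| <= C * ((1 + xi ^+ 2)^-1) ^+ 2.
  have := decay xi 0 a (or_intror erefl).
  rewrite expr0n/= addr0 invr1 expr1n mulr1.
  by under eq_Rintegral do rewrite mul0r addr0.
have [M [cM M0 HM]] := continuous_density1 mF XC.
have r0 : 0 < Num.sqrt (2 * pi) :> R by rewrite sqrtr_gt0.
exists (fun u => Num.sqrt (2 * pi) * M u); split.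
- by move=> u; apply: cvgM; [exact: cvg_cst|exact: cM].
- by move=> u; rewrite mulr_ge0// ltW.
move=> A mA.
(* In coordinates, the copy of [A] inside the complex plane is the product of [A] with {0}. *)
have mB : measurable [set z : measurableTypeR R * measurableTypeR R |
    [set u%:C | u in A] (z.1 +i* z.2)].
  rewrite (_ : [set z | _] = A `*` [set 0]); first exact: measurableX.
  apply/seteqP; split => [[u v] [w Aw [<- <-]]|[u v] [/= Au ->]] //.
  by exists u.
rewrite lawE//.
(* The two events agree where [G] vanishes, which for t = 0 is almost everywhere. *)
have -> : P [set x | [set u%:C | u in A] (F x +i* G x)] = P (F @^-1` A).
  have mFB : measurable [set x | [set u%:C | u in A] (F x +i* G x)].
    have mFG : measurable_fun setT (fun x => (F x, G x) : measurableTypeR R * measurableTypeR R).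
      exact/measurable_fun_pairP.
    by have := mFG measurableT _ mB; rewrite setTI.
  have mD : measurable [set x | G x = 0].
    rewrite -[X in measurable X]setTI; exact: (mG measurableT [set 0] (measurable_set1 0)).
  apply: (probability_eq_on mD _ mFB).
  - exact: (measure_negligible (measurableC mD) (G0 erefl)).
  - by rewrite -[X in measurable X]setTI; exact: mF.
  - apply/seteqP; split => x [/=]; first by move=> [u Au [<- _]].
    by move=> AF G0x; split => //; exists (F x) => //; rewrite G0x.
rewrite HM// /integral_du.
rewrite [X in (_ * X)%E](_ : _ = (Num.sqrt (2 * pi))%:E * \int[@lebesgue_measure R]_(u in A) (M u)%:E)%E.
  by rewrite muleA -EFinM mulVf ?mul1e// gt_eqF.
rewrite -ge0_integralZl//.
- by apply/measurable_EFinP; apply: measurable_funTS; exact: continuous_measurable_fun.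
- by move=> u _; rewrite lee_fin.
Qed.
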